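(* Let $(P,Q)$ be an irreducible pair in $W$ and let $m,n\in\mathbb{N}$, $m,n>1$, $\gcd(m,n)=1$, with $v_{1,1}(P)/v_{1,1}(Q)=m/n$. Then there exist $\nu\in\mathbb{N}$, an automorphism $\psi$ of $W$, and for $0\le j\le\nu$ integers $l_j\in\mathbb{N}$, elements $P_j,Q_j\in W^{(l_j)}$ and $(\rho_j,\sigma_j)\in\mathfrak V$, and for $1\le j\le\nu$ automorphisms $\varphi_j$ of $W^{(l_j)}$, such that $P_0=\psi(P)$, $Q_0=\psi(Q)$, $l_0=1$, $(1,0)>(\rho_0,\sigma_0)$, $v_{1,1}(P_0)=v_{1,1}(P)$, $v_{1,1}(Q_0)=v_{1,1}(Q)$, and for $j\ge1$: $l_j=\mathrm{lcm}(l_{j-1},\rho_{j-1})$, $P_j=\varphi_j(P_{j-1})$, $Q_j=\varphi_j(Q_{j-1})$ (with $W^{(l_{j-1})}\subseteq W^{(l_j)}$); and moreover: (1) $[Q_j,P_j]=1$ for all $j$; (2) $v_{1,-1}(\mathrm{en}_{\rho_j,\sigma_j}(P_j))<0$ and $v_{1,-1}(\mathrm{en}_{\rho_j,\sigma_j}(Q_j))<0$ for all $j$; (3) $(\rho_j,\sigma_j)\in\mathrm{Val}(P_j)\cap\mathrm{Val}(Q_j)$ for all $j$; (4) $v_{\rho_j,\sigma_j}(P_j)>0$ and $v_{\rho_j,\sigma_j}(Q_j)>0$ for all $j$; (5) $v_{\rho_j,\sigma_j}(P_j)/v_{\rho_j,\sigma_j}(Q_j)=m/n$ for all $j$; (6)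 $\mathrm{en}_{\rho_j,\sigma_j}(P_j)=\frac mn\mathrm{en}_{\rho_j,\sigma_j}(Q_j)$ for all $j$; (7) $(\rho_{j-1},\sigma_{j-1})>(\rho_j,\sigma_j)$ for $1\le j\le\nu$; (8) $v_{\rho_{j-1},\sigma_{j-1}}(P_j)=v_{\rho_{j-1},\sigma_{j-1}}(P_{j-1})$ and $v_{\rho_{j-1},\sigma_{j-1}}(Q_j)=v_{\rho_{j-1},\sigma_{j-1}}(Q_{j-1})$ for $1\le j\le\nu$; (9) $\ell_{\rho'',\sigma''}(P_j)=\ell_{\rho'',\sigma''}(P_{j-1})$ and $\ell_{\rho'',\sigma''}(Q_j)=\ell_{\rho'',\sigma''}(Q_{j-1})$ for $1\le j\le\nu$ and all $(\rho'',\sigma'')\in\mathfrak V$ with $(\rho_{j-1},\sigma_{j-1})<(\rho'',\sigma'')<(-1,1)$; (10) $\mathrm{en}_{\rho_j,\sigma_j}(P_j)=\mathrm{st}_{\rho_{j-1},\sigma_{j-1}}(P_j)$ for $1\le j\le\nu$; (11) for each $1\le j\le\nu$ there is a $(\rho_{j-1},\sigma_{j-1})$-homogeneous $F_{j-1}\in W^{(l_{j-1})}$, not a monomial, with $v_{\rho_{j-1},\sigma_{j-1}}(F_{j-1})=\rho_{j-1}+\sigma_{j-1}$ and $[P_{j-1},F_{j-1}]_{\rho_{j-1},\sigma_{j-1}}=\ell_{\rho_{j-1},\sigma_{j-1}}(P_{j-1})$; furthermore, if $\mathrm{en}_{\rho_{j-1},\sigma_{j-1}}(F_{j-1})=(1,1)$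 then $\mathrm{st}_{\rho_{j-1},\sigma_{j-1}}(P_j)=\mathrm{en}_{\rho_{j-1},\sigma_{j-1}}(P_{j-1})$; (12) $[Q_j,P_j]_{\rho_j,\sigma_j}=0$ for $0\le j\le\nu-1$; (13) $[Q_\nu,P_\nu]_{\rho_\nu,\sigma_\nu}=1$.
   Context: $K$ is an algebraically closed field of characteristic zero. For $l\in\mathbb{N}$, $W^{(l)}$ is the associative $K$-algebra with $K$-basis $\{X^{i/l}Y^j:i\in\mathbb{Z},j\in\mathbb{N}_0\}$, powers of $X$ multiplying as Laurent monomials and $[Y,X^\alpha]=\alpha X^{\alpha-1}$ ($\alpha\in\frac1l\mathbb{Z}$); $W^{(l)}\subseteq W^{(h)}$ when $l\mid h$, and the Weyl algebra $W$ ($[Y,X]=1$, basis $X^iY^j$, $i,j\ge0$) lies in $W^{(1)}$. $\Psi^{(l)}(X^{i/l}Y^j)=x^{i/l}y^j\in K[x^{\pm1/l},y]$ ($K$-linear); $\mathrm{Supp}(P)$ = exponents of $\Psi^{(l)}(P)$ with nonzero coefficient. $\mathfrak V=\{(\rho,\sigma)\in\mathbb{Z}^2:\gcd(\rho,\sigma)=1,\rho+\sigma>0\}$, $v_{\rho,\sigma}(a,b)=\rho a+\sigma b$ (also for $(\rho,\sigma)=(1,1),(1,-1)$). For $P\ne0$, $v_{\rho,\sigma}(P)=\max_{\mathrm{Supp}(P)}v_{\rho,\sigma}$, $\ell_{\rho,\sigma}(P)$ = sum of terms of $\Psi^{(l)}(P)$ of degree $v_{\rho,\sigma}(P)$; homogeneous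 = equal to its leading term. $\mathrm{st}_{\rho,\sigma}(P)$: among points $(a,b)\in\mathrm{Supp}(\ell_{\rho,\sigma}(P))$ maximizing $a-b$, the one with largest $a$; $\mathrm{en}_{\rho,\sigma}(P)$: among those maximizing $b-a$, the one with largest $b$. $\mathrm{Val}(P)=\{(\rho,\sigma)\in\mathfrak V:\#\mathrm{Supp}(\ell_{\rho,\sigma}(P))>1\}$. Order: on $\overline{\mathfrak V}=\mathfrak V\cup\{(1,-1),(-1,1)\}$, $(1,-1)<(\rho,\sigma)<(-1,1)$ for $(\rho,\sigma)\in\mathfrak V$, and for $(\rho_1,\sigma_1),(\rho,\sigma)\in\mathfrak V$, $(\rho_1,\sigma_1)\le(\rho,\sigma)$ iff $\rho_1\sigma-\sigma_1\rho\ge0$. $[P,Q]_{\rho,\sigma}:=0$ if $[P,Q]=0$ or $v_{\rho,\sigma}([P,Q])<v_{\rho,\sigma}(P)+v_{\rho,\sigma}(Q)-(\rho+\sigma)$, else $\ell_{\rho,\sigma}([P,Q])$. Irreducible pair: $(P,Q)=(\psi(X),\psi(Y))$ for an endomorphism $\psi$ of $W$ with $v_{1,1}(\psi(X)),v_{1,1}(\psi(Y))\ge2$ and no automorphisms $\phi_1,\phi_2$ of $W$ with $v_{1,1}(\phi_1\psi\phi_2(X))+v_{1,1}(\phi_1\psi\phi_2(Y))<v_{1,1}(\psi(X))+v_{1,1}(\psi(Y))$. *)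

(* Defs.v *)
From HB Require Import structures.
From mathcomp Require Import all_boot all_order all_algebra.
From mathcomp Require Import finmap.
From mathcomp Require Import monalg.

Set Implicit Arguments.
Unset Strict Implicit.
Unset Printing Implicit Defensive.

Import Order.TTheory GRing.Theory Num.Theory.
Local Open Scope ring_scope.

(* The algebra  W^(oo) = \bigcup_l W^(l).  An element is a finitely supported *)
(* family of coefficients c_(a,b), a : rat, b : nat, standing for             *)
(*      \sum c_(a,b) X^a Y^b    (normal ordering: powers of X on the left).   *)
(* The map Psi^(l) of the paper (X^a Y^b |-> x^a y^b) is the identity on this *)
(* coefficient representation, so polynomials of K[x^{+-1/l}, y] (leading    *)
(* terms etc.) are represented by the same type.                             *)
(* W^(l) is the subset of elements whose X-exponents lie in (1/l)Z, and the  *)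
(* Weyl algebra W the subset with X-exponents in N.                          *)

Section WeylDefs.
Variable K : fieldType.

Definition Wq := {malg K[(rat * nat)%type]}.

Definition falling (c : rat) (k : nat) : K := \prod_(i < k) (ratr c - i%:R).

(* (X^a1 Y^a2)(X^b1 Y^b2) = \sum_k C(a2,k) (b1)_k X^(a1+b1-k) Y^(a2+b2-k),
   which is the multiplication determined by [Y, X^al] = al X^(al-1). *)
Definition mulW (p q : Wq) : Wq :=
  \sum_(a <- msupp p) \sum_(b <- msupp q) \sum_(k < a.2.+1)
     << (p@_a * q@_b * 'C(a.2, k)%:R * falling b.1 k)
        *g (a.1 + b.1 - k%:R, (a.2 + b.2 - k)%N) >>.

Definition oneW : Wq := << 1 *g (0 : rat, 0%N) >>.
Definition XW : Wq := << 1 *g (1 : rat, 0%N) >>.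
Definition YW : Wq := << 1 *g (0 : rat, 1%N) >>.

Definition commW (p q : Wq) : Wq := mulW p q - mulW q p.

Definition inWl (l : nat) (p : Wq) : bool :=
  all (fun a : rat * nat => (denq a.1 %| l%:Z)%Z) (msupp p).

Definition inWeyl (p : Wq) : bool :=
  all (fun a : rat * nat => (denq a.1 == 1) && (0 <= a.1)) (msupp p).

(* K-algebra automorphisms of W^(l) (maps on Wq; only their restriction to
   W^(l) matters) *)
Definition isAutWl (l : nat) (f : Wq -> Wq) : Prop :=
  (forall p, inWl l p -> inWl l (f p)) /\
  (forall p q, inWl l p -> inWl l q -> f (p + q) = f p + f q) /\
  (forall (c : K) p, inWl l p -> f (c *: p) = c *: f p) /\
  (forall p q, inWl l p -> inWl l q -> f (mulW p q) = mulW (f p) (f q)) /\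
  f oneW = oneW /\
  (forall q, inWl l q -> exists p, inWl l p /\ f p = q) /\
  (forall p q, inWl l p -> inWl l q -> f p = f q -> p = q).

Definition isEndW (f : Wq -> Wq) : Prop :=
  (forall p, inWeyl p -> inWeyl (f p)) /\
  (forall p q, inWeyl p -> inWeyl q -> f (p + q) = f p + f q) /\
  (forall (c : K) p, inWeyl p -> f (c *: p) = c *: f p) /\
  (forall p q, inWeyl p -> inWeyl q -> f (mulW p q) = mulW (f p) (f q)) /\
  f oneW = oneW.

Definition isAutW (f : Wq -> Wq) : Prop :=
  isEndW f /\
  (forall q, inWeyl q -> exists p, inWeyl p /\ f p = q) /\
  (forall p q, inWeyl p -> inWeyl q -> f p = f q -> p = q).

Definition ptW (a : rat * nat) : rat * rat := (a.1, a.2%:R).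

Definition vpt (rs : int * int) (x : rat * rat) : rat :=
  rs.1%:~R * x.1 + rs.2%:~R * x.2.

(* v_{rho,sigma}(P) = max over Supp(P)  (P <> 0; value 0 for P = 0, unused) *)
Definition vW (rs : int * int) (p : Wq) : rat :=
  \big[Num.max/vpt rs (ptW (head (0, 0%N) (msupp p)))]_(a <- msupp p)
     vpt rs (ptW a).

Definition lsupp (rs : int * int) (p : Wq) : seq (rat * nat) :=
  [seq a <- msupp p | vpt rs (ptW a) == vW rs p].

Definition leadW (rs : int * int) (p : Wq) : Wq :=
  \sum_(a <- lsupp rs p) << p@_a *g a >>.

Definition homogW (rs : int * int) (p : Wq) : Prop := leadW rs p = p.

Definition st_better (x y : rat * rat) : bool :=
  (y.1 - y.2 < x.1 - x.2) || ((x.1 - x.2 == y.1 - y.2) && (y.1 < x.1)).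
Definition en_better (x y : rat * rat) : bool :=
  (y.2 - y.1 < x.2 - x.1) || ((x.2 - x.1 == y.2 - y.1) && (y.2 < x.2)).

Definition pick_best (better : rat * rat -> rat * rat -> bool)
    (s : seq (rat * rat)) : rat * rat :=
  foldr (fun x b => if better x b then x else b) (head (0, 0) s) s.

Definition stW (rs : int * int) (p : Wq) : rat * rat :=
  pick_best st_better (map ptW (lsupp rs p)).
Definition enW (rs : int * int) (p : Wq) : rat * rat :=
  pick_best en_better (map ptW (lsupp rs p)).

Definition inV (rs : int * int) : bool :=
  (gcdz rs.1 rs.2 == 1) && (0 < rs.1 + rs.2).

Definition ltV (a b : int * int) : bool := 0 < a.1 * b.2 - a.2 * b.1.

Definition inVal (rs : int * int) (p : Wq) : bool :=
  inV rs && (1 < size (lsupp rs p))%N.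

Definition commRS (rs : int * int) (p q : Wq) : Wq :=
  let c := commW p q in
  if (c == 0) || (vW rs c < vW rs p + vW rs q - (rs.1 + rs.2)%:~R) then 0
  else leadW rs c.

Definition irreducible_pair (P Q : Wq) : Prop :=
  exists psi : Wq -> Wq,
    isEndW psi /\ P = psi XW /\ Q = psi YW /\
    2%:R <= vW (1, 1) (psi XW) /\ 2%:R <= vW (1, 1) (psi YW) /\
    ~ (exists phi1 phi2 : Wq -> Wq,
         isAutW phi1 /\ isAutW phi2 /\
         vW (1, 1) (phi1 (psi (phi2 XW))) + vW (1, 1) (phi1 (psi (phi2 YW)))
         < vW (1, 1) (psi XW) + vW (1, 1) (psi YW)).

End WeylDefs.

(* Main.v *)
(** For a direction (rho, sigma) with rho > 0 put s = sigma / rho.  A homogeneous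
    element is x^w f(z) with z = x^(-s) y and f a polynomial in one variable, and
    in these terms the top part of the commutator of x^w p(z) and x^u q(z) is
    u p' q - w p q'.

    Existence of F.  Among the elements killed by a power of ad P there is one, G,
    whose leading form h does not commute with that of P: otherwise every nonzero
    combination of the P^i Q^j would have a nonzero coefficient at a point of the
    ray through en(P), and there are too few such points.  If the nilpotency order
    is minimal then r = [p, h] commutes with p, and F = h p / r satisfies
    [p, F] = p.  The positivity of v(P) excludes poles of F.

    Choice of the root.  Comparing orders of vanishing in
    (1 + s) p' g - w p g' = p shows that g is squarefree, that it vanishes on the
    roots of p, and that some root lam of p has multiplicity t with
    (1 + s) t > w.  After Y |-> Y + lam X^s the starting point of the edge
    therefore has v_(1,-1) < 0, and the next edge of the Newton polygon exists,
    since otherwise P and Q, hence 1 = [Q, P], would have negative degree for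
    (1, -1).

    Termination.  Either t drops below deg p, or p is a multiple of (z - lam)^t;
    then s lies in (1/l) Z, so l does not change and floor (l (1 + s)) decreases.

    Start.  A linear change of variables and the step above at slope 1 lead to a
    slope s < 1.  If 0 < s < 1 then s = 1/r and en(P) lies on the y-axis, and
    X |-> X + c Y^r lowers the total degrees of both P and Q, contradicting
    irreducibility; if s = 0, one more step makes the slope negative. *)

Require Import Defs.
From HB Require Import structures.
From mathcomp Require Import all_boot all_order all_algebra.
From mathcomp Require Import finmap.
From mathcomp Require Import monalg.
From mathcomp Require Import zify ring lra.
Set Implicit Arguments.
Unset Strict Implicit.
Unset Printing Implicit Defensive.
Import Order.TTheory GRing.Theory Num.Theory.
Local Open Scope ring_scope.

(** * Rational scalars and falling factorials *)

(** The coordinate z absorbs all denominators, and the bracket u p' q - w p q' does not contain s,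
    so every edge of every P_j leads to the same kind of operator on K[z]. These operators are
    studied by comparing orders at the roots and degrees at infinity.

    P and Q travel together: as long as the leading bracket is zero, their layers satisfy u p' q = w
    p q', so a root of multiplicity t in p has a multiplicity e in q with u t = w e. One translation
    then serves both, and the ratio m/n persists. When this fails the leading bracket is the
    constant 1, and the chain ends there. In W itself it cannot fail, because exponents are natural
    numbers and neither of m, n divides the other; hence nu > 0. The same non-divisibility shows
    that if one of the two layers is not a monomial, neither is the other.

    Associativity of the normally ordered product is obtained from a faithful action by differential
    operators. Characteristic zero enters there, and whenever a factor such as u t - w e must be
    nonzero in K. *)

Definition qK (K : fieldType) (c0 : [pchar K] =i pred0) : rat -> K :=
  locked (@ratr K).

Section RationalsInK.
Variables (K : fieldType) (c0 : [pchar K] =i pred0).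

Lemma natr_eq0_pchar0 (n : nat) : (n%:R == 0 :> K) = (n == 0%N).
Proof. by move/pcharf0P: c0 => ->. Qed.

Lemma intr_eq0_pchar0 (z : int) : (z%:~R == 0 :> K) = (z == 0).
Proof.
by case: z => n; rewrite ?NegzE ?mulrNz ?oppr_eq0 -pmulrn natr_eq0_pchar0.
Qed.

(** No nonzero denominator vanishes in [K], so fractions need not be reduced. Since [c0] is an
    argument of [qK], the morphism instances below can be attached to it. *)
Lemma qK_frac (a b : int) : b != 0 -> qK c0 (a%:~R / b%:~R) = a%:~R / b%:~R.
Proof.
move=> b0; rewrite /qK -lock /ratr; set x : rat := _ / _.
apply/eqP; rewrite eqr_div ?intr_eq0_pchar0 ?denq_neq0 // -!intrM.
rewrite -subr_eq0 -mulrzBr intr_eq0_pchar0 subr_eq0.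
rewrite -(inj_eq (@intr_inj rat)) !intrM numqE /x.
by rewrite mulrAC divfK ?intr_eq0.
Qed.

Lemma qK_zmod : zmod_morphism (qK c0).
Proof.
move=> x y; rewrite -(divq_num_den x) -(divq_num_den y).
have dx := denq_neq0 x; have dy := denq_neq0 y.
rewrite -mulNr addf_div ?intr_eq0 // -mulrNz -!intrM -intrD.
rewrite !qK_frac ?mulf_neq0 // -mulNr addf_div ?intr_eq0_pchar0 //.
by rewrite intrD !intrM mulrNz.
Qed.

Lemma qK_monoid : monoid_morphism (qK c0).
Proof.
split=> [|x y]; first by rewrite /qK -lock /ratr divr1.
rewrite -(divq_num_den x) -(divq_num_den y) mulf_div -!intrM.
have dx := denq_neq0 x; have dy := denq_neq0 y.
by rewrite !qK_frac ?mulf_neq0 // mulf_div !intrM.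
Qed.

HB.instance Definition _ := GRing.isZmodMorphism.Build rat K (qK c0) qK_zmod.
HB.instance Definition _ := GRing.isMonoidMorphism.Build rat K (qK c0) qK_monoid.

Lemma qK_nat (n : nat) : qK c0 n%:R = n%:R.
Proof. exact: rmorph_nat. Qed.

Lemma qK_eq0 x : (qK c0 x == 0) = (x == 0).
Proof. exact: fmorph_eq0. Qed.

Lemma falling0 x : falling K x 0 = 1.
Proof. by rewrite /falling big_ord0. Qed.

Lemma fallingS x k : falling K x k.+1 = falling K x k * (qK c0 x - k%:R).
Proof. by rewrite /falling big_ord_recr /qK -lock. Qed.

Lemma falling1 x : falling K x 1 = qK c0 x.
Proof. by rewrite fallingS falling0 mul1r subr0. Qed.

Lemma falling_add x m n :
  falling K x (m + n) = falling K x m * falling K (x - m%:R) n.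
Proof.
elim: n => [|n IH]; first by rewrite addn0 falling0 mulr1.
rewrite addnS !fallingS IH -mulrA; congr (_ * (_ * _)).
by rewrite rmorphB /= qK_nat natrD opprD addrA.
Qed.

(** This identity is the reason why the normally ordered product corresponds to composition of
    differential operators. *)
Lemma falling_vandermonde x y n :
  falling K (x + y) n =
  \sum_(k < n.+1) 'C(n, k)%:R * falling K x k * falling K y (n - k).
Proof.
elim: n => [|n IH].
  by rewrite big_ord_recl big_ord0 /= !falling0 bin0 !mulr1 addr0.
rewrite fallingS IH mulr_suml.
(* The new factor x + y - n is split as (x - k) + (y - (n - k)); Pascal's rule then regroups the two
   families. *)
pose A (k : nat) := 'C(n, k)%:R * falling K x k.+1 * falling K y (n - k).
pose B (k : nat) := 'C(n, k)%:R * falling K x k * falling K y (n.+1 - k).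
transitivity (\sum_(k < n.+1) (A k + B k)).
  apply: eq_bigr => k _; rewrite /A /B.
  have le_kn : (k <= n)%N by rewrite -ltnS.
  rewrite subSn // !fallingS rmorphD /= natrB //; ring.
have B_last : B n.+1 = 0 by rewrite /B bin_small // !mul0r.
rewrite [RHS]big_ord_recl /= bin0 subn0.
transitivity (B 0%N + \sum_(i < n.+1) (A i + B i.+1)); last first.
  congr (_ + _); first by rewrite /B bin0 subn0.
  apply: eq_bigr => i _; rewrite /A /B /bump /= add1n binS natrD subSS; ring.
have := @big_ord_recl K 0 +%R n.+1 (fun i : 'I_n.+2 => B i); rewrite /= => BE.
move: BE; rewrite big_ord_recr /= B_last addr0 => BE.
by rewrite !big_split /= addrCA BE.
Qed.

Lemma falling_nat_small (n k : nat) : (n < k)%N -> falling K n%:R k = 0.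
Proof.
move=> lt_nk; rewrite /falling (bigD1 (Ordinal lt_nk)) //=.
by rewrite ratr_nat subrr mul0r.
Qed.

Lemma falling_nat_neq0 (n k : nat) : (k <= n)%N -> falling K n%:R k != 0.
Proof.
move=> le_kn; rewrite /falling; apply/prodf_neq0 => i _.
rewrite ratr_nat -natrB ?natr_eq0_pchar0; last first.
  by apply: ltnW; apply: leq_trans le_kn.
by rewrite -lt0n subn_gt0; apply: leq_trans le_kn.
Qed.

End RationalsInK.

(** * Linear extension of maps given on monomials *)

Section LinearExtension.
Variables (K : fieldType) (I : choiceType) (V : lmodType K).
Implicit Types (f : I -> V) (p : {malg K[I]}).

Definition lext f p : V := \sum_(a <- msupp p) p@_a *: f a.

(** Sums over different supports become comparable once they are extended to a common finite set. *)
Lemma lextEw f (d : {fset I}) p : (msupp p `<=` d)%fset ->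
  lext f p = \sum_(a <- d) p@_a *: f a.
Proof.
move=> le_pd; rewrite /lext [RHS](bigID (mem (msupp p))) /= addrC [X in _ = X + _]big1 ?add0r.
  rewrite -[RHS]big_filter; apply: perm_big; apply: uniq_perm.
  - exact: fset_uniq.
  - by rewrite filter_uniq // fset_uniq.
  - move=> a; rewrite mem_filter /=.
    by apply/idP/andP => [H|[]//]; split=> //; apply: (fsubsetP le_pd).
by move=> a aNp; rewrite mcoeff_outdom // scale0r.
Qed.

Lemma lext_is_linear f : linear (lext f).
Proof.
move=> c p q.
pose d := (msupp p `|` msupp q)%fset.
rewrite (@lextEw f d (c *: p + q)); last first.
  apply: (fsubset_trans (msuppD_le _ _)); apply: fsetSU; exact: msuppZ_le.
rewrite (@lextEw f d p) ?fsubsetUl // (@lextEw f d q) ?fsubsetUr //.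
rewrite scaler_sumr -big_split /=; apply: eq_bigr => a _.
by rewrite mcoeffD mcoeffZ scalerDl scalerA.
Qed.

HB.instance Definition _ f :=
  GRing.isLinear.Build K {malg K[I]} V *:%R (lext f) (lext_is_linear f).

Lemma lextU f c a : lext f << c *g a >> = c *: f a.
Proof.
rewrite (@lextEw f [fset a]%fset) ?msuppU_le //.
by rewrite big_seq_fset1 mcoeffUU.
Qed.

Lemma malgZU (c d : K) (a : I) : c *: << d *g a >> = << c * d *g a >>.
Proof. by apply/malgP => k; rewrite mcoeffZ !mcoeffU mulrnAr. Qed.

Lemma malg_sumU p : p = \sum_(a <- msupp p) p@_a *: << 1 *g a >>.
Proof.
by rewrite {1}[p]monalgE; apply: eq_bigr => a _; rewrite malgZU mulr1.
Qed.

Lemma eq_lext f g p : (forall a, p@_a != 0 -> f a = g a) -> lext f p = lext g p.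
Proof.
move=> fg; rewrite /lext !big_seq; apply: eq_bigr => a.
by rewrite -mcoeff_neq0 => /fg ->.
Qed.

End LinearExtension.

Lemma linear_lext (K : fieldType) (I : choiceType) (U V : lmodType K)
    (g : {linear U -> V}) (f : I -> U) (p : {malg K[I]}) :
  g (lext f p) = lext (fun a => g (f a)) p.
Proof. by rewrite /lext linear_sum; apply: eq_bigr => a _; rewrite linearZ. Qed.

(** * The ring structure *)

Section WeylRing.
Variables (K : fieldType) (c0 : [pchar K] =i pred0).
Implicit Types (p q r : Wq K) (a b : rat * nat).

Definition mulmon a b : Wq K := \sum_(k < a.2.+1)
  << ('C(a.2, k)%:R * falling K b.1 k)
     *g (a.1 + b.1 - k%:R, (a.2 + b.2 - k)%N) >>.

Lemma mulWE p q : mulW p q = lext (fun a => lext (mulmon a) q : Wq K) p.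
Proof.
apply: eq_bigr => a _; rewrite scaler_sumr; apply: eq_bigr => b _.
rewrite scalerA scaler_sumr; apply: eq_bigr => k _.
by rewrite malgZU !mulrA.
Qed.

Lemma mulW_mon a b : mulW << 1 *g a >> << 1 *g b >> = mulmon a b :> Wq K.
Proof. by rewrite mulWE !lextU !scale1r. Qed.

Definition mulWr q p := mulW p q.

Lemma mulW_linearl q : linear (mulWr q).
Proof. by move=> c p1 p2; rewrite /mulWr !mulWE linearP. Qed.

Lemma mulW_linearr p : linear (mulW p : Wq K -> Wq K).
Proof.
move=> c q1 q2; rewrite !mulWE scaler_sumr -big_split /=.
by apply: eq_bigr => a _; rewrite linearP scalerDr !scalerA mulrC.
Qed.

HB.instance Definition _ q := GRing.isLinear.Build K (Wq K) (Wq K) *:%R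
  (mulWr q) (mulW_linearl q).
HB.instance Definition _ p := GRing.isLinear.Build K (Wq K) (Wq K) *:%R
  (mulW p) (mulW_linearr p).

(* [X^a Y^b] acting on the function [f] of exponents, i.e. on the formal
   series [\sum_e f e x^e], as the differential operator [x^a d^b/dx^b]. *)
Definition actmon a (f : rat -> K) (e : rat) : K :=
  let e' := e - a.1 + a.2%:R in falling K e' a.2 * f e'.
Definition act p (f : rat -> K) (e : rat) : K :=
  lext (fun a => actmon a f e : K^o) p.

Lemma actU a f e : act << 1 *g a >> f e = actmon a f e.
Proof. by rewrite /act lextU scale1r. Qed.

(** After the common factors are removed, the claim is the Vandermonde identity for the falling
    factorial of b.1 + (y - b.2). *)
Lemma act_mulmon a b f e : act (mulmon a b) f e = actmon a (actmon b f) e.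
Proof.
rewrite /act /mulmon linear_sum /=.
pose x := e - a.1 + a.2%:R; pose y := x - b.1 + b.2%:R.
transitivity (\sum_(k < a.2.+1)
   ('C(a.2, k)%:R * falling K b.1 k * falling K y (b.2 + (a.2 - k)) * f y)).
  apply: eq_bigr => k _; rewrite lextU /actmon /=.
  have le_k : (k <= a.2)%N by rewrite -ltnS.
  have -> : (a.2 + b.2 - k = b.2 + (a.2 - k))%N by lia.
  have -> : e - (a.1 + b.1 - k%:R) + (b.2 + (a.2 - k))%:R = y.
    by rewrite natrD natrB // /y /x; ring.
  by rewrite /GRing.scale /= !mulrA.
rewrite /actmon -/x -/y mulrA -mulr_suml; congr (_ * f y).
have -> : falling K x a.2 = falling K (b.1 + (y - b.2%:R)) a.2.
  by congr falling; rewrite /y; ring.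
rewrite (falling_vandermonde c0) mulr_suml; apply: eq_bigr => k _.
by rewrite (falling_add c0) -!mulrA; congr (_ * (_ * _)); rewrite mulrC.
Qed.

Lemma actE p f e : act p f e = \sum_(a <- msupp p) p@_a * actmon a f e.
Proof. by []. Qed.

Lemma act_lext (g : rat * nat -> Wq K) p f e :
  act (lext g p) f e = \sum_(a <- msupp p) p@_a * act (g a) f e.
Proof.
rewrite {1}/lext {1}/act linear_sum; apply: eq_bigr => a _.
by rewrite linearZ.
Qed.

Lemma act_mul p q f e : act (mulW p q) f e = act p (act q f) e.
Proof.
rewrite mulWE act_lext actE; apply: eq_bigr => a _; congr (_ * _).
rewrite act_lext /actmon actE mulr_sumr; apply: eq_bigr => b _.
by rewrite act_mulmon /actmon; ring.
Qed.

(** Faithfulness: the coefficient at (x, j) is read off from the action on the single power of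
    exponent j, by induction on j. Terms with more than j derivatives kill it, terms with fewer
    vanish by induction, and what remains is multiplied by j!, which is nonzero in [K]. *)
Lemma act_inj p q : (forall f e, act p f e = act q f e) -> p = q.
Proof.
move=> pq; apply/eqP; rewrite -subr_eq0; apply/eqP; set r := p - q.
have r0 f e : act r f e = 0 by rewrite /act linearB /= -/(act p f e) pq subrr.
apply/malgP => a; rewrite mcoeff0; case: a => x j.
have [k le_k] := ubnP j; elim: k => // k IH in x j le_k *.
have := r0 (fun e => (e == j%:R)%:R) x.
rewrite /act (lextEw _ (fsubsetUr [fset (x, j)]%fset (msupp r))).
rewrite (big_fsetD1 (x, j)) ?fset1U1 //= big1_seq ?addr0; last first.
  move=> [y i] /andP[_]; rewrite !inE /= => /andP[ne _].
  rewrite /actmon /=.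
  case: eqP => [E|_]; last by rewrite mulr0 scaler0.
  rewrite E; have [lt_ji|le_ij] := ltnP j i.
    by rewrite falling_nat_small // mul0r scaler0.
  have [e_ij|ne_ij] := eqVneq i j.
    case/negP: ne; rewrite e_ij xpair_eqE eqxx andbT; apply/eqP.
    by move: E; rewrite e_ij => E; lra.
  by rewrite IH ?scale0r //; lia.
have -> : actmon (x, j) (fun e => (e == j%:R)%:R) x = falling K j%:R j.
  rewrite /actmon /=; set e := _ + j%:R.
  have -> : e = j%:R by rewrite /e; ring.
  by rewrite eqxx mulr1.
by move=> /eqP; rewrite [_ *: _]/(_ * _) mulf_eq0 (negPf (falling_nat_neq0 c0 (leqnn j))) orbF => /eqP.
Qed.

(** Inherited from composition of operators through the faithful action. *)
Lemma mulWA : associative (@mulW K).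
Proof.
move=> p q r; apply: act_inj => f e; rewrite !act_mul.
by rewrite !actE; apply: eq_bigr => a _; rewrite /actmon act_mul.
Qed.

Lemma act_one f e : act (oneW K) f e = f e.
Proof. by rewrite actU /actmon /= falling0 mul1r subr0 addr0. Qed.

Lemma mul1W : left_id (oneW K) (@mulW K).
Proof. by move=> p; apply: act_inj => f e; rewrite act_mul act_one. Qed.

Lemma mulW1 : right_id (oneW K) (@mulW K).
Proof.
move=> p; apply: act_inj => f e; rewrite act_mul.
by rewrite !actE; apply: eq_bigr => a _; rewrite /actmon act_one.
Qed.

Lemma mulWDl : left_distributive (@mulW K) +%R.
Proof. by move=> p q r; apply: (linearD (mulWr r)). Qed.

Lemma mulWDr : right_distributive (@mulW K) +%R.
Proof. by move=> p q r; apply: linearD. Qed.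

Lemma oneW_neq0 : oneW K != 0.
Proof. by rewrite monalgU_eq0 oner_eq0. Qed.

Definition mulq := locked (@mulW K).
Definition scaleq := locked (fun (c : K) p => c *: p).

Lemma mulqE p q : mulq p q = mulW p q.
Proof. by rewrite /mulq -lock. Qed.

Lemma scaleqE c p : scaleq c p = c *: p.
Proof. by rewrite /scaleq -lock. Qed.

Lemma mulqA : associative mulq.
Proof. by move=> p q r; rewrite !mulqE mulWA. Qed.

Lemma mul1q : left_id (oneW K) mulq.
Proof. by move=> p; rewrite mulqE mul1W. Qed.

Lemma mulq1 : right_id (oneW K) mulq.
Proof. by move=> p; rewrite mulqE mulW1. Qed.

Lemma mulqDl : left_distributive mulq +%R.
Proof. by move=> p q r; rewrite !mulqE mulWDl. Qed.

Lemma mulqDr : right_distributive mulq +%R.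
Proof. by move=> p q r; rewrite !mulqE mulWDr. Qed.

Lemma scaleqA c d p : scaleq c (scaleq d p) = scaleq (c * d) p.
Proof. by rewrite !scaleqE scalerA. Qed.

Lemma scale1q : left_id 1 scaleq.
Proof. by move=> p; rewrite scaleqE scale1r. Qed.

Lemma scaleqDr : right_distributive scaleq +%R.
Proof. by move=> c p q; rewrite !scaleqE scalerDr. Qed.

Lemma scaleqDl p : {morph scaleq^~ p : c d / c + d}.
Proof. by move=> c d; rewrite !scaleqE scalerDl. Qed.

Lemma scaleqAl (c : K) p q : scaleq c (mulq p q) = mulq (scaleq c p) q.
Proof. by rewrite !mulqE !scaleqE -(linearZ_LR (mulWr q)). Qed.

Lemma scaleqAr (c : K) p q : scaleq c (mulq p q) = mulq p (scaleq c q).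
Proof. by rewrite !mulqE !scaleqE -(linearZ_LR (mulW p)). Qed.

End WeylRing.

(* [Wq K] as an algebra, whose construction needs characteristic 0.  Products
   and scalings are locked, so that conversion tests never unfold them. *)
Definition Wr (K : fieldType) (c0 : [pchar K] =i pred0) : Type := Wq K.

HB.instance Definition _ (K : fieldType) (c0 : [pchar K] =i pred0) :=
  GRing.Zmodule.copy (Wr c0) {malg K[(rat * nat)%type]}.

HB.instance Definition _ (K : fieldType) (c0 : [pchar K] =i pred0) :=
  GRing.Zmodule_isNzRing.Build (Wr c0) (mulqA c0) (mul1q c0) (mulq1 c0)
    (@mulqDl K) (@mulqDr K) (oneW_neq0 K).

HB.instance Definition _ (K : fieldType) (c0 : [pchar K] =i pred0) :=
  GRing.Zmodule_isLmodule.Build K (Wr c0)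
    (@scaleqA K) (@scale1q K) (@scaleqDr K) (@scaleqDl K).

HB.instance Definition _ (K : fieldType) (c0 : [pchar K] =i pred0) :=
  GRing.Lmodule_isLalgebra.Build K (Wr c0) (@scaleqAl K).

HB.instance Definition _ (K : fieldType) (c0 : [pchar K] =i pred0) :=
  GRing.Lalgebra_isAlgebra.Build K (Wr c0) (@scaleqAr K).

Section WrTheory.
Variables (K : fieldType) (c0 : [pchar K] =i pred0).
Implicit Types (p q : Wr c0).

Lemma mulWq p q : mulW p q = p * q.
Proof. by rewrite -mulqE. Qed.

Lemma commWq p q : commW p q = p * q - q * p.
Proof. by rewrite /commW !mulWq. Qed.

Lemma scaleWq (c : K) p : c *: (p : Wq K) = c *: p :> Wr c0.
Proof. by rewrite -scaleqE. Qed.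

Lemma mcoeffZq (c : K) p a : (c *: p)@_a = c * p@_a.
Proof. by rewrite -scaleWq mcoeffZ. Qed.

Lemma malgZUq (c d : K) a : c *: (<< d *g a >> : Wr c0) = << c * d *g a >>.
Proof. by rewrite -scaleWq malgZU. Qed.

Lemma malg_sumUq p : p = \sum_(a <- msupp p) p@_a *: (<< 1 *g a >> : Wr c0).
Proof.
rewrite {1}[p]malg_sumU; apply: eq_bigr => a _; exact: scaleWq.
Qed.

Lemma lextq_is_linear (V : lmodType K) (f : rat * nat -> V) :
  linear (lext f : Wr c0 -> V).
Proof. by move=> c p q; rewrite -scaleWq linearP. Qed.

Lemma lextWq (f : rat * nat -> Wr c0) p :
  lext (f : rat * nat -> Wq K) p = lext f p :> Wr c0.
Proof. by apply: eq_bigr => a _; rewrite scaleWq. Qed.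

Lemma mulqE_lext p q : p * q =
  lext (fun a => lext (fun b => mulmon K a b : Wr c0) q : Wr c0) p.
Proof.
by rewrite -mulWq mulWE lextWq; apply: eq_lext => a _; rewrite lextWq.
Qed.

End WrTheory.

(** * Supports and homogeneous layers *)

Section Support.
Variables (K : fieldType) (c0 : [pchar K] =i pred0).
Implicit Types (p q : Wq K) (a b : rat * nat) (S T R : rat * nat -> Prop).

Definition supp_in S p := forall a, p@_a != 0 -> S a.

Lemma supp_in_sub S T p : (forall a, S a -> T a) -> supp_in S p -> supp_in T p.
Proof. by move=> ST Sp a /Sp /ST. Qed.

Lemma supp_in_msupp S p : supp_in S p <-> (forall a, a \in msupp p -> S a).
Proof. by split=> H a; [rewrite -mcoeff_neq0|rewrite mcoeff_neq0] => /H. Qed.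

Lemma supp_in0 S : supp_in S 0.
Proof. by move=> a; rewrite mcoeff0 eqxx. Qed.

Lemma supp_inD S p q : supp_in S p -> supp_in S q -> supp_in S (p + q).
Proof.
move=> Sp Sq a; rewrite mcoeffD => pq0.
have [p0|/Sp//] := eqVneq p@_a 0; apply: Sq.
by apply: contraNneq pq0 => q0; rewrite p0 q0 addr0.
Qed.

Lemma supp_inN S p : supp_in S p -> supp_in S (- p).
Proof. by move=> Sp a; rewrite mcoeffN oppr_eq0 => /Sp. Qed.

Lemma supp_inB S p q : supp_in S p -> supp_in S q -> supp_in S (p - q).
Proof. by move=> Sp Sq; apply: supp_inD => //; apply: supp_inN. Qed.

Lemma supp_inZ S (c : K) p : supp_in S p -> supp_in S (c *: p).
Proof. by move=> Sp a; rewrite mcoeffZ mulf_eq0 negb_or => /andP[_ /Sp]. Qed.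

Lemma supp_in_sum S (J : eqType) (r : seq J) (P : pred J) (F : J -> Wq K) :
  (forall i, i \in r -> P i -> supp_in S (F i)) ->
  supp_in S (\sum_(i <- r | P i) F i).
Proof.
move=> SF; rewrite big_seq_cond; elim/big_rec: _ => [|i p]; first exact: supp_in0.
by case/andP=> ir Pi; apply: supp_inD; apply: SF.
Qed.

Lemma supp_inU S (c : K) a : (c != 0 -> S a) -> supp_in S << c *g a >>.
Proof.
move=> Sa b; rewrite mcoeffU; have [<-|_] := eqVneq a b; last by rewrite eqxx.
by rewrite mulr1n.
Qed.

Lemma supp_in_lext S (f : rat * nat -> Wq K) p :
  (forall a, p@_a != 0 -> supp_in S (f a)) -> supp_in S (lext f p).
Proof.
move=> Sf; apply: supp_in_sum => a; rewrite -mcoeff_neq0 => /Sf Sfa _.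
exact: supp_inZ.
Qed.

(** The condition on [falling] is kept because it is what prevents negative exponents of X in
    products of elements of W. *)
Lemma supp_in_mul S T R p q : supp_in S p -> supp_in T q ->
  (forall a b k, S a -> T b -> (k <= a.2)%N -> falling K b.1 k != 0 ->
     R (a.1 + b.1 - k%:R, (a.2 + b.2 - k)%N)) ->
  supp_in R (mulW p q).
Proof.
move=> Sp Tq STR; rewrite mulWE.
apply: supp_in_lext => a /Sp Sa; apply: supp_in_lext => b /Tq Tb.
apply: supp_in_sum => k _ _; apply: supp_inU; rewrite mulf_eq0 negb_or.
by case/andP=> _; apply: STR => //; rewrite -ltnS.
Qed.

(** The terms k = 0 and k = 1 are isolated: the first gives the commutative product of leading
    forms, the second their Poisson bracket. *)
Lemma mulmonE a b : mulmon K a b =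
  << 1 *g (a.1 + b.1, (a.2 + b.2)%N) >> +
  (<< a.2%:R * qK c0 b.1 *g (a.1 + b.1 - 1, (a.2 + b.2 - 1)%N) >> +
  \sum_(k < a.2.-1)
    << 'C(a.2, k.+2)%:R * falling K b.1 k.+2
       *g (a.1 + b.1 - k.+2%:R, (a.2 + b.2 - k.+2)%N) >>).
Proof.
rewrite /mulmon big_ord_recl [falling K b.1 _]falling0 mulr1 bin0 [1 *+ ord0]mulr0n.
rewrite subr0 [(_ - ord0)%N]subn0; congr (_ + _); case: a => x [|j] /=.
  by rewrite !big_ord0 mul0r monalgU0 addr0.
by rewrite big_ord_recl /= (falling1 c0) bin1.
Qed.

Lemma mulWE_swap p q :
  mulW q p = lext (fun a => lext (fun b => mulmon K b a) q : Wq K) p.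
Proof.
rewrite mulWE /lext; under eq_bigr do rewrite scaler_sumr.
rewrite exchange_big /=; apply: eq_bigr => a _; rewrite scaler_sumr.
by apply: eq_bigr => b _; rewrite !scalerA mulrC.
Qed.

Definition commmon a b := mulmon K a b - mulmon K b a.

Lemma commWE p q : commW p q = lext (fun a => lext (commmon a) q : Wq K) p.
Proof.
rewrite /commW mulWE mulWE_swap /lext -sumrB; apply: eq_bigr => a _.
rewrite -scalerBr -sumrB; congr (_ *: _); apply: eq_bigr => b _.
by rewrite -scalerBr.
Qed.

Lemma commmonE a b : commmon a b =
  << a.2%:R * qK c0 b.1 - b.2%:R * qK c0 a.1
     *g (a.1 + b.1 - 1, (a.2 + b.2 - 1)%N) >> +
  (\sum_(k < a.2.-1)
    << 'C(a.2, k.+2)%:R * falling K b.1 k.+2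
       *g (a.1 + b.1 - k.+2%:R, (a.2 + b.2 - k.+2)%N) >> -
  \sum_(k < b.2.-1)
    << 'C(b.2, k.+2)%:R * falling K a.1 k.+2
       *g (a.1 + b.1 - k.+2%:R, (a.2 + b.2 - k.+2)%N) >>).
Proof.
rewrite /commmon !mulmonE [b.1 + a.1]addrC [(b.2 + a.2)%N]addnC.
by rewrite opprD addrACA subrr add0r opprD addrACA monalgUB.
Qed.

(** The terms k = 0 cancel. Truncated subtraction never occurs: for k = 1 the coefficient is zero
    when both exponents of Y are 0. *)
Lemma supp_in_comm S T R p q : supp_in S p -> supp_in T q ->
  (forall a b k, S a -> T b -> (0 < k)%N -> (k <= a.2 + b.2)%N ->
     R (a.1 + b.1 - k%:R, (a.2 + b.2 - k)%N)) ->
  supp_in R (commW p q).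
Proof.
move=> Sp Tq STR; rewrite commWE.
apply: supp_in_lext => a /Sp Sa; apply: supp_in_lext => b /Tq Tb.
rewrite commmonE; apply: supp_inD; last apply: supp_inB.
- apply: supp_inU => nz; apply: (STR a b 1%N) => //; rewrite addn_gt0.
  apply: contraNT nz; rewrite negb_or -!leqNgt !leqn0 => /andP[/eqP-> /eqP->].
  by rewrite !mul0r subrr.
- by apply: supp_in_sum => k _ _; apply: supp_inU => _; apply: STR => //; have := ltn_ord k; lia.
- by apply: supp_in_sum => k _ _; apply: supp_inU => _; apply: STR => //; have := ltn_ord k; lia.
Qed.

End Support.

Section Layers.
Variables (K : fieldType) (c0 : [pchar K] =i pred0).
Implicit Types (p q : Wq K) (a b : rat * nat) (s w u : rat).

Definition sdeg s a : rat := a.1 + s * a.2%:R.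

(* The part of degree [w] of [p], for the grading where [X] has degree [1] and
   [Y] degree [s], as a polynomial in [z = x^(-s) y]: [x^w f(z)] is [f]. *)
Definition layer s w : Wq K -> {poly K} :=
  lext (fun a => if sdeg s a == w then 'X^(a.2) else 0).

HB.instance Definition _ s w := GRing.isLinear.Build K (Wq K) {poly K} *:%R
  (layer s w) (lext_is_linear _).

Lemma layerU s w (c : K) a :
  layer s w << c *g a >> = if sdeg s a == w then c *: 'X^(a.2) else 0.
Proof. by rewrite /layer lextU; case: ifP => // _; rewrite scaler0. Qed.

Lemma coef_layer s w p j : (layer s w p)`_j = p@_(w - s * j%:R, j).
Proof.
rewrite [in LHS](malg_sumU p) linear_sum coef_sum [in RHS](malg_sumU p).
rewrite [RHS]raddf_sum; apply: eq_bigr => a _.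
rewrite linearZ coefZ /= mcoeffZ; congr (_ * _); rewrite layerU mcoeffU scale1r.
case: a => x i; rewrite /sdeg /= xpair_eqE.
have [->|ne_ij] := eqVneq i j.
  rewrite andbT [in RHS]eq_sym subr_eq [in RHS]eq_sym.
  by case: ifP; rewrite ?coef0 // coefXn eqxx.
by rewrite andbF; case: ifP; rewrite ?coef0 // coefXn [j == i]eq_sym (negPf ne_ij).
Qed.

Definition sbound s w := supp_in (K := K) (fun a => sdeg s a <= w).

Lemma sdeg_sub s a b k : (k <= a.2 + b.2)%N ->
  sdeg s (a.1 + b.1 - k%:R, (a.2 + b.2 - k)%N) =
  sdeg s a + sdeg s b - k%:R * (1 + s).
Proof. by move=> le_k; rewrite /sdeg /= natrB // natrD; ring. Qed.

Variable s : rat.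
Hypothesis s_gt : 0 < 1 + s.

Lemma sboundM w u p q : sbound s w p -> sbound s u q -> sbound s (w + u) (mulW p q).
Proof.
move=> bp bq; apply: (supp_in_mul bp bq) => a b k da db le_k _ /=.
rewrite sdeg_sub; last by rewrite (leq_trans le_k) ?leq_addr.
have : 0 <= k%:R * (1 + s) by rewrite mulr_ge0 ?ler0n // ltW.
lra.
Qed.

Lemma sbound_comm w u p q :
  sbound s w p -> sbound s u q -> sbound s (w + u - (1 + s)) (commW p q).
Proof.
move=> bp bq; apply: (supp_in_comm c0 bp bq) => a b k da db k0 le_k /=.
rewrite sdeg_sub //.
have : 1 * (1 + s) <= k%:R * (1 + s) by rewrite ler_wpM2r ?(ltW s_gt) // ler1n.
lra.
Qed.

Lemma layer_bilinear (m : rat * nat -> rat * nat -> Wq K)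
    (l : rat * nat -> rat * nat -> {poly K}) w p q :
  (forall a b, p@_a != 0 -> q@_b != 0 -> layer s w (m a b) = l a b) ->
  layer s w (lext (fun a => lext (m a) q : Wq K) p) =
  lext (fun a => lext (l a) q : {poly K}) p.
Proof.
move=> ml; rewrite linear_lext; apply: eq_lext => a pa.
by rewrite linear_lext; apply: eq_lext => b qb; apply: ml.
Qed.

(** Each differentiation lowers the degree by 1 + s > 0, so only the terms k = 0 reach degree w +
    u. *)
Lemma layerM w u p q : sbound s w p -> sbound s u q ->
  layer s (w + u) (mulW p q) = layer s w p * layer s u q.
Proof.
move=> bp bq; rewrite mulWE.
pose l d a : {poly K} := if sdeg s a == d then 'X^(a.2) else 0.
rewrite (layer_bilinear (l := fun a b => l w a * l u b)); last first.
  move=> a b /bp da /bq db; rewrite (mulmonE c0) !linearD linear_sum /= !layerU.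
  have -> : sdeg s (a.1 + b.1, (a.2 + b.2)%N) = sdeg s a + sdeg s b.
    by have := @sdeg_sub s a b 0 isT; rewrite subr0 subn0 mul0r subr0.
  rewrite big1 => [|k _]; last first.
    rewrite layerU sdeg_sub; last by have := ltn_ord k; lia.
    case: eqP => // E; exfalso; suff : 0 < k.+2%:R * (1 + s) by lra.
    by rewrite mulr_gt0 ?ltr0n.
  rewrite addr0 /l.
  have -> : (if sdeg s (a.1 + b.1 - 1, (a.2 + b.2 - 1)%N) == w + u
      then (a.2%:R * qK c0 b.1) *: 'X^(a.2 + b.2 - 1) else 0) = 0 :> {poly K}.
    have [->|a2] := posnP a.2; first by rewrite mul0r scale0r if_same.
    rewrite (@sdeg_sub s a b 1) ?ltn_addr //; case: eqP => // E; exfalso; move: E s_gt; lra.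
  rewrite addr0 scale1r.
  have [Ea|Na] := eqVneq (sdeg s a) w; have [Eb|Nb] := eqVneq (sdeg s b) u.
  - by rewrite Ea Eb eqxx exprD.
  - by rewrite mulr0; case: eqP => // E; case/eqP: Nb; lra.
  - by rewrite mul0r; case: eqP => // E; case/eqP: Na; lra.
  - by rewrite mul0r; case: eqP => // E; case/eqP: Na; lra.
rewrite /layer /lext mulr_suml; apply: eq_bigr => a _.
rewrite -scalerAl mulr_sumr; congr (_ *: _); apply: eq_bigr => b _.
by rewrite scalerAr.
Qed.

(** Only k = 1 contributes. With a.1 = w - s a.2 and b.1 = u - s b.2, the coefficient a.2 b.1 - b.2
    a.1 becomes u a.2 - w b.2: the slope cancels. *)
Lemma layer_comm w u p q : sbound s w p -> sbound s u q ->
  layer s (w + u - (1 + s)) (commW p q) =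
  qK c0 u *: ((layer s w p)^`() * layer s u q) -
  qK c0 w *: (layer s w p * (layer s u q)^`()).
Proof.
move=> bp bq; rewrite (commWE p q).
pose l d a : {poly K} := if sdeg s a == d then 'X^(a.2) else 0.
rewrite (layer_bilinear (l := fun a b =>
   qK c0 u *: ((l w a)^`() * l u b) - qK c0 w *: (l w a * (l u b)^`()))); last first.
  move=> a b /bp da /bq db; rewrite (commmonE c0) linearD linearB !(linear_sum (layer s _)) /=.
  have low (k : nat) (c : K) : (k.+2 <= a.2 + b.2)%N -> layer s (w + u - (1 + s))
      << c *g (a.1 + b.1 - k.+2%:R, (a.2 + b.2 - k.+2)%N) >> = 0.
    move=> le_k; rewrite layerU sdeg_sub //; case: eqP => // E; exfalso.
    suff : 1 * (1 + s) < k.+2%:R * (1 + s) by move: E; lra.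
    by rewrite ltr_pM2r // ltr1n.
  rewrite big1 => [|k _]; last by rewrite low //; have := ltn_ord k; lia.
  rewrite big1 => [|k _]; last by rewrite low //; have := ltn_ord k; lia.
  rewrite subr0 addr0 layerU /l.
  have [ab0|ab] := posnP (a.2 + b.2)%N.
    have [a0 b0] : a.2 = 0%N /\ b.2 = 0%N by lia.
    rewrite a0 b0 !mul0r subrr scale0r if_same.
    by do 2!case: ifP => _; rewrite ?deriv0 ?derivXn ?mulr0n ?mul0r ?mulr0 ?scaler0 ?subrr.
  rewrite (@sdeg_sub s a b 1) //.
  have [Ea|Na] := eqVneq (sdeg s a) w; have [Eb|Nb] := eqVneq (sdeg s b) u.
  - rewrite -Ea -Eb mul1r eqxx !derivXn /sdeg !rmorphD !rmorphM /= !rmorph_nat.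
    have E1 : 'X^(a.2.-1) *+ a.2 * 'X^(b.2) = 'X^(a.2 + b.2 - 1) *+ a.2 :> {poly K}.
      rewrite mulrnAl -exprD; have [->//|a2] := posnP a.2.
      by congr ('X^_ *+ _); lia.
    have E2 : 'X^(a.2) * ('X^(b.2.-1) *+ b.2) = 'X^(a.2 + b.2 - 1) *+ b.2 :> {poly K}.
      rewrite mulrnAr -exprD; have [->//|b2] := posnP b.2.
      by congr ('X^_ *+ _); lia.
    rewrite E1 E2 -!scaler_nat !scalerA -scalerBl; congr (_ *: _); ring.
  - rewrite deriv0 !mulr0 !scaler0 subr0; case: eqP => // E; case/eqP: Nb; lra.
  - rewrite deriv0 !mul0r !scaler0 subr0; case: eqP => // E; case/eqP: Na; lra.
  - rewrite deriv0 !mul0r !scaler0 subr0; case: eqP => // E; case/eqP: Na; lra.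
have dlext f r : (lext f r : {poly K})^`() = lext (fun a => (f a)^`()) r.
  by rewrite (linear_lext deriv).
have mlext f g : (lext f p : {poly K}) * lext g q =
    lext (fun a => lext (fun b => f a * g b) q) p.
  rewrite /lext mulr_suml; apply: eq_bigr => a _; rewrite mulr_sumr scaler_sumr.
  by apply: eq_bigr => b _; rewrite -scalerAl -scalerAr scalerA.
rewrite /layer !dlext !mlext /lext !scaler_sumr -sumrB; apply: eq_bigr => a _.
rewrite !scalerA ![_ * p@_a]mulrC -!scalerA -scalerBr; congr (_ *: _).
rewrite !scaler_sumr -sumrB; apply: eq_bigr => b _.
by rewrite !scalerA ![_ * q@_b]mulrC -!scalerA -scalerBr.
Qed.
End Layers.

(** * Automorphisms *)

Lemma denq_dvdE (x : rat) (l : nat) :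
  (denq x %| l%:Z)%Z = (l%:R * x \is a Num.int).
Proof.
apply/idP/idP => [/dvdzP[k lE]|/intrP[z zE]].
  by rewrite pmulrn lE intrM -mulrA [_ * x]mulrC -numqE -intrM intr_int.
have E : l%:Z * numq x = z * denq x.
  by apply: (@intr_inj rat); rewrite !intrM numqE mulrA -zE pmulrn.
have : (denq x %| l%:Z * numq x)%Z by rewrite E dvdz_mull.
by rewrite Gauss_dvdzl // coprimez_sym; apply: coprime_num_den.
Qed.

Section NatRat.
Implicit Types x y : rat.

Definition isN x : bool := (denq x == 1) && (0 <= x).

Lemma isNE x : isN x = (x \is a Num.nat).
Proof.
by rewrite /isN natrEint.
Qed.

Lemma isNP x : reflect (exists n : nat, x = n%:R) (isN x).
Proof. by rewrite isNE; apply: (iffP natrP) => -[n ->]; exists n. Qed.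

Lemma numq_nat (n : nat) : `|numq n%:R|%N = n.
Proof. by rewrite -[n%:R]/(n%:~R) numq_int. Qed.

End NatRat.

Section Substitution.
Variables (K : fieldType) (c0 : [pchar K] =i pred0).
Local Notation W := (Wr c0).
Implicit Types (p q : W) (a b : rat * nat).

Definition Xq : rat -> W := locked (fun x => << 1 *g (x, 0%N) >>).
Definition Yq : W := locked << 1 *g (0 : rat, 1%N) >>.

Lemma XqE x : Xq x = << 1 *g (x, 0%N) >>.
Proof. by rewrite /Xq -lock. Qed.

Lemma YqE : Yq = << 1 *g (0 : rat, 1%N) >>.
Proof. by rewrite /Yq -lock. Qed.

Lemma XqD x y : Xq (x + y) = Xq x * Xq y.
Proof.
rewrite !XqE -mulWq mulW_mon (mulmonE c0) /= big_ord0 mul0r monalgU0 addr0 addr0.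
by [].
Qed.

Lemma Xq0 : Xq 0 = 1. Proof. exact: XqE. Qed.

Lemma Xq_exp n : Xq n%:R = Xq 1 ^+ n.
Proof.
by elim: n => [|n IH]; [exact: Xq0 | rewrite exprS -IH -XqD -natr1 addrC].
Qed.

Lemma YqXq x : Yq * Xq x = Xq x * Yq + qK c0 x *: Xq (x - 1).
Proof.
rewrite !XqE YqE -!mulWq !mulW_mon !(mulmonE c0) /= !big_ord0 mul0r monalgU0 !addr0 !add0r.
by rewrite mul1r malgZUq mulr1.
Qed.

Lemma monE a : << 1 *g a >> = Xq a.1 * Yq ^+ a.2 :> W.
Proof.
case: a => x j /=; elim: j => [|j IH]; first by rewrite mulr1 XqE.
rewrite exprSr mulrA -IH YqE -mulWq mulW_mon (mulmonE c0) /= rmorph0 mulr0 monalgU0 add0r.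
rewrite big1 ?addr0 ?addn1 // => k _; rewrite (falling_nat_small K (n := 0)) //.
by rewrite mulr0 monalgU0.
Qed.

Variables (E : rat -> W) (D : W).

Definition subst : W -> W := lext (fun a => E a.1 * D ^+ a.2).

HB.instance Definition _ := GRing.isLinear.Build K W W *:%R
  subst (lextq_is_linear _).

Lemma substU (c : K) a : subst << c *g a >> = c *: (E a.1 * D ^+ a.2).
Proof. exact: lextU. Qed.

Hypothesis DE : forall x, D * E x = E x * D + qK c0 x *: E (x - 1).

(** Leibniz rule from the single relation [DE]; the coefficients are those of [mulmon], which is
    what makes [subst] multiplicative. *)
Lemma expDE n x : D ^+ n * E x =
  \sum_(k < n.+1) ('C(n, k)%:R * falling K x k) *: (E (x - k%:R) * D ^+ (n - k)).
Proof.
elim: n => [|n IH].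
  by rewrite big_ord1 falling0 bin0 mulr1 scale1r subr0 mulr1 mul1r.
rewrite exprS -mulrA IH mulr_sumr.
pose A (k : nat) := ('C(n, k)%:R * falling K x k.+1) *: (E (x - k.+1%:R) * D ^+ (n - k)).
pose B (k : nat) := ('C(n, k)%:R * falling K x k) *: (E (x - k%:R) * D ^+ (n.+1 - k)).
transitivity (\sum_(k < n.+1) (A k + B k)).
  apply: eq_bigr => k _; rewrite /A /B.
  have le_kn : (k <= n)%N by rewrite -ltnS.
  have -> : x - k.+1%:R = x - k%:R - 1 by rewrite -natr1 opprD addrA.
  have -> : falling K x k.+1 = falling K x k * qK c0 (x - k%:R).
    by rewrite (fallingS c0) rmorphB /= rmorph_nat.
  move: (x - k%:R) => y; rewrite subSn // exprS -[D * _]scalerAr [D * (E _ * _)]mulrA DE.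
  rewrite [(_ + _) * D ^+ _]mulrDl scalerDr -[(_ *: _) * D ^+ _]scalerAl scalerA.
  by rewrite addrC !mulrA.
have B_last : B n.+1 = 0 by rewrite /B bin_small // !mul0r scale0r.
pose T (k : nat) :=
  ('C(n.+1, k)%:R * falling K x k) *: (E (x - k%:R) * D ^+ (n.+1 - k)).
have T0 : T 0%N = B 0%N by rewrite /T /B !bin0.
have TS i : T i.+1 = A i + B i.+1.
  rewrite /T /A /B binS natrD subSS -scalerDl addrC.
  by move: (x - i.+1%:R) => y; rewrite mulrDl.
have -> : \sum_(k < n.+2) T k = B 0%N + \sum_(i < n.+1) (A i + B i.+1).
  by rewrite big_ord_recl T0; under [in LHS]eq_bigr do rewrite /bump /= TS.
have := @big_ord_recl W 0 +%R n.+1 (fun i : 'I_n.+2 => B i); rewrite /=.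
clear IH TS T0 T; clearbody A B; rewrite big_ord_recr /= B_last addr0 => BE.
by rewrite !big_split /= BE addrCA.
Qed.

(** Additivity of [E] in the exponent is asked only for exponents that really occur, because for the
    shear it holds only on natural numbers. *)
Lemma substM p q :
  (forall a b k, p@_a != 0 -> q@_b != 0 -> falling K b.1 k != 0 ->
     E (a.1 + b.1 - k%:R) = E a.1 * E (b.1 - k%:R)) ->
  subst (p * q) = subst p * subst q.
Proof.
move=> EM; rewrite mulqE_lext (linear_lext subst).
rewrite {3}/subst /lext mulr_suml !big_seq; apply: eq_bigr => a.
rewrite -mcoeff_neq0 => pa.
rewrite -/(lext _ q) (linear_lext subst) -scalerAl; congr (_ *: _).
rewrite /subst /lext mulr_sumr !big_seq; apply: eq_bigr => b.
rewrite -mcoeff_neq0 => qb.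
rewrite -/(lext _ _) -/(subst _) -scalerAr; congr (_ *: _).
rewrite /mulmon linear_sum /= mulrA -[_ * _ * E _]mulrA expDE mulr_sumr mulr_suml.
apply: eq_bigr => k _; rewrite substU -scalerAr -scalerAl.
have [->|nz] := eqVneq (falling K b.1 k) 0; first by rewrite !mulr0 !scale0r.
have le_k : (k <= a.2)%N by rewrite -ltnS.
congr (_ *: _); rewrite /= (EM a b) // -!mulrA -exprD; congr (_ * (_ * D ^+ _)).
by rewrite addnBAC.
Qed.
End Substitution.

Section Closed.
Variables (K : fieldType) (c0 : [pchar K] =i pred0).
Local Notation W := (Wr c0).
Implicit Types (p q : W) (a b : rat * nat) (S : rat * nat -> Prop).

(** Treats W^(l) and W uniformly: the elements supported in such a set form a subalgebra. *)
Definition mul_closed_supp S := S (0, 0%N) /\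
  forall a b k, S a -> S b -> (k <= a.2)%N -> falling K b.1 k != 0 ->
     S (a.1 + b.1 - k%:R, (a.2 + b.2 - k)%N).

Lemma closed_mul S p q : mul_closed_supp S ->
  supp_in S p -> supp_in S q -> supp_in S (p * q).
Proof. by move=> [_ SM] Sp Sq; rewrite -mulWq; apply: (supp_in_mul Sp Sq). Qed.

Lemma closed_exp S p n : mul_closed_supp S -> supp_in S p -> supp_in S (p ^+ n).
Proof.
move=> SM Sp; elim: n => [|n IH]; last by rewrite exprS; apply: closed_mul.
by apply: supp_inU => _; case: SM.
Qed.

Lemma supp_inZq S (c : K) p : supp_in S p -> supp_in S (c *: p).
Proof. by move=> Sp; rewrite -scaleWq; apply: supp_inZ. Qed.

Lemma supp_in_lextq S (f : rat * nat -> W) (p : Wq K) :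
  (forall a, p@_a != 0 -> supp_in S (f a)) -> supp_in S (lext f p).
Proof. by move=> Sf; rewrite -lextWq; apply: supp_in_lext. Qed.

Lemma closed_subst S (E : rat -> W) D p : mul_closed_supp S -> supp_in S p ->
  (forall a, S a -> supp_in S (E a.1)) -> supp_in S D -> supp_in S (subst E D p).
Proof.
move=> SM Sp SE SD; apply: supp_in_lextq => a /Sp Sa.
by apply: closed_mul => //; [exact: SE | exact: closed_exp].
Qed.

Definition SWl (l : nat) a : Prop := l%:R * a.1 \is a Num.int.
Definition SW a : Prop := isN a.1.

Lemma inWlP l (p : Wq K) : inWl l p <-> supp_in (SWl l) p.
Proof.
rewrite supp_in_msupp /SWl; split=> [/allP H a /H|H]; first by rewrite denq_dvdE.
by apply/allP => a /H; rewrite denq_dvdE.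
Qed.

Lemma inWeylP (p : Wq K) : inWeyl p <-> supp_in SW p.
Proof. by rewrite supp_in_msupp; split=> [/allP|H]; last apply/allP. Qed.

Lemma SWl_closed l : mul_closed_supp (SWl l).
Proof.
split=> [|a b k Sa Sb _ _]; first by rewrite /SWl mulr0 rpred0.
by rewrite /SWl /= mulrBr mulrDr rpredB ?rpredD // -natrM rpred_nat.
Qed.

Lemma SW_closed : mul_closed_supp SW.
Proof.
split=> // a b k /isNP[i ai] /isNP[j bj] _.
rewrite /SW /= ai bj => nz.
have le_k : (k <= j)%N by rewrite leqNgt; apply: contra nz => /(falling_nat_small K) ->.
by apply/isNP; exists (i + (j - k))%N; rewrite natrD natrB // addrA.
Qed.

Lemma SW_SWl l a : SW a -> SWl l a.
Proof. by case/isNP=> n an; rewrite /SWl an -natrM rpred_nat. Qed.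

End Closed.

Section Shift.
Variables (K : fieldType) (c0 : [pchar K] =i pred0).
Local Notation W := (Wr c0).
Implicit Types (p q : W) (a b : rat * nat) (s : rat) (lam : K).

Definition shift lam s : W -> W := subst (Xq c0) (Yq c0 + lam *: Xq c0 s).

HB.instance Definition _ lam s := GRing.isLinear.Build K W W *:%R
  (shift lam s) (lextq_is_linear _).

Lemma shift_comm lam s x : let D := Yq c0 + lam *: Xq c0 s in
  D * Xq c0 x = Xq c0 x * D + qK c0 x *: Xq c0 (x - 1).
Proof.
have XC : Xq c0 s * Xq c0 x = Xq c0 x * Xq c0 s by rewrite -!XqD addrC.
by rewrite /= mulrDl mulrDr YqXq -scalerAl -scalerAr XC addrAC.
Qed.

Lemma shiftM lam s p q : shift lam s (p * q) = shift lam s p * shift lam s q.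
Proof.
apply: substM => [x|a b k _ _ _]; first exact: shift_comm.
by rewrite -XqD addrA.
Qed.

Lemma shiftXq lam s x : shift lam s (Xq c0 x) = Xq c0 x.
Proof. by rewrite [in LHS]XqE /shift substU scale1r mulr1. Qed.

Lemma shift1 lam s : shift lam s 1 = 1.
Proof. by rewrite -(Xq0 c0) shiftXq. Qed.

Lemma shiftYq lam s : shift lam s (Yq c0) = Yq c0 + lam *: Xq c0 s.
Proof. by rewrite [in LHS]YqE /shift substU scale1r /= Xq0 mul1r. Qed.

Lemma shift_exp lam s p n : shift lam s (p ^+ n) = shift lam s p ^+ n.
Proof.
by elim: n => [|n IH]; [rewrite !expr0 shift1|rewrite !exprS shiftM IH].
Qed.

Lemma shiftK lam s : cancel (shift lam s) (shift (- lam) s).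
Proof.
move=> p; rewrite {2}/shift /subst (linear_lext (shift (- lam) s)).
rewrite [RHS](malg_sumUq p); apply: eq_bigr => a _; congr (_ *: _).
rewrite /= shiftM shift_exp shiftXq linearD linearZ /= shiftYq shiftXq.
by rewrite scaleNr subrK monE.
Qed.

Lemma shift_inj lam s : injective (shift lam s).
Proof. exact: can_inj (shiftK lam s). Qed.

Lemma shift_supp lam s (S : rat * nat -> Prop) p : mul_closed_supp K S ->
  (forall a, S a -> S (a.1, 0%N)) -> S (0, 1%N) -> S (s, 0%N) ->
  supp_in S p -> supp_in S (shift lam s p).
Proof.
move=> SM SX SY Ss Sp; apply: closed_subst => //.
  by move=> a Sa; rewrite XqE; apply: supp_inU => _; apply: SX.
by apply: supp_inD; [rewrite YqE|apply: supp_inZq; rewrite XqE]; apply: supp_inU.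
Qed.

Lemma shift_Wl lam s l p : l%:R * s \is a Num.int -> inWl l p -> inWl l (shift lam s p).
Proof.
move=> ls /inWlP Sp; apply/inWlP; apply: shift_supp => //.
- exact: SWl_closed.
- by rewrite /SWl mulr0 rpred0.
Qed.

Lemma shift_Weyl lam (n : nat) p : inWeyl p -> inWeyl (shift lam n%:R p).
Proof.
move=> /inWeylP Sp; apply/inWeylP; apply: shift_supp => //.
- exact: SW_closed.
- by apply/isNP; exists n.
Qed.

Lemma shift_autWl lam s l : l%:R * s \is a Num.int -> isAutWl l (shift lam s).
Proof.
move=> ls; split; first by move=> p; apply: shift_Wl.
split; first by move=> p q _ _; rewrite linearD.
split; first by move=> c p _; rewrite !scaleWq linearZ.
split; first by move=> p q _ _; rewrite !mulWq shiftM.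
split; first exact: shift1.
split; last by move=> p q _ _ /shift_inj.
move=> q Sq; exists (shift (- lam) s q); split; first exact: shift_Wl.
by have := shiftK (- lam) s q; rewrite opprK.
Qed.

Lemma shift_autW lam (n : nat) : isAutW (shift lam n%:R).
Proof.
split; first split; first by move=> p; apply: shift_Weyl.
  split; first by move=> p q _ _; rewrite linearD.
split; first by move=> c p _; rewrite !scaleWq linearZ.
  split; first by move=> p q _ _; rewrite !mulWq shiftM.
  exact: shift1.
split; last by move=> p q _ _ /shift_inj.
move=> q Sq; exists (shift (- lam) n%:R q); split; first exact: shift_Weyl.
by have := shiftK (- lam) n%:R q; rewrite opprK.
Qed.

End Shift.

(** * Arbitrary weights and invariance of leading forms under a shift *)

Section Weights.
Variables (K : fieldType) (c0 : [pchar K] =i pred0).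
Local Notation W := (Wr c0).
Implicit Types (p q : W) (a b : rat * nat) (s : rat) (lam : K) (x : rat * rat).

(** [layer] serves only directions with rho > 0. General weights are needed because leading forms
    must be preserved for every direction up to (-1, 1), and because the boundary weight (1, -1)
    decides whether there is a next edge. *)
Definition wdeg x a : rat := x.1 * a.1 + x.2 * a.2%:R.

Lemma wdegX x u : wdeg x (u, 0%N) = x.1 * u.
Proof. by rewrite /wdeg mulr0n mulr0 addr0. Qed.

Lemma wdegY x : wdeg x (0, 1%N) = x.2.
Proof. by rewrite /wdeg mulr1n mulr0 mulr1 add0r. Qed.

Lemma wdeg_sub x a b k : (k <= a.2 + b.2)%N ->
  wdeg x (a.1 + b.1 - k%:R, (a.2 + b.2 - k)%N) =
  wdeg x a + wdeg x b - k%:R * (x.1 + x.2).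
Proof. by move=> le_k; rewrite /wdeg /= natrB // natrD; ring. Qed.

Lemma wle_mul x d e p q : 0 <= x.1 + x.2 ->
  supp_in (fun a => wdeg x a <= d) p -> supp_in (fun a => wdeg x a <= e) q ->
  supp_in (fun a => wdeg x a <= d + e) (p * q).
Proof.
move=> x0 bp bq; rewrite -mulWq; apply: (supp_in_mul bp bq) => a b k da db le_k _.
rewrite wdeg_sub; last by rewrite (leq_trans le_k) ?leq_addr.
have : 0 <= k%:R * (x.1 + x.2) by rewrite mulr_ge0 ?ler0n.
lra.
Qed.

Lemma wlt_mull x d e p q : 0 <= x.1 + x.2 ->
  supp_in (fun a => wdeg x a < d) p -> supp_in (fun a => wdeg x a <= e) q ->
  supp_in (fun a => wdeg x a < d + e) (p * q).
Proof.
move=> x0 bp bq; rewrite -mulWq; apply: (supp_in_mul bp bq) => a b k da db le_k _.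
rewrite wdeg_sub; last by rewrite (leq_trans le_k) ?leq_addr.
have : 0 <= k%:R * (x.1 + x.2) by rewrite mulr_ge0 ?ler0n.
lra.
Qed.

Lemma wlt_mulr x d e p q : 0 <= x.1 + x.2 ->
  supp_in (fun a => wdeg x a <= d) p -> supp_in (fun a => wdeg x a < e) q ->
  supp_in (fun a => wdeg x a < d + e) (p * q).
Proof.
move=> x0 bp bq; rewrite -mulWq; apply: (supp_in_mul bp bq) => a b k da db le_k _.
rewrite wdeg_sub; last by rewrite (leq_trans le_k) ?leq_addr.
have : 0 <= k%:R * (x.1 + x.2) by rewrite mulr_ge0 ?ler0n.
lra.
Qed.

Lemma wle_exp x d p n : 0 <= x.1 + x.2 -> supp_in (fun a => wdeg x a <= d) p ->
  supp_in (fun a => wdeg x a <= n%:R * d) (p ^+ n).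
Proof.
move=> x0 bp; elim: n => [|n IH].
  by rewrite mul0r; apply: supp_inU => _; rewrite wdegX mulr0.
have -> : n.+1%:R * d = d + n%:R * d by rewrite -natr1; ring.
by rewrite exprS; apply: wle_mul.
Qed.

Lemma supp_in_Xq (S : rat * nat -> Prop) u : S (u, 0%N) -> supp_in S (Xq c0 u).
Proof. by move=> Su; rewrite XqE; apply: supp_inU. Qed.

Lemma supp_in_Yq (S : rat * nat -> Prop) : S (0, 1%N) -> supp_in S (Yq c0).
Proof. by move=> SY; rewrite YqE; apply: supp_inU. Qed.

(** For such a weight X^s is lighter than Y, so replacing Y by Y + lam X^s alters only lower
    terms. *)
Lemma shift_sub_wlt x lam s d p : 0 <= x.1 + x.2 -> x.1 * s < x.2 ->
  supp_in (fun a => wdeg x a <= d) p ->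
  supp_in (fun a => wdeg x a < d) (shift lam s p - p).
Proof.
move=> x0 xs bp.
have -> : shift lam s p - p =
    lext (fun a => Xq c0 a.1 * ((Yq c0 + lam *: Xq c0 s) ^+ a.2 - Yq c0 ^+ a.2)) p.
  rewrite {2}[p]malg_sumUq /shift /subst /lext -sumrB; apply: eq_bigr => a _.
  by rewrite -scalerBr monE mulrBr.
apply: supp_in_lextq => a /bp da.
apply: (supp_in_sub (S := fun b => wdeg x b < x.1 * a.1 + a.2%:R * x.2)).
  by move=> b /lt_le_trans; apply; move: da; rewrite /wdeg; lra.
apply: wlt_mulr => //; first by apply: supp_in_Xq; rewrite wdegX.
case: a {da} => u n /=; elim: n => [|n IH].
  by rewrite subrr; apply: supp_in0.
have YL : supp_in (fun b => wdeg x b <= x.2) (Yq c0).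
  by apply: supp_in_Yq; rewrite wdegY.
have ZL : supp_in (fun b => wdeg x b < x.2) (lam *: Xq c0 s).
  by apply: supp_inZq; apply: supp_in_Xq; rewrite wdegX.
(* A noncommutative telescoping step: the difference of powers is peeled off on the left. *)
have -> : (Yq c0 + lam *: Xq c0 s) ^+ n.+1 - Yq c0 ^+ n.+1 =
    (Yq c0 + lam *: Xq c0 s) * ((Yq c0 + lam *: Xq c0 s) ^+ n - Yq c0 ^+ n) +
    lam *: Xq c0 s * Yq c0 ^+ n.
  by rewrite !exprS mulrBr [X in _ - X + _]mulrDl opprD addrA addrNK.
have -> : n.+1%:R * x.2 = x.2 + n%:R * x.2 by rewrite -natr1; ring.
apply: supp_inD; last by apply: wlt_mull => //; apply: wle_exp.
apply: wlt_mulr => //; apply: supp_inD => //.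
by apply: supp_in_sub ZL => b; apply: ltW.
Qed.

End Weights.

Section ShiftLayers.
Variables (K : fieldType) (c0 : [pchar K] =i pred0).
Local Notation W := (Wr c0).
Implicit Types (p q : W) (lam : K) (w u : rat).

Lemma sdegX s u : sdeg s (u, 0%N) = u.
Proof. by rewrite /sdeg mulr0n mulr0 addr0. Qed.

Lemma sdegY s : sdeg s (0, 1%N) = s.
Proof. by rewrite /sdeg mulr1n mulr1 add0r. Qed.

Lemma layer_low s w u (p : Wq K) : sbound s u p -> u < w -> layer s w p = 0.
Proof.
move=> bp lt_uw; apply/polyP => j; rewrite coef_layer coef0; apply/eqP.
apply/negP => /negP /bp; rewrite /sdeg /=; lra.
Qed.

Lemma sbound_weaken s w u (p : Wq K) : w <= u -> sbound s w p -> sbound s u p.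
Proof. by move=> wu; apply: supp_in_sub => a /le_trans; apply. Qed.

Lemma layerZq s w (c : K) p : layer s w (c *: p) = c *: layer s w p.
Proof. by rewrite -scaleWq linearZ. Qed.

Lemma sbound_Xq s u : sbound s u (Xq c0 u).
Proof. by apply: supp_in_Xq; rewrite sdegX. Qed.

Lemma sbound_Yq s : sbound s s (Yq c0).
Proof. by apply: supp_in_Yq; rewrite sdegY. Qed.

Lemma layer_Xq s u : layer s u (Xq c0 u) = 1.
Proof. by rewrite XqE layerU sdegX eqxx scale1r. Qed.

Lemma layer_Yq s : layer s s (Yq c0) = 'X.
Proof. by rewrite YqE layerU sdegY eqxx scale1r. Qed.

Lemma sbound1 s : sbound s 0 (oneW K).
Proof. by apply: supp_inU => _; rewrite sdegX. Qed.

Lemma layer1 s : layer s 0 (oneW K) = 1.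
Proof. by rewrite layerU sdegX eqxx scale1r. Qed.

Variable s : rat.
Hypothesis s_gt : 0 < 1 + s.

Lemma sboundMq w u p q : sbound s w p -> sbound s u q -> sbound s (w + u) (p * q).
Proof. by move=> bp bq; rewrite -mulWq; apply: sboundM. Qed.

Lemma layerMq w u p q : sbound s w p -> sbound s u q ->
  layer s (w + u) (p * q) = layer s w p * layer s u q.
Proof. by move=> bp bq; rewrite -mulWq; apply: layerM. Qed.

Lemma layer_exp n w p : sbound s w p ->
  sbound s (n%:R * w) (p ^+ n) /\ layer s (n%:R * w) (p ^+ n) = layer s w p ^+ n.
Proof.
move=> bp; elim: n => [|n [IHb IHl]].
  by rewrite mul0r; split; [exact: sbound1 | exact: layer1].
have -> : n.+1%:R * w = w + n%:R * w by rewrite -natr1; ring.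
by rewrite !exprS -IHl; split; [apply: sboundMq | rewrite layerMq].
Qed.

(** Y + lam X^s is homogeneous of degree s with layer z + lam, so on layers the shift is the
    translation z |-> z + lam. *)
Lemma layer_shift lam w p : sbound s w p ->
  sbound s w (shift lam s p) /\
  layer s w (shift lam s p) = layer s w p \Po ('X + lam%:P).
Proof.
move=> bp; pose D := Yq c0 + lam *: Xq c0 s.
have bD : sbound s s D.
  apply: supp_inD; first exact: sbound_Yq.
  by apply: supp_inZq; apply: sbound_Xq.
have lD : layer s s D = 'X + lam%:P.
  by rewrite linearD /= layerZq layer_Yq layer_Xq alg_polyC.
have bm a : sbound s (sdeg s a) (Xq c0 a.1 * D ^+ a.2) /\
    layer s (sdeg s a) (Xq c0 a.1 * D ^+ a.2) = ('X + lam%:P) ^+ a.2.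
  have [bE lE] := layer_exp a.2 bD.
  have -> : sdeg s a = a.1 + a.2%:R * s by rewrite /sdeg [s * _]mulrC.
  split; first by apply: sboundMq => //; apply: sbound_Xq.
  by rewrite layerMq ?layer_Xq ?mul1r ?lE ?lD //; apply: sbound_Xq.
split.
  apply: supp_in_lextq => a /bp da; have [+ _] := bm a.
  exact: sbound_weaken.
rewrite /shift /subst -lextWq (linear_lext (layer s w)).
rewrite /layer (linear_lext (comp_poly ('X + lam%:P))); apply: eq_lext => a /bp da.
rewrite /= -/(layer s w _) -/D; have [ba la] := bm a.
have [<-|ne] := eqVneq (sdeg s a) w; first by rewrite la comp_Xn_poly.
by rewrite comp_poly0 (layer_low ba) // lt_neqAle ne.
Qed.

End ShiftLayers.

Lemma commutator1_exp (R : pzRingType) (A B : R) n :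
  B * A = A * B + 1 -> B * A ^+ n = A ^+ n * B + A ^+ n.-1 *+ n.
Proof.
move=> BA; elim: n => [|n IH]; first by rewrite mulr1 mul1r mulr0n addr0.
rewrite exprSr mulrA IH mulrDl -[A ^+ n * B * A]mulrA BA mulrDr mulr1 mulrA -exprSr.
rewrite -addrA; congr (_ + _); rewrite mulrSr addrC; congr (_ + _) => /=.
case: n {IH} => [|n]; first by rewrite !mulr0n mul0r.
by rewrite mulrnAl -exprSr.
Qed.

(** * Shears X |-> X + c Y^r of the Weyl algebra *)

Section Shear.
Variables (K : fieldType) (c0 : [pchar K] =i pred0).
Local Notation W := (Wr c0).
Implicit Types (p q : W) (a b : rat * nat) (c : K) (r n : nat).

Definition shear_gen c r : W := Xq c0 1 + c *: Yq c0 ^+ r.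

(* Only natural exponents matter; the junk value 0 elsewhere keeps the
   commutation relation [shear_comm] true for all of them. *)
Definition shear_pow c r (x : rat) : W :=
  if isN x then shear_gen c r ^+ `|numq x|%N else 0.

Definition shear c r : W -> W := subst (shear_pow c r) (Yq c0).

HB.instance Definition _ c r := GRing.isLinear.Build K W W *:%R
  (shear c r) (lextq_is_linear _).

Lemma shear_pow_nat c r n : shear_pow c r n%:R = shear_gen c r ^+ n.
Proof. by rewrite /shear_pow numq_nat; case: isNP => // -[]; exists n. Qed.

Lemma shear_comm c r x : Yq c0 * shear_pow c r x =
  shear_pow c r x * Yq c0 + qK c0 x *: shear_pow c r (x - 1).
Proof.
have YA : Yq c0 * shear_gen c r = shear_gen c r * Yq c0 + 1.
  rewrite /shear_gen mulrDl mulrDr YqXq rmorph1 scale1r subrr Xq0.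
  by rewrite -scalerAl -scalerAr -exprS -exprSr addrAC.
have [/isNP[n ->]|xN] := boolP (isN x); last first.
  rewrite /shear_pow (negPf xN) mulr0 mul0r add0r.
  case: isNP => [[n xE]|_]; last by rewrite scaler0.
  case/negP: xN; apply/isNP; exists n.+1.
  by rewrite -natr1 -xE subrK.
rewrite shear_pow_nat (commutator1_exp _ YA) qK_nat scaler_nat.
congr (_ + _); case: n => [|n]; first by rewrite !mulr0n.
by rewrite -natr1 addrK shear_pow_nat.
Qed.

(** The pairs for which b.1 - k would be negative carry a zero falling factorial, so [shear_pow] is
    only compared at natural exponents. *)
Lemma shearM c r p q : inWeyl p -> inWeyl q ->
  shear c r (p * q) = shear c r p * shear c r q.
Proof.
move=> /inWeylP Sp /inWeylP Sq; apply: substM => [x|a b k]; first exact: shear_comm.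
case/Sp/isNP=> i ->; case/Sq/isNP=> j -> nz.
have le_k : (k <= j)%N.
  by rewrite leqNgt; apply: contra nz => /(falling_nat_small K) ->.
by rewrite -natrB // -addrA -natrB // -natrD !shear_pow_nat exprD.
Qed.

Lemma inWeyl1 : inWeyl (1 : W).
Proof. by apply/inWeylP; apply: supp_inU. Qed.

Lemma inWeylM p q : inWeyl p -> inWeyl q -> inWeyl (p * q).
Proof.
move=> /inWeylP Sp /inWeylP Sq; apply/inWeylP.
by apply: closed_mul => //; apply: SW_closed.
Qed.

Lemma inWeylX p n : inWeyl p -> inWeyl (p ^+ n).
Proof.
by elim: n => [|n IH] Wp; [exact: inWeyl1 | rewrite exprS inWeylM ?IH].
Qed.

Lemma inWeyl_Yq : inWeyl (Yq c0).
Proof. by apply/inWeylP; apply: supp_in_Yq. Qed.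

Lemma inWeyl_shear_gen c r : inWeyl (shear_gen c r).
Proof.
apply/inWeylP; apply: supp_inD; first exact: supp_in_Xq.
by apply: supp_inZq; apply/inWeylP; rewrite inWeylX ?inWeyl_Yq.
Qed.

Lemma shear_Weyl c r p : inWeyl p -> inWeyl (shear c r p).
Proof.
move=> /inWeylP Sp; apply/inWeylP; apply: closed_subst => //.
- exact: SW_closed.
- move=> a /isNP[n ->]; rewrite shear_pow_nat.
  by apply/inWeylP; rewrite inWeylX ?inWeyl_shear_gen.
- by apply: supp_in_Yq.
Qed.

Lemma shear1 c r : shear c r 1 = 1.
Proof. by rewrite /shear substU scale1r (shear_pow_nat c r 0) mulr1. Qed.

Lemma shearX c r p n : inWeyl p -> shear c r (p ^+ n) = shear c r p ^+ n.
Proof.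
move=> Wp; elim: n => [|n IH]; first by rewrite !expr0 shear1.
by rewrite !exprS shearM ?inWeylX // IH.
Qed.

Lemma shear_Yq c r : shear c r (Yq c0) = Yq c0.
Proof.
by rewrite [in LHS]YqE /shear substU scale1r (shear_pow_nat c r 0) mul1r.
Qed.

Lemma shear_Xq1 c r : shear c r (Xq c0 1) = shear_gen c r.
Proof. by rewrite [in LHS]XqE /shear substU scale1r (shear_pow_nat c r 1) mulr1. Qed.

Lemma shearK c r p : inWeyl p -> shear (- c) r (shear c r p) = p.
Proof.
move=> /inWeylP Sp; rewrite {2}/shear /subst (linear_lext (shear (- c) r)).
rewrite [RHS]malg_sumUq -/(lext _ _); apply: eq_lext => a /Sp /isNP[n an] /=.
rewrite an shear_pow_nat shearM ?inWeylX ?inWeyl_shear_gen ?inWeyl_Yq //.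
rewrite !shearX ?inWeyl_shear_gen ?inWeyl_Yq // shear_Yq.
rewrite {1}/shear_gen linearD linearZ /= shearX ?inWeyl_Yq // shear_Yq shear_Xq1.
by rewrite /shear_gen scaleNr subrK monE an Xq_exp.
Qed.

Lemma shear_autW c r : isAutW (shear c r).
Proof.
split; first split; first by move=> p; apply: shear_Weyl.
  split; first by move=> p q _ _; rewrite linearD.
  split; first by move=> d p _; rewrite !scaleWq linearZ.
  split; first by move=> p q Wp Wq; rewrite !mulWq shearM.
  exact: shear1.
split.
  move=> q Sq; exists (shear (- c) r q); split; first exact: shear_Weyl.
  by have := @shearK (- c) r q Sq; rewrite opprK.
by move=> p q Wp Wq pq; rewrite -(shearK c r Wp) pq shearK.
Qed.

Lemma top_coef_pow c r n : (0 < r)%N ->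
  let A : {poly K} := (1 + c *: 'X^r) ^+ n in
  (size A <= (r * n).+1)%N /\ A`_(r * n) = c ^+ n.
Proof.
move=> r0 /=; elim: n => [|n [IHs IHc]].
  by rewrite !expr0 muln0 size_poly1 coef1 eqxx.
rewrite exprSr; set A := _ ^+ n in IHs IHc *; split.
  apply: (leq_trans (size_polyMleq _ _)).
  have : (size (1 + c *: 'X^r : {poly K})%R <= r.+1)%N.
    apply: (leq_trans (size_polyD _ _)); rewrite size_poly1 geq_max ltnS leq0n /=.
    by apply: (leq_trans (size_scale_leq _ _)); rewrite size_polyXn.
  move: IHs; set u := size A; set v := size _; rewrite mulnS; lia.
rewrite mulrDr mulr1 -scalerAr coefD coefZ coefMXn mulnS ltnNge leq_addr /= addKn IHc.
rewrite nth_default ?add0r ?exprS //; apply: (leq_trans IHs); lia.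
Qed.

(** The pure power of Y in (X + z^(-r) Y^r)^i Y^j has coefficient z^(-ri). On the line through (0,
    D) one has ri + j = D, so this equals z^(-D) z^j, and the contributions add up to the value of
    the layer at z. A root z thus removes Y^D, and a non-root creates it. *)
Lemma shear_top (z : K) r w (D : nat) p : z != 0 -> (0 < r)%N ->
    D%:R = r%:R * w -> inWeyl p -> sbound r%:R^-1 w p ->
  sbound r%:R^-1 w (shear (z ^- r) r p) /\
  (shear (z ^- r) r p)@_(0, D) = z ^- D * (layer r%:R^-1 w p).[z].
Proof.
move=> z0 r0 DE /inWeylP Sp bp; set c := z ^- r; set s : rat := r%:R^-1.
have rs : r%:R * s = 1 by rewrite mulfV // pnatr_eq0 -lt0n.
have s_gt : 0 < 1 + s by rewrite addr_gt0 ?ltr01 // invr_gt0 ltr0n.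
have [bYr lYr] := layer_exp s_gt r (@sbound_Yq K c0 s).
have bA : sbound s 1 (shear_gen c r).
  by apply: supp_inD; [exact: sbound_Xq | apply: supp_inZq; rewrite -rs].
have lA : layer s 1 (shear_gen c r) = 1 + c *: 'X^r.
  by rewrite linearD /= layer_Xq layerZq -{1}rs lYr layer_Yq.
have bm n j : sbound s (n%:R + s * j%:R) (shear_gen c r ^+ n * Yq c0 ^+ j) /\
    layer s (n%:R + s * j%:R) (shear_gen c r ^+ n * Yq c0 ^+ j)
    = (1 + c *: 'X^r) ^+ n * 'X^j.
  have [bE lE] := layer_exp s_gt n bA.
  have [bF lF] := layer_exp s_gt j (@sbound_Yq K c0 s).
  move: bE lE bF lF; rewrite mulr1 [_ * s]mulrC lA layer_Yq => bE lE bF lF.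
  by split; [apply: sboundMq | rewrite layerMq // lE lF].
have bmon a : p@_a != 0 -> exists2 n : nat, a.1 = n%:R &
    shear_pow c r a.1 * Yq c0 ^+ a.2 = shear_gen c r ^+ n * Yq c0 ^+ a.2.
  by case/Sp/isNP=> n an; exists n => //; rewrite an shear_pow_nat.
split.
  apply: supp_in_lextq => a pa; have [n an ->] := bmon a pa.
  have [+ _] := bm n a.2; apply: sbound_weaken.
  by have := bp a pa; rewrite /sdeg an.
have -> : (shear c r p)@_(0, D) = (layer s w (shear c r p))`_D.
  rewrite coef_layer; congr (mcoeff (_, _) _).
  by rewrite DE mulrA [s * _]mulrC rs mul1r subrr.
rewrite {1}/shear /subst -lextWq (linear_lext (layer s w)) [in RHS]/layer /lext.
rewrite coef_sum horner_sum mulr_sumr !big_seq; apply: eq_bigr => a.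
rewrite -mcoeff_neq0 => pa; have [n an ->] := bmon a pa.
rewrite coefZ hornerZ mulrCA; congr (_ * _).
have [bn ln] := bm n a.2.
have da : sdeg s a = n%:R + s * a.2%:R by rewrite /sdeg an.
rewrite /=; case: eqP => [Ew|ne].
  have DnE : D = (r * n + a.2)%N.
    apply/eqP; rewrite -(eqr_nat rat) DE -Ew da natrD natrM mulrDr mulrA rs mul1r.
    by [].
  rewrite -Ew da ln coefMXn DnE ltnNge leq_addl /= addnK.
  have [_ ->] := top_coef_pow c n r0.
  rewrite hornerXn exprD invfM -mulrA mulVf ?expf_neq0 // mulr1.
  by rewrite /c exprVn exprM.
rewrite horner0 mulr0 (layer_low bn) ?coef0 // -da lt_neqAle; apply/andP; split.
  by apply/eqP.
exact: bp.
Qed.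

End Shear.

(** * The bracket on polynomials in one variable *)

Section PoissonPoly.
Variables (K : fieldType) (c0 : [pchar K] =i pred0).
Local Notation q := (qK c0).
Implicit Types (p h g r : {poly K}) (z : K) (w u : rat).

(* The Poisson bracket of [x^w p(x^(-s) y)] and [x^u h(x^(-s) y)] is
   [x^(w+u-1-s) f(x^(-s) y)] with [f = pb w u p h], whatever [s] is. *)
Definition pb w u p h : {poly K} := q u *: (p^`() * h) - q w *: (p * h^`()).

(** The additional factor L on the left avoids the exponents t - 1 and e - 1. The right-hand side
    displays the local leading coefficient u t - w e of a bracket. *)
Lemma pb_local w u z (t e : nat) p h :
  let L := 'X - z%:P in
  L * pb w u (L ^+ t * p) (L ^+ e * h) =
  L ^+ (t + e) * (q (u * t%:R - w * e%:R) *: (p * h) + L * pb w u p h).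
Proof.
set L := 'X - z%:P => /=.
have dL n f : L * (L ^+ n * f)^`() = L ^+ n * (f *+ n + L * f^`()).
  rewrite derivM deriv_exp derivXsubC; case: n => [|n] /=; first by rewrite !mulr0n; ring.
  by rewrite exprS; ring.
rewrite /pb mulrBr -!scalerAr.
rewrite [L * (_^`() * _)]mulrA dL [L * (_ * _^`())]mulrCA dL.
rewrite rmorphB !rmorphM !rmorph_nat /= exprD.
rewrite -!mul_polyC polyCB !polyCM !polyC_natr; ring.
Qed.

Lemma mup_decomp p z : p != 0 ->
  exists2 p1, ~~ root p1 z & p = ('X - z%:P) ^+ mup z p * p1.
Proof.
move=> p0; have [m [p1 + pE]] := multiplicity_XsubC p z.
rewrite p0 /= => rp1; exists p1 => //; rewrite {1}pE mulrC; congr (_ ^+ _ * _).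
have p10 : p1 != 0 by apply: contraNneq rp1 => ->; rewrite root0.
rewrite pE mupM ?expf_neq0 ?polyXsubC_eq0 // mup_XsubCX eqxx mupNroot //.
Qed.

Lemma root_mup p z : p != 0 -> root p z = (0 < mup z p)%N.
Proof. by move=> p0; rewrite -XsubC_dvd // dvdp_XsubCl. Qed.

(** Otherwise the bracket would have order exactly t + e - 1 at z. *)
Lemma mup_pb0 w u p h z : p != 0 -> h != 0 -> pb w u p h = 0 ->
  u * (mup z p)%:R = w * (mup z h)%:R.
Proof.
move=> p0 h0 pb0; have [p1 rp1 pE] := mup_decomp z p0.
have [h1 rh1 hE] := mup_decomp z h0; move: pb0.
set t := mup z p; set e := mup z h => pb0.
have := pb_local w u z t e p1 h1; rewrite /= -pE -hE pb0 mulr0 => /esym/eqP.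
rewrite mulf_eq0 expf_eq0 polyXsubC_eq0 andbF /= => /eqP /(congr1 (horner^~ z)).
rewrite hornerD hornerZ !hornerM hornerXsubC subrr mul0r addr0 horner0 => /eqP.
rewrite !mulf_eq0 -!rootE (negPf rp1) (negPf rh1) !orbF qK_eq0 subr_eq0.
by move=> /eqP.
Qed.

Lemma coefM_top p h n m : (size p <= n.+1)%N -> (size h <= m.+1)%N ->
  (p * h)`_(n + m) = p`_n * h`_m.
Proof.
move=> sp sh; have lt_n : (n < (n + m).+1)%N by rewrite ltnS leq_addr.
rewrite coefM (bigD1 (Ordinal lt_n)) //= addKn big1 ?addr0 // => i ne.
have [lt_in|lt_ni|E] := ltngtP i n.
- by rewrite [h`__]nth_default ?mulr0 // (leq_trans sh) //; lia.
- by rewrite [p`__]nth_default ?mul0r // (leq_trans sp).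
- by case/eqP: ne; apply: val_inj.
Qed.

(** After multiplication by 'X the derivatives become Euler operators, which multiply the
    coefficient of index i by i. *)
Lemma coef_pb_top w u p h n m : (size p <= n.+1)%N -> (size h <= m.+1)%N ->
  (0 < n + m)%N ->
  (pb w u p h)`_(n + m).-1 = q (u * n%:R - w * m%:R) * (p`_n * h`_m).
Proof.
move=> sp sh nm0.
have th (f : {poly K}) i : ('X * f^`())`_i = f`_i *+ i.
  by rewrite coefXM coef_deriv; case: i.
have sth (f : {poly K}) k : (size f <= k.+1)%N -> (size ('X * f^`())%R <= k.+1)%N.
  move=> sf; apply/leq_sizeP => i lt_ki; rewrite th (leq_sizeP _ _ sf) //.
  by rewrite mul0rn.
have -> : (pb w u p h)`_(n + m).-1 = ('X * pb w u p h)`_(n + m).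
  by rewrite coefXM; case: (n + m)%N nm0.
rewrite /pb mulrBr -!scalerAr mulrA [X in _ - _ *: X]mulrCA coefB !coefZ.
rewrite (coefM_top (sth _ _ sp) sh) (coefM_top sp (sth _ _ sh)) !th.
by rewrite rmorphB !rmorphM !rmorph_nat /=; ring.
Qed.

(** The counterpart of [mup_pb0] at infinity, with degrees instead of multiplicities. *)
Lemma size_pb0 w u p h : p != 0 -> h != 0 -> pb w u p h = 0 ->
  u * (size p).-1%:R = w * (size h).-1%:R.
Proof.
move=> p0 h0 pb0; set n := (size p).-1; set m := (size h).-1.
have sp : (size p <= n.+1)%N by rewrite prednK ?size_poly_gt0.
have sh : (size h <= m.+1)%N by rewrite prednK ?size_poly_gt0.
have [nm|nm] := posnP (n + m)%N.
  have [-> ->] : n = 0%N /\ m = 0%N by lia.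
  by rewrite !mulr0n !mulr0.
have := coef_pb_top w u sp sh nm; rewrite pb0 coef0 => /esym/eqP.
rewrite !mulf_eq0 -!lead_coefE !lead_coef_eq0 (negPf p0) (negPf h0) !orbF.
by rewrite qK_eq0 subr_eq0 => /eqP.
Qed.

End PoissonPoly.

(** * The equation [p, F] = p over an algebraically closed field *)

Section PoissonClosed.
Variables (K : closedFieldType) (c0 : [pchar K] =i pred0).
Local Notation q := (qK c0).
Implicit Types (p h g r : {poly K}) (z : K) (w u b : rat).

Lemma closed_poly_factor p : p != 0 ->
  exists2 rs : seq K, p = lead_coef p *: \prod_(z <- rs) ('X - z%:P) &
    forall z, mup z p = count_mem z rs.
Proof.
move=> p0; have [rs pE] := closed_field_poly_normal p; exists rs => // z.
rewrite {1}pE -mul_polyC mupMr ?mu_prod_XsubC //.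
by rewrite rootC lead_coef_eq0.
Qed.

Lemma size_factor (rs : seq K) (c : K) :
  c != 0 -> (size (c *: \prod_(z <- rs) ('X - z%:P))%R).-1 = size rs.
Proof. by move=> c1; rewrite size_scale // size_prod_XsubC. Qed.

Lemma dvdp_mup p h : p != 0 -> h != 0 ->
  (forall z, (mup z p <= mup z h)%N) -> p %| h.
Proof.
move=> p0 h0 le_ph; have [rs pE cp] := closed_poly_factor p0.
rewrite pE dvdpZl ?lead_coef_eq0 //.
have {le_ph} : forall z, (count_mem z rs <= mup z h)%N by move=> z; rewrite -cp.
elim: {p p0 pE cp} rs h h0 => [|z rs IH] h h0 le_ph.
  by rewrite big_nil dvd1p.
have : ('X - z%:P) %| h.
  by rewrite XsubC_dvd // (leq_trans _ (le_ph z)) //= eqxx.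
move=> /dvdpP[h1 hE]; rewrite hE big_cons mulrC dvdp_mul2r ?polyXsubC_eq0 //.
have h10 : h1 != 0 by apply: contraNneq h0; rewrite hE => ->; rewrite mul0r.
apply: IH => // y; have := le_ph y; rewrite hE mupM ?polyXsubC_eq0 //=.
by rewrite (@mup_XsubCX _ 1); case: eqP; lia.
Qed.

(** The solution is g = h p / r: bracketing with p is a derivation that sends h to r and kills p and
    r. The work lies in showing that r divides h p. *)
Lemma pb_divide w u b p h : 0 < w -> 0 < b -> p != 0 ->
  let r := pb c0 w u p h in
  r != 0 -> pb c0 w (u + w - b) p r = 0 ->
  exists g, pb c0 w b p g = p.
Proof.
move=> w0 b0 p0 r r0 pr0.
have h0 : h != 0 by apply: contraNneq r0; rewrite /r /pb => ->; rewrite deriv0 !mulr0 !scaler0 subrr.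
have : r %| h * p.
  apply: dvdp_mup => // [|z]; first by rewrite mulf_neq0.
  rewrite mupM //; have E1 := mup_pb0 z p0 r0 pr0.
  have [p1 rp1 pE] := mup_decomp z p0; have [h1 rh1 hE] := mup_decomp z h0.
  rewrite leqNgt; apply/negP => lt_r.
  move: E1 lt_r; set t := mup z p; set e := mup z h; set tau := mup z r => E1 lt_r.
  (* An order tau > t + e of r forces the local leading coefficient u t - w e to vanish. With E1
     this gives w tau = w (t + e) - b t, which is impossible for positive w and b. *)
  suff E2 : u * t%:R = w * e%:R.
    have tau_gt : (e%:R + t%:R + 1 : rat) <= tau%:R by rewrite -natrD natr1 ler_nat addnC; lia.
    have : w * (e%:R + t%:R + 1) <= w * tau%:R by rewrite ler_pM2l.
    have : 0 <= b * t%:R by rewrite mulr_ge0 ?ler0n // ltW.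
    move: E1 E2 w0; rewrite mulrBl mulrDl; lra.
  have [r1 rr1 rE] := mup_decomp z r0.
  have := pb_local c0 w u z t e p1 h1; rewrite /= -pE -hE -/r rE -/tau mulrA -exprS.
  have -> : tau.+1 = ((t + e) + (tau - (t + e)).+1)%N by lia.
  rewrite exprD -mulrA => /mulfI; rewrite expf_neq0 ?polyXsubC_eq0 // => /(_ isT).
  rewrite exprS -mulrA => /(congr1 (horner^~ z)).
  rewrite !hornerD hornerZ !hornerM hornerXsubC subrr !mul0r addr0 => /esym/eqP.
  rewrite !mulf_eq0 -!rootE (negPf rp1) (negPf rh1) !orbF qK_eq0 subr_eq0.
  by move=> /eqP.
case/dvdpP=> g gE; exists g.
(* Multiplication by r^2 clears denominators; g' r is then eliminated by differentiating g r = h p,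
   and p r' by the vanishing of the bracket of p and r. *)
apply/eqP; rewrite -subr_eq0; apply/eqP/(mulfI (expf_neq0 2 r0)); rewrite mulr0.
have dE : (g * r)^`() = (h * p)^`() by rewrite gE.
have rE : r = (q u)%:P * (p^`() * h) - (q w)%:P * (p * h^`()) by rewrite !mul_polyC.
move: dE pr0; rewrite !derivM /pb rmorphB rmorphD /= -!mul_polyC polyCB polyCD.
move: (q w)%:P (q b)%:P (q u)%:P (r^`()) rE => a bb c r' rE dE pr0.
clearbody r.
have {}dE : g^`() * r = h^`() * p + h * p^`() - g * r' by rewrite -dE addrK.
have {}pr0 : a * (p * r') = (c + a - bb) * (p^`() * r).
  by apply/esym/eqP; rewrite -subr_eq0 pr0.
transitivity (bb * p^`() * r * (g * r) - a * p * r * (g^`() * r) - r * r * p).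
  ring.
rewrite dE.
transitivity (bb * p^`() * r * (g * r) - a * p * r * (h^`() * p + h * p^`())
   + a * (p * r') * (g * r) - r * r * p); first ring.
rewrite pr0 -gE.
transitivity (r * p * ((c * (p^`() * h) - a * (p * h^`())) - r)); first ring.
by rewrite -rE subrr mulr0.
Qed.

Section Eigen.
Variables (w b : rat) (p g : {poly K}).
Hypotheses (w0 : 0 < w) (b0 : 0 < b) (p0 : p != 0) (pg : pb c0 w b p g = p).

Lemma eigen_neq0 : g != 0.
Proof.
apply: contraNneq p0 => g0; rewrite -pg g0 /pb deriv0 !mulr0 !scaler0 subrr.
by [].
Qed.

(** Let t and e be the orders of p and g. For e = 0 the bracket would have order t - 1, for e > 1 it
    would have order greater than t, while p has order t. For e = 1 the leading coefficients of
    order t give (b t - w) g1(z) = 1. *)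
Lemma eigen_order z : (0 < mup z p + mup z g)%N ->
  mup z g = 1%N /\ b * (mup z p)%:R != w.
Proof.
have g0 := eigen_neq0.
have [p1 rp1 pE] := mup_decomp z p0; have [g1 rg1 gE] := mup_decomp z g0.
have := pb_local c0 w b z (mup z p) (mup z g) p1 g1.
rewrite /= -pE -gE pg; set t := mup z p; set e := mup z g.
rewrite pE -/t mulrCA exprD -mulrA => /mulfI.
rewrite expf_neq0 ?polyXsubC_eq0 // => /(_ isT) E te.
have e1 : e = 1%N.
  case: e E te => [|[|e]] //.
    rewrite expr0 mul1r addn0 mulr0 subr0 => /(congr1 (horner^~ z)).
    rewrite hornerD hornerZ !hornerM hornerXsubC subrr !mul0r addr0 => /esym/eqP; rewrite !mulf_eq0 -!rootE.
    rewrite (negPf rp1) (negPf rg1) !orbF qK_eq0 mulf_eq0 pnatr_eq0.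
    by rewrite gt_eqF //= => /eqP ->.
  move=> E _; move: E; rewrite exprS -mulrA => /mulfI.
  rewrite polyXsubC_eq0 => /(_ isT); rewrite exprS -mulrA => /(congr1 (horner^~ z)).
  rewrite hornerM hornerXsubC subrr mul0r => /eqP.
  by rewrite -rootE (negPf rp1).
split=> //; move: E; rewrite e1 expr1 => /mulfI; rewrite polyXsubC_eq0 => /(_ isT).
move=> /(congr1 (horner^~ z)); rewrite hornerD hornerZ !hornerM hornerXsubC subrr mul0r addr0.
move=> E; apply: contraNneq rp1 => bt; rewrite rootE E bt mulr1 subrr rmorph0 mul0r.
by [].
Qed.

(** If deg g > 1, the possible top degree of the bracket exceeds deg p, so its coefficient must
    vanish. *)
Lemma eigen_size : (2 < size g)%N -> b * (size p).-1%:R = w * (size g).-1%:R.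
Proof.
move=> sg; have g0 := eigen_neq0; set n := (size p).-1; set m := (size g).-1.
have sp : (size p <= n.+1)%N by rewrite prednK ?size_poly_gt0.
have sh : (size g <= m.+1)%N by rewrite prednK ?size_poly_gt0.
have m2 : (1 < m)%N by rewrite /m; lia.
have nm : (0 < n + m)%N by lia.
have := coef_pb_top c0 w b sp sh nm; rewrite pg nth_default; last first.
  by rewrite (leq_trans sp) //; lia.
move=> /esym/eqP; rewrite !mulf_eq0 -!lead_coefE !lead_coef_eq0 (negPf p0) (negPf g0).
by rewrite !orbF qK_eq0 subr_eq0 => /eqP.
Qed.

(** The roots of g are simple and include those of p, so deg p is the sum of [mup z p] over them. If
    no summand exceeded w / b, all would be strictly smaller, as equality is excluded by
    [eigen_order]. For deg g > 1 the sum would be below (w / b) deg g, which is deg p; for deg g <=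
    1 it contradicts the hypothesis directly. *)
Lemma eigen_root : w < b * (size p).-1%:R -> exists z, w < b * (mup z p)%:R.
Proof.
move=> wN; have g0 := eigen_neq0.
have [rp pE cp] := closed_poly_factor p0; have [rg gE cg] := closed_poly_factor g0.
have sp : (size p).-1 = size rp by rewrite pE size_factor ?lead_coef_eq0.
have sg : (size g).-1 = size rg by rewrite gE size_factor ?lead_coef_eq0.
have ug : uniq rg.
  apply: count_mem_uniq => z; rewrite -cg; have [z_in|z_out] := boolP (z \in rg).
    have mz : (0 < mup z g)%N by rewrite cg -has_count has_pred1.
    by have [-> _] := @eigen_order z (ltn_addl _ mz).
  by rewrite cg; apply/count_memPn.
have sub_rp z : z \in rp -> z \in rg.
  move=> z_in; have mz : (0 < mup z p)%N by rewrite cp -has_count has_pred1.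
  have [e1 _] := @eigen_order z (ltn_addr _ mz).
  by rewrite -has_pred1 has_count -cg e1.
have sum_mup : size rp = (\sum_(z <- rg) mup z p)%N.
  under eq_bigr do rewrite cp.
  rewrite -sum1_size (eq_big_seq (fun z => \sum_(y <- rg) (y == z : nat))%N); last first.
    move=> z /sub_rp z_in; rewrite (bigD1_seq z) //= eqxx big1 // => y.
    by move/negPf=> ->.
  rewrite exchange_big /=; apply: eq_bigr => y _.
  by rewrite -sum1_count [RHS]big_mkcond /=; apply: eq_bigr => z _; rewrite eq_sym; case: eqP.
have [/hasP[z _ zP]|/hasPn none] := boolP (has (fun z => w < b * (mup z p)%:R) rg).
  by exists z.
have lt_each z : z \in rg -> b * (mup z p)%:R < w.
  move=> z_in; have mz : (0 < mup z g)%N by rewrite cg -has_count has_pred1.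
  have [_ ne] := @eigen_order z (ltn_addl _ mz).
  by rewrite lt_neqAle ne leNgt none.
have [rg0|rg1|rg2] := ltngtP (size rg) 1%N.
- have rgE : rg = [::] by apply: size0nil; lia.
  move: wN; rewrite sp sum_mup rgE big_nil mulr0 => wN.
  by move: (lt_trans w0 wN); rewrite ltxx.
- have sumE : b * (size rp)%:R = \sum_(z <- rg) b * (mup z p)%:R.
    by rewrite sum_mup natr_sum mulr_sumr.
  have sg3 : (2 < size g)%N by rewrite -subn1 in sg; lia.
  have := eigen_size sg3; rewrite sp sg sumE => E.
  have [z0 z0_in] : exists z, z \in rg.
    by case: (rg) rg1 => // z l _; exists z; rewrite mem_head.
  suff : \sum_(z <- rg) b * (mup z p)%:R < w * (size rg)%:R by rewrite E ltxx.
  have -> : w * (size rg)%:R = \sum_(z <- rg) w.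
    by rewrite big_const_seq count_predT iter_addr_0 mulr_natr.
  rewrite (big_rem z0) //= [X in _ < X](big_rem z0) //= ltr_leD ?lt_each //.
  rewrite !big_seq; apply: ler_sum => z /mem_rem z_in.
  by rewrite ltW ?lt_each.
- move: rg2 lt_each sum_mup sp; case: (rg) => [|z [|]] // _ lt_each.
  rewrite big_seq1 => -> sp; move: wN; rewrite sp => wN.
  by have := lt_trans wN (lt_each z (mem_head _ _)); rewrite ltxx.
Qed.

(** All roots of p are roots of g, and g has just one. This is the case en(F) = (1, 1). *)
Lemma eigen_linear z : size g = 2%N -> root p z -> mup z p = (size p).-1.
Proof.
move=> sg rz; have g0 := eigen_neq0.
have [rp pE cp] := closed_poly_factor p0; have [rg gE cg] := closed_poly_factor g0.
have sp : (size p).-1 = size rp by rewrite pE size_factor ?lead_coef_eq0.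
have sg' : size rg = 1%N by rewrite -(size_factor rg (c := lead_coef g)) ?lead_coef_eq0 // -gE sg.
have sub_rp y : y \in rp -> y \in rg.
  move=> z_in; have mz : (0 < mup y p)%N by rewrite cp -has_count has_pred1.
  have [e1 _] := @eigen_order y (ltn_addr _ mz).
  by rewrite -has_pred1 has_count -cg e1.
have z_rp : z \in rp by rewrite -has_pred1 has_count -cp -root_mup.
rewrite sp cp; apply/eqP; rewrite -all_count; apply/allP => y y_in /=.
move: sg' (sub_rp z z_rp) (sub_rp y y_in); case: (rg) => [|v [|]] //= _.
by rewrite !inE => /eqP -> /eqP ->.
Qed.

End Eigen.
End PoissonClosed.

(** * Existence of F *)

Lemma seq_argmax (T : eqType) (f : T -> rat) (r : seq T) : r != [::] ->
  exists2 x, x \in r & forall y, y \in r -> f y <= f x.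
Proof.
elim: r => // x [|y r] IH _.
  by exists x; rewrite ?mem_head // => z; rewrite inE => /eqP ->.
have [//|m m_in m_max] := IH; have [le_xm|lt_mx] := leP (f x) (f m).
  exists m; first by rewrite inE m_in orbT.
  by move=> z; rewrite inE => /orP[/eqP -> //|]; apply: m_max.
exists x; first exact: mem_head.
by move=> z; rewrite inE => /orP[/eqP -> //|/m_max /le_trans]; apply; apply: ltW.
Qed.

Section Degree.
Variables (K : fieldType) (s : rat).

Lemma layer_neq0P w (p : Wq K) :
  layer s w p != 0 <-> exists2 a, p@_a != 0 & sdeg s a = w.
Proof.
split=> [l0|[a pa da]].
  exists (w - s * (size (layer s w p)).-1%:R, (size (layer s w p)).-1).
    by rewrite -coef_layer -lead_coefE lead_coef_eq0.
  by rewrite /sdeg /= subrK.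
apply: contraNneq pa => l0; move: (coef_layer s w p a.2).
by rewrite l0 coef0 -da /sdeg addrK -surjective_pairing => <-.
Qed.

Lemma sdeg_exists (p : Wq K) : p != 0 ->
  exists2 w, sbound s w p & layer s w p != 0.
Proof.
move=> p0; have [|a a_in a_max] := @seq_argmax _ (sdeg s) (msupp p).
  apply: contraNneq p0 => E; apply/eqP/malgP => x; rewrite mcoeff0.
  by apply: mcoeff_outdom; rewrite -[x \in _]/(x \in enum_fset _) E.
exists (sdeg s a); first by move=> b; rewrite mcoeff_neq0; apply: a_max.
by apply/layer_neq0P; exists a; rewrite ?mcoeff_neq0.
Qed.

Lemma sbound_sum (J : eqType) (r : seq J) (F : J -> Wq K) w :
  (forall i, i \in r -> sbound s w (F i)) -> sbound s w (\sum_(i <- r) F i).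
Proof. by move=> bF; apply: supp_in_sum => i ir _; apply: bF. Qed.
End Degree.

Section AdNilpotent.
Variables (K : fieldType) (c0 : [pchar K] =i pred0).
Local Notation W := (Wr c0).
Variables (P Q : W).
Hypothesis QP : Q * P = P * Q + 1.

Definition adP (G : W) : W := P * G - G * P.

Lemma adP_linear : linear adP.
Proof.
move=> c G H; rewrite /adP mulrDl mulrDr -scalerAl -scalerAr opprD addrACA.
by rewrite scalerBr.
Qed.
HB.instance Definition _ := GRing.isLinear.Build K W W *:%R adP adP_linear.

(** Over the centralizer of P, ad P acts as minus the derivative with respect to Q, because [P, Q] =
    -1. *)
Lemma adP_exp (f : W) n : adP f = 0 -> adP (f * Q ^+ n) = - (n%:R *: (f * Q ^+ n.-1)).
Proof.
move=> /eqP; rewrite subr_eq0 => /eqP fP.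
have NPQ : - P * Q = Q * - P + 1 by rewrite mulNr mulrN -[P * Q](addrK 1) -QP opprB addrC.
have := commutator1_exp n NPQ; rewrite mulNr mulrN => E.
rewrite /adP mulrA fP -!mulrA -mulrBr.
have -> : P * Q ^+ n - Q ^+ n * P = - (Q ^+ n.-1 *+ n).
  by rewrite -[P * _]opprK E opprD opprK addrAC subrr add0r.
by rewrite mulrN mulrnAr scaler_nat.
Qed.

Lemma iter_adP_exp n (f : W) : adP f = 0 -> iter n.+1 adP (f * Q ^+ n) = 0.
Proof.
elim: n f => [|n IH] f f0; first by rewrite /= mulr1.
rewrite iterSr adP_exp //= -scaleNr scalerAl; apply: IH.
by rewrite linearZ /= f0 scaler0.
Qed.

Lemma iter_adP0 n : iter n adP 0 = 0.
Proof. by elim: n => //= n ->; rewrite linear0. Qed.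

Lemma iter_adP_leq n m (G : W) : (n <= m)%N -> iter n adP G = 0 -> iter m adP G = 0.
Proof. by move=> /subnK <- G0; rewrite iterD G0 iter_adP0. Qed.

Lemma iter_adP_sum n (J : Type) (r : seq J) (F : J -> W) :
  (forall i, iter n adP (F i) = 0) -> iter n adP (\sum_(i <- r) F i) = 0.
Proof.
move=> F0; suff -> : iter n adP (\sum_(i <- r) F i) = \sum_(i <- r) iter n adP (F i).
  by rewrite big1.
by elim: n {F0} => //= n ->; rewrite linear_sum.
Qed.

(** Powers of Q are independent over the centralizer of P: applying ad P differentiates the relation
    and lowers its degree in Q. *)
Lemma adP_free n (f : nat -> W) : (forall j, adP (f j) = 0) ->
  \sum_(j < n) f j * Q ^+ j = 0 -> forall j, (j < n)%N -> f j = 0.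
Proof.
elim: n f => // n IH f f0 sum0.
have f1 j : (j < n)%N -> f j.+1 = 0.
  move=> lt_jn; have E : \sum_(i < n) (i.+1%:R *: f i.+1) * Q ^+ i = 0.
    have /(congr1 adP) := sum0; rewrite linear0 linear_sum big_ord_recl /=.
    rewrite adP_exp // mulr0n scale0r oppr0 add0r => E.
    apply/eqP; rewrite -oppr_eq0 -sumrN; apply/eqP; rewrite -[RHS]E.
    by apply: eq_bigr => i _; rewrite adP_exp // scalerAl.
  have g0 i : adP (i.+1%:R *: f i.+1) = 0 by rewrite linearZ /= f0 scaler0.
  have /eqP := IH (fun i => i.+1%:R *: f i.+1) g0 E j lt_jn.
  by rewrite scaler_eq0 natr_eq0_pchar0 //= => /eqP.
case=> [|j]; last exact: f1.
move=> _; move: sum0; rewrite big_ord_recl /= mulr1 big1 ?addr0 // => i _.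
by rewrite f1 ?mul0r.
Qed.

End AdNilpotent.

Section EigenExists.
Variables (K : closedFieldType) (c0 : [pchar K] =i pred0).
Local Notation W := (Wr c0).
Variables (s w u : rat) (P Q : W).
Hypotheses (s_gt : 0 < 1 + s) (w0 : 0 < w) (u0 : 0 < u).
Hypotheses (QP : Q * P = P * Q + 1) (bP : sbound s w P) (bQ : sbound s u Q).
Let p := layer s w P.
Hypothesis sp : (1 < size p)%N.

(** The leading degrees i w of the powers are distinct, since w > 0. *)
Lemma pow_free n (c : nat -> K) : \sum_(i < n) c i *: P ^+ i = 0 ->
  forall i, (i < n)%N -> c i = 0.
Proof.
have p0 : p != 0 by rewrite -size_poly_gt0 (ltn_trans _ sp).
elim: n => // n IH; rewrite big_ord_recr /= => E.
have cn : c n = 0.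
  move/(congr1 (layer s (n%:R * w))): (E); rewrite linear0 linearD /= layerZq.
  have [_ ->] := layer_exp s_gt n bP.
  rewrite (layer_low (u := (n%:R - 1) * w)) ?add0r; first last.
  - by rewrite mulrBl mul1r gtrBl.
  - apply: sbound_sum => i _; apply: supp_inZq.
    have [bE _] := layer_exp s_gt i bP; apply: sbound_weaken bE.
    by rewrite ler_pM2r // lerBrDr natr1 ler_nat.
  by move=> /eqP; rewrite scaler_eq0 expf_eq0 (negPf p0) andbF orbF => /eqP.
move=> i; rewrite ltnS leq_eqVlt => /orP[/eqP -> //|]; apply: IH.
by rewrite -[RHS]E cn scale0r addr0.
Qed.

(** Linear algebra gives a nonzero combination G of the P^i Q^j with zero coefficients at all
    relevant points of the ray through en(P). A leading layer commuting with p would have its end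
    point on that ray, by [size_pb0]. *)
Lemma noncommuting_exists : exists G d eta, [/\ iter d (adP P) G = 0,
  sbound s eta G & pb c0 w eta p (layer s eta G) != 0].
Proof.
have p0 : p != 0 by rewrite -size_poly_gt0 (ltn_trans _ sp).
set N := (size p).-1; have N0 : (0 < N)%N by rewrite /N; case: (size p) sp => [|[]].
have NR : 0 < N%:R :> rat by rewrite ltr0n.
(* Chosen so that a degree at most n (w + u) corresponds to a point of the ray of height at most n
   B. *)
pose B := Num.bound ((w + u) * N%:R / w).
have BP : (w + u) * N%:R < B%:R * w.
  rewrite -ltr_pdivrMr //; apply: le_lt_trans (archi_boundP _); rewrite ?ler_norm //.
  by rewrite divr_ge0 ?mulr_ge0 ?ler0n ?addr_ge0 ?ltW.
(* There are n^2 = n B + 2 n unknowns against J = n B + 1 conditions. *)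
set n := B.+2; set J := (n * B).+1.
pose T := ('I_n * 'I_n)%type.
pose E (ij : T) : W := P ^+ ij.1 * Q ^+ ij.2.
(* The point of height c on the ray through en(P) = (w - s N, N). *)
pose pt (c : nat) : rat * nat := (c%:R * (w / N%:R - s), c).
pose A : 'M[K]_(#|{: T}|, J) := \matrix_(k, c) (E (enum_val k))@_(pt c).
have [v v0 vA] : exists2 v : 'rV[K]_#|{: T}|, v != 0 & v *m A = 0.
  have /rowV0Pn[v v_in v0] : kermx A != 0.
    rewrite -mxrank_eq0 mxrank_ker subn_eq0 -ltnNge.
    apply: (leq_ltn_trans (rank_leq_col A)).
    by rewrite card_prod card_ord /J /n; nia.
  by exists v => //; apply/sub_kermxP.
pose V i j : K := v 0 (enum_rank ((inord i, inord j) : T)).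
pose G : W := \sum_(i < n) \sum_(j < n) V i j *: (P ^+ i * Q ^+ j).
have GE : G = \sum_k v 0 k *: E (enum_val k).
  rewrite (reindex_onto enum_rank enum_val) /=; last by move=> k _; rewrite enum_valK.
  rewrite /G pair_bigA /=; apply: eq_big => [ij|ij _]; first by rewrite enum_rankK eqxx.
  by rewrite enum_rankK /V !inord_val -surjective_pairing.
have Gpt c : (c < J)%N -> G@_(pt c) = 0.
  move=> lt_c; move/rowP/(_ (Ordinal lt_c)): vA; rewrite !mxE => vA.
  rewrite GE raddf_sum -[RHS]vA; apply: eq_bigr => k _ /=.
  by rewrite mcoeffZq mxE.
have G0 : G != 0.
  apply: contraNneq v0 => G0; apply/eqP/rowP => k; rewrite !mxE.
  have V0 i j : (i < n)%N -> (j < n)%N -> V i j = 0.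
    move=> lt_i lt_j; apply: (@pow_free n (V^~ j)) => //.
    apply: (@adP_free _ _ P Q QP n (fun j => \sum_(i < n) V i j *: P ^+ i)) => //.
      move=> j'; rewrite linear_sum big1 // => i' _; rewrite linearZ /= /adP.
      by rewrite -exprS -exprSr subrr scaler0.
    rewrite -[RHS]G0 /G exchange_big /=; apply: eq_bigr => j' _.
    by rewrite mulr_suml; apply: eq_bigr => i' _; rewrite scalerAl.
  have := V0 (enum_val k).1 (enum_val k).2 (ltn_ord _) (ltn_ord _).
  by rewrite /V !inord_val -surjective_pairing enum_valK.
have Gnil : iter n (adP P) G = 0.
  apply: iter_adP_sum => i; apply: iter_adP_sum => j; rewrite scalerAl.
  apply: (@iter_adP_leq _ _ _ j.+1); first exact: ltn_ord.
  apply: iter_adP_exp => //; rewrite linearZ /= /adP -exprS -exprSr subrr scaler0.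
  by [].
have Gbound : sbound s (n%:R * (w + u)) G.
  apply: sbound_sum => i _; apply: sbound_sum => j _; apply: supp_inZq.
  have [bi _] := layer_exp s_gt i bP; have [bj _] := layer_exp s_gt j bQ.
  apply: sbound_weaken (sboundMq s_gt bi bj).
  by rewrite mulrDr lerD // ler_pM2r // ler_nat ltnW.
have [eta bG lG] := sdeg_exists s G0.
exists G, n, eta; split=> //; apply/negP => /eqP pb0.
(* From eta N = w M the leading coefficient of the layer sits at [pt M]; the degree bound gives M <
   J, where that coefficient was made zero. *)
have := size_pb0 p0 lG pb0; set M := (size (layer s eta G)).-1; rewrite -/N => EM.
have etaE : eta = M%:R * w / N%:R by rewrite [M%:R * _]mulrC -EM mulfK // gt_eqF.
have ptM : pt M = (eta - s * M%:R, M) by rewrite /pt etaE; congr (_, _); ring.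
have eta_le : eta <= n%:R * (w + u).
  by rewrite leNgt; apply: contra lG => lt; rewrite (layer_low Gbound).
have lt_MJ : (M < J)%N.
  rewrite ltnS -(ler_nat rat) natrM -(ler_pM2r w0) [M%:R * w]mulrC -EM.
  apply: (@le_trans _ _ (n%:R * (w + u) * N%:R)); first by rewrite ler_pM2r.
  by rewrite -!mulrA ler_pM2l ?ltr0n // ltW.
have := Gpt M lt_MJ; rewrite ptM -coef_layer -lead_coefE => /eqP.
by rewrite lead_coef_eq0 (negPf lG).
Qed.

(** Minimality of the nilpotency order is replaced by induction: as long as [p, [p, h]] is nonzero,
    G may be exchanged for [P, G], whose layer is [p, h] and whose order is smaller. Order 0 would
    mean G = 0. *)
Lemma eigen_exists : exists g, pb c0 w (1 + s) p g = p.
Proof.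
have p0 : p != 0 by rewrite -size_poly_gt0 (ltn_trans _ sp).
have [G [d [eta [Gd bG pbG]]]] := noncommuting_exists.
elim: d G eta Gd bG pbG => [|d IH] G eta Gd bG pbG.
  move: pbG; rewrite -[G]/(iter 0 (adP P) G) Gd linear0 /pb deriv0 !mulr0 !scaler0.
  by rewrite subrr eqxx.
have E : layer s (w + eta - (1 + s)) (adP P G) = pb c0 w eta p (layer s eta G).
  by rewrite /adP -commWq (layer_comm c0 s_gt bP bG).
have [pb0|pb1] := eqVneq (pb c0 w (eta + w - (1 + s)) p (pb c0 w eta p (layer s eta G))) 0.
  exact: (pb_divide w0 s_gt p0 pbG pb0).
apply: (IH (adP P G) (w + eta - (1 + s))); first by rewrite -iterSr.
  by rewrite /adP -commWq; apply: sbound_comm.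
by rewrite E [w + eta]addrC.
Qed.

End EigenExists.

Section PolySupport.
Variables (K : fieldType) (c0 : [pchar K] =i pred0).
Implicit Types (f h p g : {poly K}) (S T R : nat -> Prop).

Definition psupp S f := forall i, f`_i != 0 -> S i.

Lemma psuppM S T R f h : psupp S f -> psupp T h ->
  (forall i j, S i -> T j -> R (i + j)%N) -> psupp R (f * h).
Proof.
move=> Sf Th STR n; rewrite coefM => nz.
have [i] : exists i : 'I_n.+1, f`_i * h`_(n - i) != 0.
  by apply/existsP; apply: contraNT nz => /existsPn H; rewrite big1 // => i _;
     apply/eqP; rewrite -[_ == _]negbK H.
rewrite mulf_eq0 negb_or => /andP[/Sf Si /Th Tj].
by have := STR _ _ Si Tj; rewrite subnKC // -ltnS.
Qed.

Lemma psupp_deriv S f : psupp S f -> psupp (fun i => S i.+1) f^`().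
Proof.
move=> Sf i; rewrite coef_deriv => nz; apply: Sf.
by apply: contraNneq nz => ->; rewrite mul0rn.
Qed.

Lemma psuppZ S (c : K) f : psupp S f -> psupp S (c *: f).
Proof. by move=> Sf i; rewrite coefZ mulf_eq0 negb_or => /andP[_ /Sf]. Qed.

Lemma psuppB S f h : psupp S f -> psupp S h -> psupp S (f - h).
Proof.
move=> Sf Sh i; rewrite coefB => nz; have [f0|/Sf//] := eqVneq f`_i 0.
by apply: Sh; apply: contraNneq nz => h0; rewrite f0 h0 subrr.
Qed.

Lemma psupp_pb w b S T R p g : psupp S p -> psupp T g ->
  (forall i j, S i -> T j -> (0 < i + j)%N -> R (i + j).-1) -> psupp R (pb c0 w b p g).
Proof.
move=> Sp Tg STR; apply: psuppB; apply: psuppZ.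
  apply: psuppM (psupp_deriv Sp) Tg _ => i j Si Tj.
  by have := STR _ _ Si Tj; apply.
apply: psuppM Sp (psupp_deriv Tg) _ => i j Si Tj.
by have := STR _ _ Si Tj; rewrite addnS; apply.
Qed.

Lemma pbDr w b p g h : pb c0 w b p (g + h) = pb c0 w b p g + pb c0 w b p h.
Proof.
rewrite /pb derivD !mulrDr !scalerDr opprD !addrA; congr (_ + _).
by rewrite addrAC.
Qed.

(* The bracket with [p] respects the grading of [K[z]] by the exponents of [x]
   modulo [1/l], so the component of [g] of the right class already works. *)
Lemma eigen_project (l : nat) s w p g : pb c0 w (1 + s) p g = p ->
  psupp (fun i => l%:R * (w - s * i%:R) \is a Num.int) p ->
  exists2 g', pb c0 w (1 + s) p g' = p &
    psupp (fun j => l%:R * (1 + s - s * j%:R) \is a Num.int) g'.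
Proof.
move=> pg Sp; pose S j := l%:R * (1 + s - s * j%:R) \is a Num.int.
pose C i := l%:R * (w - s * i%:R) \is a Num.int.
pose g1 := \poly_(j < size g) (if S j then g`_j else 0).
have g1E j : g1`_j = if S j then g`_j else 0.
  by rewrite coef_poly; case: ltnP => // /(nth_default 0) ->; case: ifP.
have S1 : psupp S g1 by move=> j; rewrite g1E; case: ifP => // _; rewrite eqxx.
exists g1 => //; pose g2 := g - g1.
have S2 : psupp (fun j => ~~ S j) g2.
  by move=> j; rewrite coefB g1E; case: ifP => //; rewrite subrr eqxx.
have CE i j : (0 < i + j)%N -> l%:R * (w - s * (i + j).-1%:R) =
    l%:R * (w - s * i%:R) + (l%:R * (1 + s - s * j%:R) - l%:R).
  by move=> ij; rewrite -subn1 natrB // natrD; ring.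
have P1 : psupp (fun i => C i) (pb c0 w (1 + s) p g1).
  apply: (psupp_pb Sp S1) => i j Ci Sj ij; rewrite /C CE //.
  by rewrite rpredD // rpredB // rpred_nat.
have P2 : psupp (fun i => ~~ C i) (pb c0 w (1 + s) p g2).
  apply: (psupp_pb Sp S2) => i j Ci Sj ij; rewrite /C CE //.
  apply: contra Sj => Cij; rewrite /S.
  rewrite -[X in X \is a _](subrK l%:R) rpredD ?rpred_nat //.
  by have := rpredB Cij Ci; rewrite addrAC subrr add0r.
have E : pb c0 w (1 + s) p g1 - p = - pb c0 w (1 + s) p g2.
  have := pbDr w (1 + s) p g1 g2; rewrite {1}/g2 [g1 + _]addrC subrK pg.
  by move: (pb _ _ _ _ g1) (pb _ _ _ _ g2) => x y ->; rewrite opprD addrA subrr sub0r.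
apply/eqP; rewrite -subr_eq0; apply/eqP/polyP => i; rewrite coef0.
apply/eqP/negP => /negP nz.
have Ci : C i by apply: (psuppB P1 Sp nz).
by have := nz; rewrite E coefN oppr_eq0 => /P2; rewrite Ci.
Qed.

End PolySupport.

Section Homogeneous.
Variables (K : fieldType).
Implicit Types (s b : rat) (g : {poly K}).

Definition homog s b g : Wq K :=
  \sum_(j < size g) << g`_j *g (b - s * (j : nat)%:R, j : nat) >>.

Lemma homog_supp s b g (S : rat * nat -> Prop) :
  (forall j : nat, g`_j != 0 -> S (b - s * j%:R, j)) -> supp_in S (homog s b g).
Proof. by move=> SG; apply: supp_in_sum => j _ _; apply: supp_inU; apply: SG. Qed.

Lemma mcoeff_homog s b g (j : nat) : (homog s b g)@_(b - s * j%:R, j) = g`_j.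
Proof.
rewrite raddf_sum /=; under eq_bigr do rewrite mcoeffU xpair_eqE.
have [lt_j|le_j] := ltnP j (size g); last first.
  rewrite nth_default // big1 // => i _.
  by rewrite [_ == j]ltn_eqF ?andbF // (leq_trans _ le_j).
rewrite (bigD1 (Ordinal lt_j)) //= !eqxx big1 ?addr0 // => i ne.
by rewrite [_ == j](negPf _) ?andbF //; apply: contra ne.
Qed.

Lemma sdeg_line s b j : sdeg s (b - s * j%:R, j) = b.
Proof. by rewrite /sdeg /= subrK. Qed.

Lemma homog_sbound s b g : sbound s b (homog s b g).
Proof. by apply: homog_supp => j _; rewrite sdeg_line. Qed.

Lemma layer_homog s b g : layer s b (homog s b g) = g.
Proof. by apply/polyP => j; rewrite coef_layer mcoeff_homog. Qed.
End Homogeneous.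

(** * The next edge *)

Section NextDirection.
Variables (K : fieldType) (c0 : [pchar K] =i pred0).
Local Notation W := (Wr c0).
Implicit Types (P Q : W) (A B x : rat * nat) (s t : rat).

(** The starting point of the edge of slope s, around which the Newton polygon turns towards its
    next edge. *)
Definition corner s P A := P@_A != 0 /\ forall x, P@_x != 0 ->
  sdeg s x <= sdeg s A /\ (sdeg s x = sdeg s A -> (A.2 <= x.2)%N).

(** The slopes at which a support point below A has the same degree as A. As the slope decreases
    from s, the largest of them is met first. *)
Definition slopes P A : seq rat :=
  [seq (x.1 - A.1) / (A.2%:R - x.2%:R) | x <- msupp P & (x.2 < A.2)%N].

Definition nonmono (f : {poly K}) := exists2 j, (j < (size f).-1)%N & f`_j != 0.

Lemma slopes_lt s P A t : corner s P A -> t \in slopes P A -> t < s.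
Proof.
move=> [_ cP] /mapP[x]; rewrite mem_filter => /andP[lt_x].
rewrite -mcoeff_neq0 => /cP [le_x eq_x] ->.
have d0 : 0 < A.2%:R - x.2%:R :> rat by rewrite subr_gt0 ltr_nat.
rewrite ltr_pdivrMr //; move: le_x; rewrite le_eqVlt => /orP[/eqP /eq_x|].
  by rewrite leqNgt lt_x.
rewrite /sdeg; lra.
Qed.

(** Points below A are controlled by their slopes. The others are controlled by the corner condition
    at s, since a smaller slope only lowers their degree relative to A. *)
Lemma edge_of_slope s s' P A : corner s P A -> s' < s ->
  (forall t, t \in slopes P A -> t <= s') ->
  sbound s' (sdeg s' A) P /\ size (layer s' (sdeg s' A) P) = A.2.+1.
Proof.
move=> [PA cP] lt_s le_s'.
have le_x x : P@_x != 0 ->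
    sdeg s' x <= sdeg s' A /\ (sdeg s' x = sdeg s' A -> (x.2 <= A.2)%N).
  move=> Px; have [lt_x|le_x] := ltnP x.2 A.2.
    have : (x.1 - A.1) / (A.2%:R - x.2%:R) <= s'.
      apply: le_s'; apply/mapP; exists x => //.
      by rewrite mem_filter lt_x -mcoeff_neq0.
    have d0 : 0 < A.2%:R - x.2%:R :> rat by rewrite subr_gt0 ltr_nat.
    rewrite ler_pdivrMr // /sdeg => H; split; last by rewrite ltnW.
    move: H; lra.
  have [le1 _] := cP x Px.
  have d0 : 0 <= x.2%:R - A.2%:R :> rat by rewrite subr_ge0 ler_nat.
  have H : 0 <= (s - s') * (x.2%:R - A.2%:R) by rewrite mulr_ge0 // subr_ge0 ltW.
  split; first by move: H le1; rewrite /sdeg; lra.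
  move=> E; rewrite leqNgt; apply/negP => lt_A.
  have d1 : 0 < x.2%:R - A.2%:R :> rat by rewrite subr_gt0 ltr_nat.
  have : 0 < (s - s') * (x.2%:R - A.2%:R) by rewrite mulr_gt0 // subr_gt0.
  by move: le1 E; rewrite /sdeg; lra.
split; first by move=> x /le_x[].
apply/eqP; rewrite eqn_leq; apply/andP; split.
  apply/leq_sizeP => j lt_j; rewrite coef_layer; apply/eqP/negP => /negP /le_x[_].
  by rewrite sdeg_line => /(_ erefl); rewrite leqNgt lt_j.
rewrite ltnNge; apply/negP => /leq_sizeP /(_ A.2 (leqnn _)).
rewrite coef_layer /sdeg addrK -surjective_pairing => /eqP.
by rewrite (negPf PA).
Qed.

Lemma nonmono_of_slope s' P A : s' \in slopes P A ->
  size (layer s' (sdeg s' A) P) = A.2.+1 -> nonmono (layer s' (sdeg s' A) P).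
Proof.
move=> /mapP[x]; rewrite mem_filter => /andP[lt_x].
rewrite -mcoeff_neq0 => Px s'E sz; exists x.2; rewrite ?sz //.
rewrite coef_layer; have -> : sdeg s' A - s' * x.2%:R = x.1.
  have d0 : A.2%:R - x.2%:R != 0 :> rat by rewrite gt_eqF // subr_gt0 ltr_nat.
  have : s' * (A.2%:R - x.2%:R) = x.1 - A.1 by rewrite s'E divfK.
  rewrite /sdeg; lra.
by rewrite -surjective_pairing.
Qed.

(** One slope is wanted for both elements, so the maximum is taken over the slopes of P and Q
    together; at this point only one of the layers is known not to be a monomial. *)
Lemma next_slope s P Q A B : 0 < 1 + s -> Q * P = P * Q + 1 ->
  corner s P A -> corner s Q B -> A.1 < A.2%:R -> B.1 < B.2%:R ->
  exists s', [/\ -1 < s', s' < s,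
    sbound s' (sdeg s' A) P /\ size (layer s' (sdeg s' A) P) = A.2.+1,
    sbound s' (sdeg s' B) Q /\ size (layer s' (sdeg s' B) Q) = B.2.+1 &
    nonmono (layer s' (sdeg s' A) P) \/ nonmono (layer s' (sdeg s' B) Q)].
Proof.
move=> s1 QP cP cQ A12 B12.
(* If no slope exceeds -1, the starting point is also maximal for the weight (1, -1). *)
have low R C : corner s R C -> all (fun t => t <= -1) (slopes R C) ->
    supp_in (fun x => wdeg (1, -1) x <= C.1 - C.2%:R) R.
  move=> [_ cR] /allP le_1 x Rx; rewrite /wdeg /=.
  have [lt_x|le_x] := ltnP x.2 C.2.
    have : (x.1 - C.1) / (C.2%:R - x.2%:R) <= -1.
      apply: le_1; apply/mapP; exists x => //.
      by rewrite mem_filter lt_x -mcoeff_neq0.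
    have d0 : 0 < C.2%:R - x.2%:R :> rat by rewrite subr_gt0 ltr_nat.
    by rewrite ler_pdivrMr //; lra.
  have [le1 _] := cR x Rx.
  have d0 : 0 <= x.2%:R - C.2%:R :> rat by rewrite subr_ge0 ler_nat.
  by have := mulr_ge0 (ltW s1) d0; move: le1; rewrite /sdeg; lra.
have [t0 t0_in t0_gt] : exists2 t, t \in slopes P A ++ slopes Q B & -1 < t.
  apply/hasP; rewrite has_cat; apply: contraT; rewrite negb_or -!all_predC.
  have nlt r : all (predC (fun t : rat => -1 < t)) r = all (fun t => t <= -1) r.
    by apply: eq_all => t /=; rewrite leNgt.
  rewrite !nlt => /andP[/(low _ _ cP) lP /(low _ _ cQ) lQ].
  have x0 : 0 <= (1 : rat, -1 : rat).1 + (1 : rat, -1 : rat).2 by [].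
  have l1 := wle_mul x0 lQ lP; have l2 := wle_mul x0 lP lQ.
  rewrite [A.1 - _ + _]addrC in l2; have := supp_inB l1 l2.
  rewrite QP [P * Q + 1]addrC addrK => /(_ (0, 0%N)) H.
  have : wdeg (1, -1) (0, 0%N) <= B.1 - B.2%:R + (A.1 - A.2%:R).
    by apply: H; rewrite mcoeffUU oner_eq0.
  by rewrite wdegX mulr0; lra.
have [|s' s'_in s'_max] := @seq_argmax _ id (slopes P A ++ slopes Q B).
  by case: (_ ++ _) t0_in.
have lt_s : s' < s.
  by move: s'_in; rewrite mem_cat => /orP[]; [apply: slopes_lt cP|apply: slopes_lt cQ].
have maxP t : t \in slopes P A -> t <= s' by move=> ?; apply: s'_max; rewrite mem_cat; apply/orP; left.
have maxQ t : t \in slopes Q B -> t <= s' by move=> ?; apply: s'_max; rewrite mem_cat; apply/orP; right.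
have eP := edge_of_slope cP lt_s maxP; have eQ := edge_of_slope cQ lt_s maxQ.
exists s'; split=> //; first exact: lt_le_trans t0_gt (s'_max _ t0_in).
move: s'_in; rewrite mem_cat => /orP[s'P|s'Q]; [left|right].
  by apply: nonmono_of_slope => //; case: eP.
by apply: nonmono_of_slope => //; case: eQ.
Qed.

End NextDirection.

(** * Stages: common directions of P and Q with proportional end points *)

Section Stages.
Variables (K : closedFieldType) (c0 : [pchar K] =i pred0) (m n : nat).
Hypotheses (m1 : (1 < m)%N) (n1 : (1 < n)%N) (mn : coprime m n).
Local Notation W := (Wr c0).
Implicit Types (P Q : W) (s w u : rat).

(** With N the degree of the layer, en(P) = (w - s N, N); [stage_en] says that v_(1,-1) is negative
    there, and [stage_wu] with [stage_size] say en(P) = (m/n) en(Q). Layers may be monomials, since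
    the auxiliary stage at slope 1 need not have an edge. *)
Record stage s P Q w u : Prop := Stage {
  stage_s : 0 < 1 + s;
  stage_QP : Q * P = P * Q + 1;
  stage_bP : sbound s w P;
  stage_bQ : sbound s u Q;
  stage_w : 0 < w;
  stage_u : 0 < u;
  stage_wu : n%:R * w = m%:R * u;
  stage_size : (n * (size (layer s w P)).-1 = m * (size (layer s u Q)).-1)%N;
  stage_en : w < (1 + s) * (size (layer s w P)).-1%:R }.

(** The commutator 1 has degree 0, which cannot exceed w + u - (1 + s). *)
Lemma commutator_bound s P Q w u : 0 < 1 + s -> Q * P = P * Q + 1 ->
  sbound s w P -> sbound s u Q -> 1 + s <= w + u.
Proof.
move=> s1 QP bP bQ; have := sbound_comm c0 s1 bQ bP; rewrite commWq.
rewrite QP [P * Q + 1]addrC addrK => /(_ (0, 0%N)); rewrite mcoeffUU oner_eq0.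
by move=> /(_ isT); rewrite sdegX; lra.
Qed.

Section Stage.
Variables (s w u : rat) (P Q : W).
Hypothesis st : stage s P Q w u.
Let p := layer s w P.
Let q := layer s u Q.

Let n0 : 0 < n%:R :> rat. Proof. by rewrite ltr0n ltnW. Qed.
Let m0 : 0 < m%:R :> rat. Proof. by rewrite ltr0n ltnW. Qed.

Lemma stage_size_p : (1 < size p)%N.
Proof.
case: st => s1 _ _ _ w0 _ _ _ en; rewrite ltnNge; apply/negP => le1.
have E : (size p).-1 = 0%N by lia.
by move: en; rewrite -/p E mulr0n mulr0 => /(lt_trans w0); rewrite ltxx.
Qed.

Lemma stage_size_q : (1 < size q)%N.
Proof. by have := stage_size st; have := stage_size_p; rewrite -/p -/q; nia. Qed.

Lemma stage_p0 : p != 0.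
Proof. by rewrite -size_poly_gt0 (ltn_trans _ stage_size_p). Qed.

Lemma stage_q0 : q != 0.
Proof. by rewrite -size_poly_gt0 (ltn_trans _ stage_size_q). Qed.

Lemma stage_sum : 1 + s <= w + u.
Proof. by case: st => s1 QP bP bQ *; apply: commutator_bound QP bP bQ. Qed.

Lemma stage_pb : pb c0 w u p q = (if w + u == 1 + s then -1 else 0).
Proof.
case: st => s1 QP bP bQ *.
have -> : pb c0 w u p q = layer s (w + u - (1 + s)) (commW P Q).
  by rewrite (layer_comm c0 s1 bP bQ).
rewrite commWq -[P * Q - _]opprB QP [P * Q + 1]addrC addrK linearN /=.
rewrite -[X in layer _ _ X]/(oneW K) layerU sdegX scale1r eq_sym subr_eq0.
by case: eqP; rewrite ?oppr0.
Qed.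

Lemma stage_pb0 : 1 + s < w + u -> pb c0 w u p q = 0.
Proof. by move=> lt; rewrite stage_pb gt_eqF. Qed.

Lemma stage_cross (a b : nat) : (n * a = m * b)%N -> u * a%:R = w * b%:R.
Proof.
move=> ab; have n0' : n%:R != 0 :> rat by rewrite gt_eqF.
apply: (mulfI n0'); rewrite [RHS]mulrA (stage_wu st) mulrCA -natrM ab natrM; ring.
Qed.

Lemma stage_en_q : u < (1 + s) * (size q).-1%:R.
Proof.
have [_ _ _ _ w0 u0 wu sz en] := st; have E := stage_cross sz.
rewrite -(ltr_pM2l w0); have -> : w * ((1 + s) * (size q).-1%:R) =
  u * ((1 + s) * (size p).-1%:R) by rewrite mulrCA -E mulrCA.
by rewrite [w * u]mulrC ltr_pM2l.
Qed.

End Stage.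

Lemma nonmono_dec (f : {poly K}) :
  nonmono f \/ f = lead_coef f *: 'X^((size f).-1).
Proof.
have [/existsP[j nz]|/existsPn none] :=
    boolP [exists j : 'I_(size f).-1, f`_j != 0].
  by left; exists j.
right; apply/polyP => j; rewrite coefZ coefXn.
have [lt_j|lt_j|->] := ltngtP j (size f).-1.
- by rewrite mulr0; apply/eqP; have := none (Ordinal lt_j); rewrite negbK.
- by rewrite mulr0 nth_default //; case: (size f) lt_j.
- by rewrite mulr1 lead_coefE.
Qed.

Lemma Xpb_coef w u (f g : {poly K}) i : ('X * pb c0 w u f g)`_i =
  qK c0 u * (('X * f^`()) * g)`_i - qK c0 w * (f * ('X * g^`()))`_i.
Proof.
rewrite /pb mulrBr -!scalerAr ['X * (_ * g)]mulrA ['X * (f * _)]mulrCA.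
by rewrite coefB !coefZ.
Qed.

Lemma theta_monomial (c : K) k : 'X * (c *: 'X^k)^`() = k%:R *: (c *: 'X^k).
Proof.
rewrite derivZ derivXn -scalerAr; case: k => [|k]; first by rewrite !mulr0n mulr0 scaler0 scale0r.
by rewrite /= mulrnAr -exprS scaler_nat scalerMnr.
Qed.

Lemma theta_coef (f : {poly K}) i : ('X * f^`())`_i = f`_i *+ i.
Proof. by rewrite coefXM coef_deriv; case: i. Qed.

Lemma Xpb_monor w u (f : {poly K}) (c : K) k i :
  ('X * pb c0 w u f (c *: 'X^k))`_(i + k) =
  (qK c0 u * i%:R - qK c0 w * k%:R) * (c * f`_i).
Proof.
rewrite Xpb_coef theta_monomial scalerA -2!scalerAr 2!coefZ 2!coefMXn.
rewrite ltnNge leq_addl /= addnK theta_coef; ring.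
Qed.

Lemma Xpb_monol w u (f : {poly K}) (c : K) k i :
  ('X * pb c0 w u (c *: 'X^k) f)`_(k + i) =
  (qK c0 u * k%:R - qK c0 w * i%:R) * (c * f`_i).
Proof.
rewrite Xpb_coef theta_monomial scalerA -2!scalerAl 2!coefZ 2!coefXnM.
rewrite ltnNge leq_addr /= addKn theta_coef; ring.
Qed.

(** If q is a monomial of degree M and p has a term of degree j < N, that term contributes the
    factor u j - w M = u (j - N), which is nonzero. Since the bracket is constant, j + M = 1, hence
    M = 1 and n N = m, against coprimality. The other case is symmetric. *)
Lemma stage_nonmono s P Q w u : stage s P Q w u ->
  nonmono (layer s w P) \/ nonmono (layer s u Q) ->
  nonmono (layer s w P) /\ nonmono (layer s u Q).
Proof.
move=> st; have p0 := stage_p0 st; have q0 := stage_q0 st.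
have sp := stage_size_p st; have sq := stage_size_q st.
have pbE := stage_pb st; have sz := stage_size st.
have w0 := stage_w st; have u0 := stage_u st.
set p := layer s w P in p0 sp pbE sz *; set q := layer s u Q in q0 sq pbE sz *.
have const i : ('X * pb c0 w u p q)`_i != 0 -> i = 1%N.
  rewrite pbE coefXM; case: i => [|[|i]] //=; first by rewrite eqxx.
  by case: ifP => _; rewrite ?coefN ?coef1 ?coef0 ?oppr0 eqxx.
have m1n : ~~ (m %| n)%N.
  apply/negP => /gcdn_idPl E; move: mn; rewrite /coprime E => /eqP.
  by move=> mE; move: m1; rewrite mE.
have n1m : ~~ (n %| m)%N.
  apply/negP => /gcdn_idPr E; move: mn; rewrite /coprime E => /eqP.
  by move=> nE; move: n1; rewrite nE.
case=> [mono|mono]; split=> //.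
  have [//|qE] := nonmono_dec q; case: mono => j lt_j pj; case/negP: n1m.
  set N' := (size q).-1 in qE sz.
  have : ('X * pb c0 w u p q)`_(j + N') != 0.
    rewrite qE Xpb_monor; move: (lead_coef q) (lead_coef_eq0 q) => c cE.
    rewrite mulf_neq0 ?mulf_neq0 ?cE //.
    rewrite -!(qK_nat c0) -!rmorphM -rmorphB qK_eq0 -(stage_cross st sz) -mulrBr.
    by rewrite mulf_eq0 negb_or (gt_eqF u0) /= lt_eqF // subr_lt0 ltr_nat.
  move/const => jN'; have N'1 : N' = 1%N by rewrite /N'; lia.
  by rewrite -[m]muln1 -N'1 -sz dvdn_mulr.
have [//|pE] := nonmono_dec p; case: mono => j lt_j qj; case/negP: m1n.
set N := (size p).-1 in pE sz.
have : ('X * pb c0 w u p q)`_(N + j) != 0.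
  rewrite pE Xpb_monol; move: (lead_coef p) (lead_coef_eq0 p) => c cE.
  rewrite mulf_neq0 ?mulf_neq0 ?cE //.
  rewrite -!(qK_nat c0) -!rmorphM -rmorphB qK_eq0 (stage_cross st sz) -mulrBr.
  by rewrite mulf_eq0 negb_or (gt_eqF w0) /= gt_eqF // subr_gt0 ltr_nat.
move/const => jN; have N1 : N = 1%N by rewrite /N; lia.
by rewrite -[n]muln1 -N1 sz dvdn_mulr.
Qed.

Lemma comp_shift_coef (f : {poly K}) lam : f != 0 ->
  (f \Po ('X + lam%:P))`_(mup lam f) != 0 /\
  forall i, (f \Po ('X + lam%:P))`_i != 0 -> (mup lam f <= i)%N.
Proof.
move=> f0; have [f1 rf1 fE] := mup_decomp lam f0.
have E : f \Po ('X + lam%:P) = 'X^(mup lam f) * (f1 \Po ('X + lam%:P)).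
  rewrite {1}fE comp_polyM rmorphXn /=; congr (_ ^+ _ * _).
  by rewrite comp_polyB comp_polyX comp_polyC addrK.
rewrite E; split.
  rewrite coefXnM ltnn subnn -horner_coef0 horner_comp.
  by rewrite hornerD hornerX hornerC add0r -rootE.
by move=> i; rewrite coefXnM; case: ltnP => //; rewrite eqxx.
Qed.

(** After the translation the multiplicity of lam is the order at 0, that is, the height of the
    starting point. *)
Lemma corner_shift s w P lam : 0 < 1 + s -> sbound s w P -> layer s w P != 0 ->
  let t := mup lam (layer s w P) in corner s (shift lam s P) (w - s * t%:R, t).
Proof.
move=> s1 bP p0 t; have [bP' lP'] := layer_shift s1 lam bP.
have [c1 c2] := comp_shift_coef lam p0; rewrite -lP' in c1 c2.
split; first by rewrite -coef_layer.
move=> x Px; rewrite sdeg_line; split; first exact: bP'.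
move=> dx; apply: c2; rewrite coef_layer -dx /sdeg addrK.
by rewrite -surjective_pairing.
Qed.

Lemma stage_next s P Q w u (l : nat) : stage s P Q w u -> 1 + s < w + u -> inWl l P ->
  exists g lam s', let t := mup lam (layer s w P) in let e := mup lam (layer s u Q) in
    let A := (w - s * t%:R, t) in let B := (u - s * e%:R, e) in
    let P' := shift lam s P in let Q' := shift lam s Q in
    [/\ pb c0 w (1 + s) (layer s w P) g = layer s w P /\
        psupp (fun j => l%:R * (1 + s - s * j%:R) \is a Num.int) g,
        s' < s /\ corner s P' A,
        (size g = 2%N -> t = (size (layer s w P)).-1) /\ (0 < t)%N,
        stage s' P' Q' (sdeg s' A) (sdeg s' B) /\
        nonmono (layer s' (sdeg s' A) P') /\ nonmono (layer s' (sdeg s' B) Q') &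
        size (layer s' (sdeg s' A) P') = t.+1 /\
        size (layer s' (sdeg s' B) Q') = e.+1].
Proof.
move=> st lt_sum WP; have p0 := stage_p0 st; have q0 := stage_q0 st.
have [s1 QP bP bQ w0 u0 wu sz en] := st.
have [g0 pg0] := eigen_exists s1 w0 u0 QP bP bQ (stage_size_p st).
have [|g pg Sg] := @eigen_project _ _ l s w (layer s w P) g0 pg0.
  by move=> i; rewrite coef_layer; move/inWlP: WP => WP /WP.
have [lam lamP] := eigen_root w0 s1 p0 pg en.
have pbpq := stage_pb0 st lt_sum.
set t := mup lam (layer s w P) in lamP; pose e := mup lam (layer s u Q).
(* The layers commute, so the root chosen for p is equally good for q and the starting points stay
   in ratio m/n. *)
have te : u * t%:R = w * e%:R by apply: mup_pb0 pbpq.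
have nt : (n * t = m * e)%N.
  apply/eqP; rewrite -(eqr_nat rat) !natrM; apply/eqP.
  have u0' : u != 0 by rewrite gt_eqF.
  by apply: (mulfI u0'); rewrite mulrCA te mulrA wu; ring.
have t0 : (0 < t)%N.
  by rewrite lt0n; apply: contraTneq lamP => ->; rewrite mulr0n mulr0 -leNgt ltW.
have lamQ : u < (1 + s) * e%:R.
  rewrite -(ltr_pM2l w0).
  have -> : w * ((1 + s) * e%:R) = u * ((1 + s) * t%:R) by rewrite mulrCA -te mulrCA.
  by rewrite [w * u]mulrC ltr_pM2l.
have QP' : shift lam s Q * shift lam s P = shift lam s P * shift lam s Q + 1.
  by rewrite -!shiftM QP linearD /= shift1.
have cP := corner_shift lam s1 bP p0; have cQ := corner_shift lam s1 bQ q0.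
rewrite /= -/t in cP; rewrite /= -/e in cQ.
have [||s' [s'1 lt_s [bP' sP'] [bQ' sQ'] mono]] := next_slope s1 QP' cP cQ.
- by rewrite /=; lra.
- by rewrite /=; lra.
have s'1' : 0 < 1 + s' by lra.
set A := (_, t) in cP bP' sP' mono; set B := (_, e) in cQ bQ' sQ' mono.
have wu' : n%:R * sdeg s' A = m%:R * sdeg s' B.
  have ntR : n%:R * t%:R = m%:R * e%:R :> rat by rewrite -!natrM nt.
  rewrite /sdeg /=; transitivity (n%:R * w + (s' - s) * (n%:R * t%:R)); first ring.
  rewrite wu ntR; ring.
have sum' := commutator_bound s'1' QP' bP' bQ'.
have n0 : 0 < n%:R :> rat by rewrite ltr0n ltnW.
have m0 : 0 < m%:R :> rat by rewrite ltr0n ltnW.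
(* The two new degrees are in ratio m/n and their sum is at least 1 + s' > 0, so both are
   positive. *)
have w'0 : 0 < sdeg s' A.
  rewrite -(pmulr_rgt0 _ (addr_gt0 m0 n0)) mulrDl wu' -mulrDr.
  by rewrite mulr_gt0 //; lra.
have u'0 : 0 < sdeg s' B by rewrite -(pmulr_rgt0 _ m0) -wu' mulr_gt0.
have st' : stage s' (shift lam s P) (shift lam s Q) (sdeg s' A) (sdeg s' B).
  split=> //; first by rewrite sP' sQ'.
  by rewrite sP' /sdeg /=; lra.
exists g, lam, s'; split=> //.
- split=> // sg; have rlam : root (layer s w P) lam by rewrite root_mup.
  by rewrite /t (eigen_linear s1 p0 pg sg rlam).
- by split=> //; apply: stage_nonmono.
Qed.

End Stages.

(** * Leading forms and end points *)

Lemma size_gt1 (T : eqType) (r : seq T) x y :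
  x \in r -> y \in r -> x != y -> (1 < size r)%N.
Proof. by case: r => [|a [|b r]] //; rewrite !inE => /eqP -> /eqP ->; rewrite eqxx. Qed.

(** [better] need not be an order: x replaces whatever the fold holds when x is met, and nothing
    replaces x afterwards. *)
Lemma pick_best_eq (better : rat * rat -> rat * rat -> bool) r x : x \in r ->
  (forall y, y \in r -> ~~ better y x) ->
  (forall y, y \in r -> y != x -> better x y) -> pick_best better r = x.
Proof.
move=> x_in worse best; rewrite /pick_best.
have : head (0, 0) r \in r by case: (r) x_in => // y r' _; apply: mem_head.
move: (head (0, 0) r) => b b_in.
suff fold_x r' : {subset r' <= r} -> x \in r' ->
    foldr (fun x b => if better x b then x else b) b r' = x by apply: fold_x.
elim: r' => // y r' IH sub; rewrite inE /=.
have sub' : {subset r' <= r} by move=> z z_in; apply: sub; rewrite inE z_in orbT.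
have [x_in' _|x_out] := boolP (x \in r').
  by rewrite IH // ifN // worse // sub // mem_head.
rewrite orbF => /eqP <-.
have : foldr (fun x b => if better x b then x else b) b r' \in b :: r'.
  elim: (r') => [|z r'' IH']; first exact: mem_head.
  rewrite /=; case: ifP => _; first by rewrite !inE eqxx orbT.
  by move: IH'; rewrite !inE => /orP[->|->] //; rewrite !orbT.
move: (foldr _ _ _) => z; rewrite inE => z_in.
have z_r : z \in r by case/orP: z_in => [/eqP -> //|/sub'].
by have [->|ne] := eqVneq z x; [case: ifP | rewrite best].
Qed.

Section LeadTheory.
Variable (K : fieldType).
Implicit Types (P F : Wq K) (rs : int * int).

Lemma bigmax_seq_le (T : eqType) (r : seq T) (f : T -> rat) x0 d : x0 <= d ->
  (forall a, a \in r -> f a <= d) -> \big[Num.max/x0]_(a <- r) f a <= d.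
Proof.
move=> x0d fd; rewrite big_seq; elim/big_rec: _ => // a x a_in xd.
by rewrite ge_max fd.
Qed.

Lemma seq_le_bigmax (T : eqType) (r : seq T) (f : T -> rat) x0 a :
  a \in r -> f a <= \big[Num.max/x0]_(b <- r) f b.
Proof.
elim: r => // b r IH; rewrite inE big_cons le_max => /orP[/eqP -> |/IH ->].
  by rewrite lexx.
by rewrite orbT.
Qed.

Lemma vW_eq rs P a : P@_a != 0 ->
  (forall b, P@_b != 0 -> vpt rs (ptW b) <= vpt rs (ptW a)) ->
  vW rs P = vpt rs (ptW a).
Proof.
move=> Pa le_a; apply: le_anti; apply/andP; split; last first.
  by apply: (@seq_le_bigmax _ _ (fun b => vpt rs (ptW b))); rewrite -mcoeff_neq0.
apply: (@bigmax_seq_le _ _ (fun b => vpt rs (ptW b))) => [|b]; last first.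
  by rewrite -mcoeff_neq0; apply: le_a.
have : a \in (msupp P : seq _) by rewrite -mcoeff_neq0.
case E : (msupp P : seq _) => [//|c r] _ /=; apply: le_a.
by rewrite mcoeff_neq0 -[_ \in _]/(_ \in enum_fset _) E mem_head.
Qed.

Lemma vW_attained rs P : P != 0 -> exists2 a, P@_a != 0 &
  vW rs P = vpt rs (ptW a) /\
  (forall b, P@_b != 0 -> vpt rs (ptW b) <= vpt rs (ptW a)).
Proof.
move=> P0; have [|a a_in a_max] := @seq_argmax _ (fun b => vpt rs (ptW b)) (msupp P).
  apply: contraNneq P0 => E; apply/eqP/malgP => x; rewrite mcoeff0.
  by apply: mcoeff_outdom; rewrite -[x \in _]/(x \in enum_fset _) E.
have Pa : P@_a != 0 by rewrite mcoeff_neq0.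
have le_a b : P@_b != 0 -> vpt rs (ptW b) <= vpt rs (ptW a).
  by rewrite mcoeff_neq0; apply: a_max.
by exists a => //; split=> //; apply: vW_eq.
Qed.

Lemma vW_ge rs P a : P@_a != 0 -> vpt rs (ptW a) <= vW rs P.
Proof.
by move=> Pa; apply: (@seq_le_bigmax _ _ (fun b => vpt rs (ptW b))); rewrite -mcoeff_neq0.
Qed.

Lemma mem_lsupp rs P a :
  (a \in lsupp rs P) = (P@_a != 0) && (vpt rs (ptW a) == vW rs P).
Proof. by rewrite mem_filter andbC mcoeff_neq0. Qed.

Lemma lsupp_uniq rs P : uniq (lsupp rs P).
Proof. by rewrite filter_uniq // fset_uniq. Qed.

Lemma mcoeff_lead rs P a :
  (leadW rs P)@_a = if vpt rs (ptW a) == vW rs P then P@_a else 0.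
Proof.
rewrite /leadW raddf_sum /=; under eq_bigr do rewrite mcoeffU.
have [a_in|a_out] := boolP (a \in lsupp rs P).
  rewrite (bigD1_seq a) ?lsupp_uniq //= eqxx big1 ?addr0.
    by move: a_in; rewrite mem_lsupp => /andP[_ ->].
  by move=> b /negPf ->.
rewrite big1_seq => [|b /= b_in].
  move: a_out; rewrite mem_lsupp; case: (_ == vW rs P) => //.
  by rewrite andbT negbK => /eqP.
by case: eqP b_in => // ->; rewrite (negPf a_out).
Qed.

Lemma lead_eq rs P F : vW rs P = vW rs F ->
  (forall a, vpt rs (ptW a) = vW rs P -> P@_a = F@_a) -> leadW rs P = leadW rs F.
Proof.
move=> vE PF; apply/malgP => a; rewrite !mcoeff_lead -vE; case: eqP => // /PF.
by [].
Qed.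

End LeadTheory.

(* The direction of slope [s = sigma / rho], with [rho > 0]. *)
Definition dir (s : rat) : int * int := (denq s, numq s).

Section Directions.
Implicit Types s : rat.

Lemma dirE s a : vpt (dir s) (ptW a) = (denq s)%:~R * sdeg s a.
Proof. by rewrite /vpt /sdeg /= numqE; ring. Qed.

Lemma den_gt0 s : 0 < (denq s)%:~R :> rat.
Proof. by rewrite ltr0z denq_gt0. Qed.

Lemma dir_sum s : ((dir s).1 + (dir s).2)%:~R = (denq s)%:~R * (1 + s) :> rat.
Proof. by rewrite intrD /= numqE; ring. Qed.

Lemma dir_inV s : 0 < 1 + s -> inV (dir s).
Proof.
move=> s1; rewrite /inV -(ltr0z rat) dir_sum mulr_gt0 ?den_gt0 // andbT.
rewrite /gcdz /= -[_ == _]/(coprime `|denq s| `|numq s|) coprime_sym.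
exact: coprime_num_den.
Qed.

(** The second direction is arbitrary, including those with rho <= 0. *)
Lemma ltV_dir s (x : int * int) :
  ltV (dir s) x = (x.1%:~R * s < x.2%:~R :> rat).
Proof.
rewrite /ltV /= -(ltr0z rat) intrB !intrM numqE.
have -> : (denq s)%:~R * x.2%:~R - s * (denq s)%:~R * x.1%:~R =
  (denq s)%:~R * (x.2%:~R - x.1%:~R * s) :> rat by ring.
by rewrite pmulr_rgt0 ?den_gt0 // subr_gt0.
Qed.

Lemma ltV_dir2 s s' : ltV (dir s') (dir s) = (s' < s).
Proof. by rewrite ltV_dir /= numqE mulrC ltr_pM2r ?den_gt0. Qed.
End Directions.

Section LayerGlue.
Variables (K : fieldType).
Implicit Types (P F : Wq K) (s w : rat) (A : rat * nat).

Definition ptA A : rat * rat := (A.1, A.2%:R).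

Lemma vW_layer s w P : sbound s w P -> layer s w P != 0 ->
  vW (dir s) P = (denq s)%:~R * w.
Proof.
move=> bP /layer_neq0P[a Pa da]; rewrite (@vW_eq _ _ _ a) //.
  by rewrite dirE da.
by move=> b /bP; rewrite !dirE da ler_pM2l ?den_gt0.
Qed.

Lemma lsupp_layer s w P a : sbound s w P -> layer s w P != 0 ->
  (a \in lsupp (dir s) P) = (P@_a != 0) && (sdeg s a == w).
Proof.
move=> bP p0; rewrite mem_lsupp dirE (vW_layer bP p0).
by rewrite (inj_eq (mulfI _)) // gt_eqF // den_gt0.
Qed.

Lemma layer_coef_deg s w P a : sdeg s a = w -> P@_a = (layer s w P)`_a.2.
Proof. by move=> <-; rewrite coef_layer /sdeg addrK -surjective_pairing. Qed.

Lemma layer_lead s w P F : sbound s w P -> sbound s w F -> layer s w P != 0 ->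
  layer s w P = layer s w F -> leadW (dir s) P = leadW (dir s) F.
Proof.
move=> bP bF p0 PF; have f0 : layer s w F != 0 by rewrite -PF.
apply: lead_eq => [|a]; first by rewrite (vW_layer bP p0) (vW_layer bF f0).
rewrite dirE (vW_layer bP p0) => /(mulfI _) E.
have da : sdeg s a = w by apply: E; rewrite gt_eqF // den_gt0.
by rewrite !(layer_coef_deg _ da) PF.
Qed.

Lemma inVal_layer s w P : 0 < 1 + s -> sbound s w P -> nonmono (layer s w P) ->
  inVal (dir s) P.
Proof.
move=> s1 bP [j lt_j pj]; rewrite /inVal dir_inV //=.
set N := (size (layer s w P)).-1 in lt_j.
have p0 : layer s w P != 0 by apply: contraNneq pj => ->; rewrite coef0.
have mem i : (layer s w P)`_i != 0 -> (w - s * i%:R, i) \in lsupp (dir s) P.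
  by rewrite coef_layer (lsupp_layer _ bP p0) sdeg_line eqxx andbT.
apply: (size_gt1 (mem j pj) (mem N _)); first by rewrite -lead_coefE lead_coef_eq0.
by rewrite xpair_eqE negb_and [j == N]ltn_eqF ?orbT.
Qed.

(** At fixed degree w the difference b - a equals (1 + s) b - w, so it grows with the height b and
    no tie can occur. *)
Lemma enW_edge s P A : 0 < 1 + s -> sbound s (sdeg s A) P ->
  size (layer s (sdeg s A) P) = A.2.+1 -> enW (dir s) P = ptA A.
Proof.
move=> s1 bP sz; have p0 : layer s (sdeg s A) P != 0 by rewrite -size_poly_gt0 sz.
have PA : P@_A != 0.
  by rewrite (layer_coef_deg _ (erefl (sdeg s A))) -[A.2]/(A.2.+1.-1) -sz -lead_coefE lead_coef_eq0.
have leA a : a \in lsupp (dir s) P -> sdeg s a = sdeg s A /\ (a.2 <= A.2)%N.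
  rewrite (lsupp_layer _ bP p0) => /andP[Pa /eqP da]; split=> //.
  rewrite leqNgt; apply: contraNN Pa => lt_A.
  by rewrite (layer_coef_deg _ da) nth_default // sz.
have d2 a : sdeg s a = sdeg s A -> (a.2 <= A.2)%N ->
    a.2%:R - a.1 <= A.2%:R - A.1 /\ (a.2%:R - a.1 = A.2%:R - A.1 -> a = A).
  move=> da le_a.
  have le_aR : 0 <= A.2%:R - a.2%:R :> rat by rewrite subr_ge0 ler_nat.
  have := mulr_ge0 (ltW s1) le_aR; move: da; rewrite /sdeg => da H.
  split; first by move: H da; lra.
  move=> E; have : (1 + s) * (A.2%:R - a.2%:R) = 0 by move: E da; lra.
  move=> /eqP; rewrite mulf_eq0 (gt_eqF s1) /= subr_eq0 eqr_nat => /eqP e2.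
  rewrite [a]surjective_pairing [A]surjective_pairing e2; congr (_, _).
  by move: E; rewrite e2; lra.
apply: pick_best_eq.
- by apply/mapP; exists A => //; rewrite (lsupp_layer _ bP p0) PA eqxx.
- move=> _ /mapP[a /leA[da le_a] ->]; have [le1 _] := d2 a da le_a.
  by rewrite /en_better /= negb_or negb_and -leNgt le1 /= -leNgt ler_nat le_a orbT.
- move=> _ /mapP[a /leA[da le_a] ->] ne; have [le1 eq1] := d2 a da le_a.
  rewrite /en_better /= lt_neqAle le1 andbT; apply/orP; left.
  by apply: contraNneq ne => /eq1 ->.
Qed.

Lemma stW_corner c0 s (P : @Wr K c0) A : 0 < 1 + s -> corner s P A ->
  stW (dir s) P = ptA A.
Proof.
move=> s1 [PA cP]; have bP : sbound s (sdeg s A) P by move=> x /cP[].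
have p0 : layer s (sdeg s A) P != 0 by apply/layer_neq0P; exists A.
have geA a : a \in lsupp (dir s) P -> sdeg s a = sdeg s A /\ (A.2 <= a.2)%N.
  rewrite (lsupp_layer _ bP p0) => /andP[Pa /eqP da]; split=> //.
  by have [_] := cP a Pa; apply.
have d2 a : sdeg s a = sdeg s A -> (A.2 <= a.2)%N ->
    a.1 - a.2%:R <= A.1 - A.2%:R /\ (a.1 - a.2%:R = A.1 - A.2%:R -> a = A) /\ 
    (a.1 - a.2%:R = A.1 - A.2%:R -> a.1 <= A.1).
  move=> da le_a.
  have le_aR : 0 <= a.2%:R - A.2%:R :> rat by rewrite subr_ge0 ler_nat.
  have := mulr_ge0 (ltW s1) le_aR; move: da; rewrite /sdeg => da H.
  split; first by move: H da; lra.
  suff E0 : a.1 - a.2%:R = A.1 - A.2%:R -> a = A by split=> // /E0 ->.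
  move=> E; have : (1 + s) * (A.2%:R - a.2%:R) = 0 by move: E da; lra.
  move=> /eqP; rewrite mulf_eq0 (gt_eqF s1) /= subr_eq0 eqr_nat => /eqP e2.
  rewrite [a]surjective_pairing [A]surjective_pairing e2; congr (_, _).
  by move: E; rewrite e2; lra.
apply: pick_best_eq.
- by apply/mapP; exists A => //; rewrite (lsupp_layer _ bP p0) PA eqxx.
- move=> _ /mapP[a /geA[da le_a] ->]; have [le1 [eq1 le2]] := d2 a da le_a.
  rewrite /st_better /= negb_or -leNgt le1 /=; apply/negP => /andP[/eqP E].
  by rewrite ltNge le2.
- move=> _ /mapP[a /geA[da le_a] ->] ne; have [le1 [eq1 _]] := d2 a da le_a.
  rewrite /st_better /= lt_neqAle le1 andbT; apply/orP; left.
  by apply: contraNneq ne => /eq1 ->.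
Qed.

Lemma homogW_homog s b (g : {poly K}) : g != 0 -> homogW (dir s) (homog s b g).
Proof.
move=> g0; apply/malgP => a; rewrite mcoeff_lead; case: eqP => // ne.
apply/esym/eqP/negP => /negP nz; apply: ne.
have bF : sbound s b (homog s b g) by exact: homog_sbound.
have lF : layer s b (homog s b g) != 0 by rewrite layer_homog.
rewrite dirE (vW_layer bF lF); congr (_ * _).
suff H : supp_in (fun a => sdeg s a = b) (homog s b g) by apply: H.
by apply: homog_supp => j _; rewrite sdeg_line.
Qed.

End LayerGlue.

(** * Roots of layers that are not monomials *)

Section NonzeroRoots.
Variables (K : closedFieldType) (c0 : [pchar K] =i pred0).
Implicit Types (f p g : {poly K}).

Lemma size_mup_decomp p p1 z k : p != 0 -> p = ('X - z%:P) ^+ k * p1 ->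
  (size p).-1 = (k + (size p1).-1)%N.
Proof.
move=> p0 pE; have p10 : p1 != 0 by apply: contraNneq p0; rewrite pE => ->; rewrite mulr0.
rewrite pE mulrC size_Mmonic ?monic_exp ?monicXsubC // size_exp_XsubC.
by move: p10; rewrite -size_poly_gt0; case: (size p1) => // k' _; lia.
Qed.

Lemma mup_le_size p z : p != 0 -> (mup z p <= (size p).-1)%N.
Proof.
move=> p0; have [p1 _ pE] := mup_decomp z p0.
by rewrite (size_mup_decomp p0 pE) leq_addr.
Qed.

Lemma nonmono_neq0 f : nonmono f -> f != 0.
Proof. by case=> j _; apply: contraNneq => ->; rewrite coef0. Qed.

Lemma nonmonoXn (c : K) k : ~ nonmono (c *: 'X^k).
Proof.
move=> mono; case: (mono) => j lt_j; rewrite coefZ coefXn.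
have := nonmono_neq0 mono; rewrite scaler_eq0 negb_or => /andP[c1 _].
rewrite size_scale // size_polyXn /= in lt_j.
by rewrite (ltn_eqF lt_j) mulr0 eqxx.
Qed.

Lemma nonmono_root f : nonmono f -> exists2 z, z != 0 & root f z.
Proof.
move=> mono; have f0 := nonmono_neq0 mono.
have [f1 rf1 fE] := mup_decomp 0 f0.
have [/size_poly1P[c _ f1E]|f1s] := boolP (size f1 == 1%N).
  by case: (@nonmonoXn c (mup 0 f)); rewrite -mul_polyC -f1E mulrC -['X]subr0 -polyC0 -fE.
have [z rz] := closed_rootP f1 f1s; exists z.
  by apply: contraTneq rz => ->.
by rewrite fE rootM rz orbT.
Qed.

(** A nonzero root of p is also a root of g, and a nonzero monomial has no such root. *)
Lemma eigen_nonmono w b p g : 0 < b -> pb c0 w b p g = p -> nonmono p -> nonmono g.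
Proof.
move=> b0 pg mono; have p0 := nonmono_neq0 mono.
have [z z0 rz] := nonmono_root mono.
have [//|gE] := nonmono_dec g; have g0 := eigen_neq0 p0 pg.
have mz : (0 < mup z p)%N by rewrite -root_mup.
have [e1 _] := eigen_order b0 p0 pg (ltn_addr _ mz).
have : root g z by rewrite root_mup // e1.
by rewrite gE rootE hornerZ hornerXn mulf_eq0 lead_coef_eq0 (negPf g0) expf_eq0 (negPf z0) andbF.
Qed.

(** Here p is a multiple of the N-th power of z' - z in the variable z', with z nonzero, and N z is
    nonzero in characteristic zero. Two support points of consecutive heights make s a difference of
    exponents of X. *)
Lemma full_mup_coef p z : nonmono p -> mup z p = (size p).-1 ->
  p`_(size p).-1 != 0 /\ p`_(size p).-2 != 0.
Proof.
move=> mono mz; have p0 := nonmono_neq0 mono.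
have lc0 : lead_coef p != 0 by rewrite lead_coef_eq0.
split=> //; have [p1 rp1 pE] := mup_decomp z p0.
have N0 : (0 < (size p).-1)%N by case: mono => j lt_j _; apply: leq_ltn_trans lt_j.
have s1 : (size p1).-1 = 0%N.
  by apply/eqP; rewrite -(eqn_add2l (mup z p)) -(size_mup_decomp p0 pE) addn0 mz.
have [c c1 p1E] : exists2 c, c != 0 & p1 = c%:P.
  apply/size_poly1P; have : (0 < size p1)%N.
    by rewrite size_poly_gt0; apply: contraNneq rp1 => ->; rewrite root0.
  by move: s1; case: (size p1) => [|[|]].
have z0 : z != 0.
  apply/eqP => z0; case: (@nonmonoXn c (mup z p)).
  by rewrite -mul_polyC -p1E mulrC -['X]subr0 -polyC0 -{1}z0 -pE.
have EN : ('X - z%:P) ^+ (size p).-1 = \prod_(y <- nseq (size p).-1 z) ('X - y%:P).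
  by rewrite big_nseq -Monoid.iteropE.
rewrite {1}pE mz p1E mulrC coefCM mulf_neq0 // EN.
rewrite -{2}(size_nseq (size p).-1 z) coefPn_prod_XsubC ?size_nseq -?lt0n //.
rewrite oppr_eq0 big_nseq -Monoid.iteropE.
by rewrite -[iterop _ _ _ _]/(z *+ _) -mulr_natr mulf_neq0 // natr_eq0_pchar0 // -lt0n.
Qed.

End NonzeroRoots.

(** * Chains *)

Lemma shift_lead (K : fieldType) (c0 : [pchar K] =i pred0) (lam : K) (s : rat)
    (rs : int * int) : 0 <= rs.1 + rs.2 -> rs.1%:~R * s < rs.2%:~R ->
  forall G : Wr c0, vW rs (shift lam s G) = vW rs G /\
    leadW rs (shift lam s G) = leadW rs G.
Proof.
move=> rs0 rss G; pose x : rat * rat := (rs.1%:~R, rs.2%:~R).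
have x0 : 0 <= x.1 + x.2 by rewrite /x /= -intrD ler0z.
have [->|G0] := eqVneq G 0; first by rewrite linear0.
have [a Ga [vG le_a]] := vW_attained rs G0.
have wlt : supp_in (fun b => wdeg x b < vW rs G) (shift lam s G - G).
  by apply: shift_sub_wlt => // b Gb; rewrite vG; apply: le_a.
have same b : vW rs G <= wdeg x b -> (shift lam s G)@_b = G@_b.
  move=> le_b; apply/eqP; rewrite -subr_eq0 -mcoeffB; apply/negP => /negP.
  by move/wlt; rewrite ltNge le_b.
have sa : (shift lam s G)@_a = G@_a by rewrite same // vG.
have vS : vW rs (shift lam s G) = vpt rs (ptW a).
  apply: vW_eq; rewrite ?sa // => b nb; rewrite leNgt -vG; apply/negP => lt_b.
  move: nb; rewrite same ?ltW // => /le_a; rewrite -vG leNgt.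
  by rewrite lt_b.
split; first by rewrite vS vG.
apply: lead_eq; rewrite vS ?vG // => b vb; apply: same.
by rewrite vG -vb.
Qed.

Section Chains.
Variables (K : closedFieldType) (c0 : [pchar K] =i pred0) (m n : nat).
Hypotheses (m1 : (1 < m)%N) (n1 : (1 < n)%N) (mn : coprime m n).
Local Notation W := (Wr c0).
Implicit Types (P Q F : Wq K) (s w u : rat) (l : nat) (rs : int * int).

Definition data_ok l P Q rs :=
  (0 < l)%N /\ inV rs /\ inWl l P /\ inWl l Q.

Definition node_ok P Q rs :=
  commW Q P = oneW K /\
  vpt (1, -1) (enW rs P) < 0 /\
  vpt (1, -1) (enW rs Q) < 0 /\
  inVal rs P /\ inVal rs Q /\
  0 < vW rs P /\ 0 < vW rs Q /\
  vW rs P / vW rs Q = m%:R / n%:R /\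
  enW rs P = (m%:R / n%:R * (enW rs Q).1, m%:R / n%:R * (enW rs Q).2).

Definition map_ok l l' P P' Q Q' rs (phi : Wq K -> Wq K) :=
  l' = lcmn l `|rs.1|%N /\ isAutWl l' phi /\ P' = phi P /\ Q' = phi Q.

Definition link_ok l P P' Q Q' rs rs' :=
  ltV rs' rs /\
  vW rs P' = vW rs P /\
  vW rs Q' = vW rs Q /\
  (forall rs2 : int * int, inV rs2 -> ltV rs rs2 ->
     leadW rs2 P' = leadW rs2 P /\ leadW rs2 Q' = leadW rs2 Q) /\
  enW rs' P' = stW rs P' /\
  (exists F : Wq K,
     inWl l F /\ homogW rs F /\ (1 < size (msupp F))%N /\
     vW rs F = (rs.1 + rs.2)%:~R /\
     commRS rs P F = leadW rs P /\
     (enW rs F = (1, 1) -> stW rs P' = enW rs P)).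

Let n0 : 0 < n%:R :> rat. Proof. by rewrite ltr0n ltnW. Qed.
Let m0 : 0 < m%:R :> rat. Proof. by rewrite ltr0n ltnW. Qed.

Lemma enW_stage s w P : 0 < 1 + s -> sbound s w P -> layer s w P != 0 ->
  enW (dir s) P = (w - s * (size (layer s w P)).-1%:R, (size (layer s w P)).-1%:R).
Proof.
move=> s1 bP p0; set N := (size (layer s w P)).-1.
by apply: (@enW_edge _ _ _ (w - s * N%:R, N)); rewrite ?sdeg_line //=
  prednK // size_poly_gt0.
Qed.

Lemma node_of_stage s (P Q : W) w u : stage m n s P Q w u ->
  nonmono (layer s w P) -> nonmono (layer s u Q) -> node_ok P Q (dir s).
Proof.
move=> st monoP monoQ; have p0 := stage_p0 m1 n1 mn st; have q0 := stage_q0 m1 n1 mn st.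
have [s1 QP bP bQ w0 u0 wu sz en] := st.
have enq := stage_en_q n1 st.
rewrite /node_ok (enW_stage s1 bP p0) (enW_stage s1 bQ q0).
rewrite (vW_layer bP p0) (vW_layer bQ q0) (inVal_layer s1 bP monoP) (inVal_layer s1 bQ monoQ).
move: sz en enq; move: (size _).-1 => N; move: (size _).-1 => M sz en enq.
split; first by rewrite commWq QP addrC addKr.
split; first by rewrite /vpt /=; lra.
split; first by rewrite /vpt /=; lra.
do 2!split=> //; split; first by rewrite mulr_gt0 ?den_gt0.
split; first by rewrite mulr_gt0 ?den_gt0.
have szR : n%:R * N%:R = m%:R * M%:R :> rat by rewrite -!natrM sz.
have n0' : n%:R != 0 :> rat by rewrite gt_eqF.
split.
  rewrite -mulf_div divff ?mul1r; last by rewrite gt_eqF ?den_gt0.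
  have u0' : u != 0 by rewrite gt_eqF.
  by apply/eqP; rewrite eqr_div // mulrC wu.
have H x y : n%:R * x = m%:R * y -> x = m%:R / n%:R * y :> rat.
  by move=> E; rewrite mulrAC -E mulrC mulKf.
congr (_, _); apply: H => //; rewrite !mulrBr wu; congr (_ - _).
by rewrite mulrCA szR mulrCA.
Qed.

Lemma commRS_stage s (P Q : W) w u : stage m n s P Q w u ->
  commRS (dir s) Q P = if w + u == 1 + s then oneW K else 0.
Proof.
move=> st; have p0 := stage_p0 m1 n1 mn st; have q0 := stage_q0 m1 n1 mn st.
have sum := stage_sum st; have [s1 QP bP bQ w0 u0 wu sz en] := st.
have l1 : layer s 0 (oneW K) != 0 by rewrite layer1 oner_eq0.
have b1 := @sbound1 K s.
rewrite /commRS commWq QP [P * Q + 1]addrC addrK -[1]/(oneW K) (negPf (oneW_neq0 K)).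
rewrite (vW_layer b1 l1) (vW_layer bP p0) (vW_layer bQ q0) dir_sum /=.
rewrite -mulrDr -mulrBr ltr_pM2l ?den_gt0 // subr_gt0 [u + w]addrC.
have [E|ne] := eqVneq (w + u) (1 + s); last by rewrite lt_neqAle eq_sym ne sum.
rewrite E ltxx; apply/malgP => a; rewrite mcoeff_lead dirE (vW_layer b1 l1) mulr0.
case: eqP => // ne; rewrite /oneW mcoeffU; case: eqP => // aE.
by case: ne; rewrite -aE sdegX mulr0.
Qed.

(** The element F is the homogeneous lift of the solution g; its exponents lie in (1/l)Z thanks to
    the projection of g. *)
Lemma link_of_next s (P Q : W) w u l (g : {poly K}) lam s' A :
  stage m n s P Q w u -> nonmono (layer s w P) ->
  pb c0 w (1 + s) (layer s w P) g = layer s w P ->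
  psupp (fun j => l%:R * (1 + s - s * j%:R) \is a Num.int) g ->
  0 < 1 + s' -> s' < s -> corner s (shift lam s P) A ->
  A = (w - s * A.2%:R, A.2) ->
  (size g = 2%N -> A.2 = (size (layer s w P)).-1) ->
  sbound s' (sdeg s' A) (shift lam s P) ->
  size (layer s' (sdeg s' A) (shift lam s P)) = A.2.+1 ->
  link_ok l P (shift lam s P) Q (shift lam s Q) (dir s) (dir s').
Proof.
move=> st monoP pg Sg s'1 lt_s cP AE sg2 bP' sP'.
have p0 := stage_p0 m1 n1 mn st; have q0 := stage_q0 m1 n1 mn st.
have [s1 QP bP bQ w0 u0 wu sz en] := st.
have vE (G : W) v : sbound s v G -> layer s v G != 0 ->
    vW (dir s) (shift lam s G) = vW (dir s) G.
  move=> bG lG; have [bG' lG'] := layer_shift s1 lam bG.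
  rewrite (vW_layer bG lG) (vW_layer bG') // lG' comp_poly_eq0 //.
  by rewrite size_XaddC.
split; first by rewrite ltV_dir2.
split; first exact: vE bP p0.
split; first exact: vE bQ q0.
split.
  move=> rs2 /andP[_ rs2_gt]; rewrite ltV_dir => rs2s.
  have leadE := @shift_lead _ c0 lam s rs2 (ltW rs2_gt) rs2s.
  by split; [exact: (leadE P).2 | exact: (leadE Q).2].
split; first by rewrite (enW_edge s'1 bP' sP') (stW_corner s1 cP).
have g0 := eigen_neq0 p0 pg.
have monog := eigen_nonmono s1 pg monoP.
set F := homog s (1 + s) g; exists F.
have bF : sbound s (1 + s) F by exact: homog_sbound.
have lF : layer s (1 + s) F = g by exact: layer_homog.
have lF0 : layer s (1 + s) F != 0 by rewrite lF.
split; first by apply/inWlP; apply: homog_supp => j /Sg.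
split; first exact: homogW_homog.
split.
  have : inVal (dir s) F by apply: (inVal_layer s1 bF); rewrite lF.
  move=> /andP[_] /leq_trans; apply.
  by rewrite size_filter count_size.
split; first by rewrite (vW_layer bF lF0) dir_sum.
split.
  have bC : sbound s w (commW P F).
    by have := sbound_comm c0 s1 bP bF; rewrite addrK.
  have lC : layer s w (commW P F) = layer s w P.
    by have := layer_comm c0 s1 bP bF; rewrite addrK lF -/(pb c0 w (1 + s) _ g) pg.
  have lC0 : layer s w (commW P F) != 0 by rewrite lC.
  have C0 : commW P F != 0 by apply: contraNneq lC0 => ->; rewrite linear0.
  rewrite /commRS (negPf C0) (vW_layer bC lC0) (vW_layer bP p0) (vW_layer bF lF0).
  rewrite dir_sum addrK ltxx /=; exact: (layer_lead bC bP lC0 lC).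
rewrite (enW_stage s1 bF lF0) lF => -[_ sg].
(* en(F) has height deg g, so en(F) = (1, 1) makes g linear and lam the only root of p; then the
   starting point has full height. *)
have sg2' : size g = 2%N.
  have : ((size g).-1 == 1)%N by rewrite -(eqr_nat rat) sg.
  by case: (size g) => [|[|[]]].
rewrite (stW_corner s1 cP) (enW_stage s1 bP p0) -(sg2 sg2') /ptA.
by rewrite {1}AE.
Qed.

(** The initial data are parameters, so that a chain can be extended at its front. *)
Definition chain_from l P Q rs0 :=
  exists (nu : nat) (ls : nat -> nat) (Pj Qj : nat -> Wq K)
         (rs : nat -> (int * int)%type) (phi : nat -> Wq K -> Wq K),
    [/\ ls 0%N = l /\ rs 0%N = rs0, Pj 0%N = P /\ Qj 0%N = Q,
        forall j, (j <= nu)%N ->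
          data_ok (ls j) (Pj j) (Qj j) (rs j) /\ node_ok (Pj j) (Qj j) (rs j),
        forall j, (1 <= j <= nu)%N ->
          map_ok (ls j.-1) (ls j) (Pj j.-1) (Pj j) (Qj j.-1) (Qj j) (rs j.-1) (phi j) /\
          link_ok (ls j.-1) (Pj j.-1) (Pj j) (Qj j.-1) (Qj j) (rs j.-1) (rs j) &
        (forall j, (j < nu)%N -> commRS (rs j) (Qj j) (Pj j) = 0) /\
        commRS (rs nu) (Qj nu) (Pj nu) = oneW K].

Lemma chain_cons l l' P P' Q Q' rs rs' phi : data_ok l P Q rs -> node_ok P Q rs ->
  map_ok l l' P P' Q Q' rs phi -> link_ok l P P' Q Q' rs rs' ->
  commRS rs Q P = 0 -> chain_from l' P' Q' rs' -> chain_from l P Q rs.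
Proof.
move=> dok nok mok lok c [nu [ls [Pj [Qj [rss [phis [[l0 r0] [P0 Q0] nodes links [cs cnu]]]]]]]].
pose ext T (x : T) (f : nat -> T) (j : nat) := if j is k.+1 then f k else x.
exists nu.+1, (ext _ l ls), (ext _ P Pj), (ext _ Q Qj), (ext _ rs rss).
(* Automorphisms are indexed by their targets, starting from 1; the value at 0 is a filler. *)
exists (fun j => if j is (_.+1 as k).+1 then phis k else phi).
split; [by split | by split | | | split; last exact: cnu].
- case=> [|j] le_j; [by split | exact: (nodes j le_j)].
- case=> [|[|j]] le_j; [by [] | | exact: (links j.+1 le_j)].
  by rewrite /= l0 P0 Q0 r0; split.
- by case=> [|j] lt_j; [exact: c | exact: (cs j lt_j)].
Qed.

(** Lexicographic induction: k exceeds deg p and r exceeds l (1 + s). When the degree drops, r is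
    chosen anew, since l may have grown. *)
Lemma chain_exists k r s l (P Q : W) w u : stage m n s P Q w u ->
  nonmono (layer s w P) -> nonmono (layer s u Q) ->
  (0 < l)%N -> inWl l P -> inWl l Q ->
  ((size (layer s w P)).-1 < k)%N -> l%:R * (1 + s) < r%:R ->
  chain_from l P Q (dir s).
Proof.
elim: k r s l P Q w u => // k IHk; elim=> [|r IHr] s l P Q w u st monoP monoQ l0 WP WQ lt_k lt_r.
  have s1 := stage_s st.
  have : 0 < l%:R * (1 + s) by rewrite mulr_gt0 // ltr0n.
  by move: lt_r; lra.
have s1 := stage_s st; have p0 := nonmono_neq0 monoP.
have nok := node_of_stage st monoP monoQ; have cE := commRS_stage st.
have dok : data_ok l P Q (dir s) by split=> //; split=> //; apply: dir_inV.
(* Equality is the case in which the leading bracket is 1: the chain stops with nu = 0. *)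
have [sumE|sumN] := eqVneq (w + u) (1 + s).
  exists 0%N, (fun=> l), (fun=> P), (fun=> Q), (fun=> dir s), (fun=> id).
  split; [by split | by split | by move=> j _; split | by case=> [|j] /andP[] |].
  by split=> //; rewrite cE sumE eqxx.
have lt_sum : 1 + s < w + u by rewrite lt_neqAle eq_sym sumN (stage_sum st).
have [g [lam [s']]] := stage_next m1 n1 mn st lt_sum WP; lazy zeta.
set t := mup lam (layer s w P); set e := mup lam (layer s u Q).
set A := (_, t); set B := (_, e).
move=> [[pg Sg] [lt_s cA] [sg2 t0] [st' [monoP' monoQ']] [sP' sQ']].
have s'1 := stage_s st'; have bP' := stage_bP st'.
pose l' := lcmn l `|denq s|%N.
have l'0 : (0 < l')%N by rewrite lcmn_gt0 l0 absz_gt0 denq_neq0.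
have l's : l'%:R * s \is a Num.int.
  by rewrite -denq_dvdE dvdzE /= dvdn_lcmr.
have sub_l (G : Wq K) : inWl l G -> inWl l' G.
  move=> /inWlP WG; apply/inWlP => a /WG; rewrite /SWl => la.
  have /dvdnP[q ->] : (l %| l')%N by exact: dvdn_lcml.
  by rewrite natrM -mulrA rpredM ?rpred_nat.
have WP' : inWl l' (shift lam s P) by apply: shift_Wl => //; apply: sub_l.
have WQ' : inWl l' (shift lam s Q) by apply: shift_Wl => //; apply: sub_l.
have lok := link_of_next st monoP pg Sg s'1 lt_s cA (erefl _) sg2 bP' sP'.
apply: (chain_cons (l' := l') (phi := shift lam s) dok nok _ lok).
- by split=> //; split=> //; apply: shift_autWl.
- by rewrite cE (negPf sumN).
have le_tN : (t <= (size (layer s w P)).-1)%N by exact: mup_le_size.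
have [tN|ne_tN] := eqVneq t (size (layer s w P)).-1; last first.
  apply: (IHk (Num.bound (l'%:R * (1 + s'))) s' l' _ _ _ _ st') => //.
    by rewrite sP' /=; rewrite ltnS in lt_k; apply: leq_trans lt_k; rewrite ltn_neqAle ne_tN.
  apply: le_lt_trans (archi_boundP _); rewrite ?ler_norm //.
  by rewrite mulr_ge0 ?ler0n // ltW.
have ls : l%:R * s \is a Num.int.
  have [c1 c2] := full_mup_coef c0 monoP tN.
  set N := (size (layer s w P)).-1 in c1 c2 tN.
  have N0 : (0 < N)%N by rewrite -tN.
  move/inWlP: WP => WP; rewrite !coef_layer in c1 c2.
  have := rpredB (WP _ c2) (WP _ c1); rewrite /= -mulrBr.
  have -> // : w - s * N.-1%:R - (w - s * N%:R) = s.
  by rewrite -subn1 natrB //; ring.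
have l'l : l' = l.
  by apply/lcmn_idPl; move: ls; rewrite -denq_dvdE dvdzE.
rewrite l'l in WP' WQ' *; apply: (IHr s' l _ _ _ _ st' monoP' monoQ') => //.
  by rewrite sP' /= tN.
have /intrP[v vE] : l%:R * (1 + s) \is a Num.int.
  by rewrite mulrDr mulr1 rpredD ?rpred_nat.
(* As l (1 + s) is an integer below r + 1, it is at most r, and l (1 + s') is strictly smaller,
   hence below r. *)
have lt_v : v + 1 <= r.+1%:Z by rewrite lezD1 -(ltr_int rat) -vE.
have : l%:R * (1 + s') < l%:R * (1 + s) by rewrite ltr_pM2l ?ltr0n // ltrD2l.
have : (v + 1)%:~R <= (r.+1%:Z)%:~R :> rat by rewrite ler_int.
rewrite intrD -vE -[(r.+1%:Z)%:~R]/(r.+1%:R) -natr1; lra.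
Qed.

End Chains.

(** * The start of the chain *)

Section Automorphisms.
Variable K : fieldType.
Implicit Types (f g : Wq K -> Wq K) (p q : Wq K).

Lemma isAutW_id : isAutW (@id (Wq K)).
Proof. by split=> //; split=> // q Wq; exists q. Qed.

Lemma isAutW_comp f g : isAutW f -> isAutW g -> isAutW (f \o g).
Proof.
move=> [[fW [fD [fZ [fM f1]]]] [fS fI]] [[gW [gD [gZ [gM g1]]]] [gS gI]].
split; first split; first by move=> p Wp /=; apply/fW/gW.
- split; first by move=> p q Wp Wq /=; rewrite gD // fD // gW.
  split; first by move=> c p Wp /=; rewrite gZ // fZ // gW.
  split; first by move=> p q Wp Wq /=; rewrite gM // fM // gW.
  by rewrite /= g1 f1.
split.
  move=> q /fS[p [Wp <-]]; have [r [Wr <-]] := gS p Wp; by exists r.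
by move=> p q Wp Wq /= /fI fE; apply: gI => //; apply: fE; apply: gW.
Qed.

End Automorphisms.

Section WeylStages.
Variables (K : closedFieldType) (c0 : [pchar K] =i pred0) (m n : nat).
Hypotheses (m1 : (1 < m)%N) (n1 : (1 < n)%N) (mn : coprime m n).
Local Notation W := (Wr c0).
Implicit Types (P Q : W) (s w u : rat).

Lemma weyl_coef P a : inWeyl P -> P@_a != 0 -> exists i : nat, a.1 = i%:R.
Proof. by move=> /inWeylP WP /WP /isNP. Qed.

Lemma weyl_layer_coef s w P j : inWeyl P -> (layer s w P)`_j != 0 ->
  exists i : nat, w - s * j%:R = i%:R.
Proof. by move=> WP; rewrite coef_layer => /(weyl_coef WP). Qed.

Lemma not_dvd_mn : ~~ (m %| n)%N /\ ~~ (n %| m)%N.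
Proof.
split; apply/negP.
  by move=> /gcdn_idPl E; move: mn m1; rewrite /coprime E => /eqP ->.
by move=> /gcdn_idPr E; move: mn n1; rewrite /coprime E => /eqP ->.
Qed.

(** With equality, the constant coefficient u p_1 q_0 - w p_0 q_1 of the bracket is -1, so one
    product is nonzero. If it is p_1 q_0, then u and w - s are natural numbers, which forces u = 1
    and w = s; this leaves deg p = 1, so m divides n. The other case is symmetric. *)
Lemma weyl_stage_sum s P Q w u : stage m n s P Q w u -> inWeyl P -> inWeyl Q ->
  1 + s < w + u.
Proof.
move=> st WP WQ; rewrite lt_neqAle (stage_sum st) andbT eq_sym; apply/negP => /eqP sumE.
have p0 := stage_p0 m1 n1 mn st; have q0 := stage_q0 m1 n1 mn st.
have sp := stage_size_p m1 n1 mn st; have sq := stage_size_q m1 n1 mn st.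
have [ndm ndn] := not_dvd_mn.
have /(congr1 (fun f : {poly K} => f`_0)) := stage_pb st.
rewrite sumE eqxx coefN coef1 /= coefB !coefZ !coef0M coef_deriv [_^`()`_0]coef_deriv.
have [s1 QP bP bQ w0 u0 wu sz en] := st.
move: p0 q0 sp sq sz.
set p := layer s w P; set q := layer s u Q => p0 q0 sp sq sz E.
(* The end point has abscissa s (1 - deg f), which must be nonnegative. *)
have key (G : W) v (f := layer s v G) : inWeyl G -> v = s -> f != 0 -> 0 < v ->
    ((size f).-1 <= 1)%N.
  move=> WG vs f0 v0; have : f`_(size f).-1 != 0 by rewrite -lead_coefE lead_coef_eq0.
  case/(weyl_layer_coef WG)=> i; rewrite -vs -{1}[v]mulr1 -mulrBr => iE.
  rewrite -(ler_nat rat) -subr_ge0 -(pmulr_rge0 _ v0) iE.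
  exact: ler0n.
have [pq0|pq0] := eqVneq (p`_0 * q`_1) 0.
  have : p`_1 * q`_0 != 0.
    apply/negP => /eqP pq1; move: E; rewrite !mulr1n pq0 pq1 !mulr0 subrr => /esym/eqP.
    by rewrite oppr_eq0 oner_eq0.
  rewrite mulf_eq0 negb_or => /andP[/(weyl_layer_coef WP)[i iE] /(weyl_layer_coef WQ)[j jE]].
  rewrite mulr0n mulr0 subr0 in jE; rewrite mulr1n mulr1 in iE.
  have j1 : 1 <= u by move: u0; rewrite jE ltr0n ler1n.
  have i0 : 0 <= w - s by rewrite iE ler0n.
  have ws : w = s by move: sumE j1 i0; lra.
  have N1 : (size p).-1 = 1%N by have := key P w WP ws p0 w0; rewrite -/p; case: (size p) sp => [|[|[|]]].
  case/negP: ndm; move: sz; rewrite N1 muln1 => ->; exact: dvdn_mulr.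
move: pq0; rewrite mulf_eq0 negb_or => /andP[/(weyl_layer_coef WP)[i iE] /(weyl_layer_coef WQ)[j jE]].
rewrite mulr0n mulr0 subr0 in iE; rewrite mulr1n mulr1 in jE.
have j1 : 1 <= w by move: w0; rewrite iE ltr0n ler1n.
have i0 : 0 <= u - s by rewrite jE ler0n.
have us : u = s by move: sumE j1 i0; lra.
have N1 : (size q).-1 = 1%N by have := key Q u WQ us q0 u0; rewrite -/q; case: (size q) sq => [|[|[|]]].
by case/negP: ndn; move: sz; rewrite N1 muln1 => <-; exact: dvdn_mulr.
Qed.

(** Support points (i, j) of the image satisfy r i + j <= N with r > 1, so i + j = N only at (0, N),
    and there the root z makes the coefficient vanish. *)
Lemma weyl_reduce (z : K) r (N : nat) w P : (1 < r)%N -> z != 0 ->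
  inWeyl P -> sbound r%:R^-1 w P -> N%:R = r%:R * w ->
  (size (layer r%:R^-1 w P)).-1 = N -> root (layer r%:R^-1 w P) z -> layer r%:R^-1 w P != 0 ->
  vW (1, 1) (shear (z ^- r) r P : Wq K) < vW (1, 1) P.
Proof.
move=> r1 z0 WP bP NE sz rz p0; have r0 := ltnW r1.
have P0 : P != 0 by apply: contraNneq p0 => ->; rewrite linear0.
have [bP' top] := shear_top z0 r0 NE WP bP.
rewrite (rootP rz) mulr0 in top.
have WP' := shear_Weyl (z ^- r) r WP; set P' : W := shear _ _ _ in bP' top WP' *.
have P'0 : P' != 0.
  by apply: contraNneq P0 => P'0; rewrite -(shearK (z ^- r) r WP) -/P' P'0 linear0.
have rR : 0 < r%:R :> rat by rewrite ltr0n.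
have [a P'a [-> _]] := vW_attained (1, 1) P'0.
have PN : P@_(0, N) != 0.
  have -> : (0 : rat, N) = (w - r%:R^-1 * N%:R, N).
    by rewrite NE mulKf ?subrr // gt_eqF.
  by rewrite -coef_layer -sz -lead_coefE lead_coef_eq0.
apply: lt_le_trans (vW_ge (1, 1) PN).
have [i ai] := weyl_coef WP' P'a.
have := bP' a P'a; rewrite /sdeg ai -(ler_pM2l rR) mulrDr mulVKf ?gt_eqF // -NE.
rewrite -natrM -natrD ler_nat => le_N.
rewrite /vpt /ptW ai /= !mul1r add0r -natrD ltr_nat ltn_neqAle.
have {}le_N : (2 * i + a.2 <= N)%N.
  by apply: leq_trans le_N; rewrite leq_add2r leq_mul2r r1 orbT.
apply/andP; split; first last.
  by apply: leq_trans le_N; rewrite leq_add2r mul2n -addnn leq_addr.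
apply/negP => /eqP iN; have i0 : i = 0%N.
  apply/eqP; rewrite -leqn0 -(leq_add2r (i + a.2)) add0n {2}iN addnA addnn -mul2n.
  exact: le_N.
have aE : a = (0, N) by rewrite [a]surjective_pairing ai i0 -iN i0.
by move: P'a; rewrite aE top eqxx.
Qed.

Lemma weyl_slope_pos s P Q w u : stage m n s P Q w u ->
  nonmono (layer s w P) -> nonmono (layer s u Q) -> inWeyl P -> inWeyl Q ->
  0 < s -> s < 1 -> exists phi : Wq K -> Wq K, [/\ isAutW phi,
    vW (1, 1) (phi P) < vW (1, 1) P & vW (1, 1) (phi Q) < vW (1, 1) Q].
Proof.
move=> st monoP monoQ WP WQ s0 s_lt1; have sum := weyl_stage_sum st WP WQ.
have WlP : inWl 1 P by apply/inWlP => a; move/inWeylP: WP => WP /WP; apply: SW_SWl.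
have p0 := nonmono_neq0 monoP; have q0 := nonmono_neq0 monoQ.
have pb0 := stage_pb0 st sum.
have [g [lam [s']]] := stage_next m1 n1 mn st sum WlP; lazy zeta.
set t := mup lam (layer s w P) => -[[pg Sg] _ [sg2 t0] _ _].
have [s1 QP bP bQ w0 u0 wu sz en] := st.
have g0 := eigen_neq0 p0 pg.
move: pb0 pg sg2 sz en; set p := layer s w P in p0 monoP t t0 *; set q := layer s u Q in q0 monoQ *.
move=> pb0 pg sg2 sz en.
set N := (size p).-1 in sg2 sz en; set M := (size g).-1.
(* A linear g would make p a multiple of a full power, with consecutive exponents, and s would be an
   integer. *)
have sg : (2 < size g)%N.
  rewrite ltn_neqAle eq_sym; apply/andP; split; last first.
    have [e1 _] := eigen_order s1 p0 pg (ltn_addr (mup lam g) t0).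
    have := mup_le_size lam g0; rewrite e1.
    by case: (size g) => [|[]].
  apply/eqP => /sg2 tN; have [c1 c2] := full_mup_coef c0 monoP tN.
  have [i iE] := weyl_layer_coef WP c1; have [j jE] := weyl_layer_coef WP c2.
  have N0 : (0 < N)%N by rewrite -tN.
  have sE : s = j%:R - i%:R.
    by rewrite -iE -jE -/N -[(size p).-2]/(N.-1) -subn1 natrB //; ring.
  have s_int : s \is a Num.int by rewrite sE rpredB ?rpred_nat.
  case/intrP: s_int => v vE; move: s0 s_lt1; rewrite vE ltr0z (ltrz1 rat).
  by clear; lia.
have EM := eigen_size w0 s1 p0 pg sg; rewrite -/N -/M in EM.
have gM : g`_M != 0 by rewrite -lead_coefE lead_coef_eq0.
have pN : p`_N != 0 by rewrite -lead_coefE lead_coef_eq0.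
have [i iE] := weyl_layer_coef WP pN.
have M2 : (1 < M)%N by rewrite /M; case: (size g) sg => [|[|[]]].
have N0 : (0 < N)%N by case: monoP => k lt_k _; apply: leq_ltn_trans lt_k.
have NR : 0 < N%:R :> rat by rewrite ltr0n.
have MR : 2 <= M%:R :> rat by rewrite (ler_nat _ 2).
(* This is the abscissa of en(F). It is an integer because F lies in W^(1), nonnegative because
   en(F) is parallel to en(P), and less than 1 because M > 1. Its vanishing gives s = 1/(M - 1) and
   puts en(P) on the y-axis. *)
have F0 : 1 + s - s * M%:R = 0.
  have ge0 : 0 <= 1 + s - s * M%:R.
    rewrite -(pmulr_rge0 _ NR).
    have -> : N%:R * (1 + s - s * M%:R) = M%:R * i%:R.
      by rewrite -iE; move: EM; lra.
    by rewrite mulr_ge0 ?ler0n.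
  have lt1 : 1 + s - s * M%:R < 1.
    have : s * 2 <= s * M%:R by rewrite ler_pM2l.
    by move: s0; lra.
  have /intrP[v vE] := Sg M gM; rewrite mul1r in vE.
  move: ge0 lt1; rewrite vE ler0z (ltrz1 rat) => ge0 lt1.
  by have -> : v = 0 by move: ge0 lt1; clear; lia.
pose r := M.-1; have r1R : s * r%:R = 1 by rewrite /r -subn1 natrB ?(ltnW M2) //; move: F0; lra.
have r0 : (0 < r)%N by rewrite /r; case: (M) M2 => [|[]].
have rR : r%:R != 0 :> rat by rewrite pnatr_eq0 -lt0n.
have sE : s = r%:R^-1 by apply: (mulIf rR); rewrite mulVf.
have r1 : (1 < r)%N.
  rewrite ltn_neqAle r0 andbT eq_sym; apply: contraTneq s_lt1 => rE.
  by rewrite sE rE invr1 ltxx.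
have wE : w = s * N%:R.
  have MR0 : M%:R != 0 :> rat by rewrite pnatr_eq0 -lt0n ltnW.
  apply: (mulIf MR0); rewrite -EM mulrAC; congr (_ * _).
  by move: F0; lra.
have szR : n%:R * N%:R = m%:R * (size q).-1%:R :> rat by rewrite -!natrM sz.
have uE : u = s * (size q).-1%:R.
  have mR : m%:R != 0 :> rat by rewrite pnatr_eq0 -lt0n ltnW.
  by apply: (mulfI mR); rewrite -wu wE mulrCA szR mulrCA.
(* Since the layers commute, a root of p is a root of q, so one shear lowers both degrees. *)
have [z z0 rz] := nonmono_root monoP.
have rzq : root q z.
  rewrite root_mup // lt0n; apply/eqP => e0.
  have := mup_pb0 z p0 q0 pb0; rewrite e0 mulr0n mulr0 => /eqP.
  rewrite mulf_eq0 (gt_eqF u0) pnatr_eq0 /= => /eqP mz0.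
  by move: rz; rewrite root_mup // mz0.
have NEp : N%:R = r%:R * w by rewrite wE mulrA [r%:R * s]mulrC r1R mul1r.
have NEq : (size q).-1%:R = r%:R * u by rewrite uE mulrA [r%:R * s]mulrC r1R mul1r.
exists (shear (c0 := c0) (z ^- r) r); split; first exact: shear_autW.
  by apply: (@weyl_reduce z r N w P) => //; rewrite -sE.
by apply: (@weyl_reduce z r (size q).-1 u Q) => //; rewrite -sE.
Qed.

End WeylStages.

Section Start.
Variables (K : closedFieldType) (c0 : [pchar K] =i pred0) (m n : nat).
Hypotheses (m1 : (1 < m)%N) (n1 : (1 < n)%N) (mn : coprime m n).
Local Notation W := (Wr c0).
Implicit Types (P Q : W) (s w u : rat).

Lemma endo_commutator (psi : Wq K -> Wq K) : isEndW psi ->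
  (psi (YW K) : W) * psi (XW K) = (psi (XW K) : W) * psi (YW K) + 1.
Proof.
move=> [_ [psiD [_ [psiM psi1]]]].
have WX : inWeyl (XW K) by apply/inWeylP; apply: supp_inU.
have WY : inWeyl (YW K) by apply/inWeylP; apply: supp_inU.
have YX : mulW (YW K) (XW K) = mulW (XW K) (YW K) + oneW K.
  have := YqXq c0 1; rewrite YqE XqE subrr Xq0 rmorph1 scale1r -!mulWq.
  by [].
rewrite -!mulWq -!psiM // YX psiD ?psi1 //; last exact: (inWeyl1 c0).
by have := @inWeylM K c0 (XW K) (YW K) WX WY; rewrite -mulWq.
Qed.

Lemma neq0_of_commutator P Q : Q * P = P * Q + 1 -> P != 0 /\ Q != 0.
Proof.
move=> QP; have one0 := oner_neq0 W.
by split; apply: contraNneq one0 => E; move: QP; rewrite E mulr0 mul0r add0r => <-.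
Qed.

Lemma dir1 : dir 1 = (1, 1). Proof. by []. Qed.

Lemma weyl_top P : inWeyl P -> P != 0 -> exists D : nat,
  [/\ vW (1, 1) P = D%:R, sbound 1 D%:R P & layer 1 D%:R P != 0].
Proof.
move=> WP P0; have [w bP lP] := sdeg_exists 1 P0.
have [a Pa da] := (layer_neq0P 1 w P).1 lP; have [i ai] := weyl_coef WP Pa.
have wE : w = (i + a.2)%:R by rewrite -da /sdeg ai mul1r natrD.
exists (i + a.2)%N; rewrite -wE; split=> //.
by rewrite -dir1 (vW_layer bP lP) mul1r.
Qed.

(** Exponents of X are nonnegative in W, so no support point on the line x + y = D is higher than
    (0, D). *)
Lemma weyl_size_top P (D : nat) : inWeyl P -> P@_(0, D) != 0 ->
  size (layer 1 D%:R P) = D.+1.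
Proof.
move=> WP PD; apply/eqP; rewrite eqn_leq; apply/andP; split.
  apply/leq_sizeP => j lt_j; apply/eqP/negP => /negP /(weyl_layer_coef WP)[i].
  have : (D%:R : rat) < j%:R by rewrite ltr_nat.
  have : (0 : rat) <= i%:R by rewrite ler0n.
  by rewrite mul1r => + + E; rewrite -E; lra.
rewrite ltnNge; apply/negP => /leq_sizeP /(_ D (leqnn _)) /eqP.
by rewrite coef_layer mul1r subrr (negPf PD).
Qed.

(** A root z of z f(z) - 1 is neither 0 nor a root of f. *)
Lemma nonroot_exists (f : {poly K}) : f != 0 -> exists2 z, z != 0 & f.[z] != 0.
Proof.
move=> f0; have /closed_rootP[z] : size (f * 'X - 1)%R != 1%N.
  rewrite size_polyDl ?size_mulX ?size_polyN ?size_poly1 ?ltnS ?size_poly_gt0 //.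
  by rewrite eqSS -lt0n size_poly_gt0.
rewrite rootE hornerD hornerN hornerMX hornerC subr_eq0 => /eqP fz.
by exists z; apply: contraTneq (oner_neq0 K) => E; rewrite -fz E ?mulr0 ?mul0r eqxx.
Qed.

Lemma weyl_inWl P : inWeyl P -> inWl 1 P.
Proof. by move=> WP; apply/inWlP => a; move/inWeylP: WP => WP /WP; apply: SW_SWl. Qed.

Lemma first_stage P Q : inWeyl P -> inWeyl Q -> Q * P = P * Q + 1 ->
  2 <= vW (1, 1) P -> 2 <= vW (1, 1) Q ->
  vW (1, 1) P / vW (1, 1) Q = m%:R / n%:R ->
  exists (psi : Wq K -> Wq K) s w u (P' Q' : W),
    [/\ isAutW psi /\ (P' = psi P /\ Q' = psi Q), inWeyl P' /\ inWeyl Q',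
        vW (1, 1) P' = vW (1, 1) P /\ vW (1, 1) Q' = vW (1, 1) Q,
        stage m n s P' Q' w u /\ s < 1 &
        nonmono (layer s w P') /\ nonmono (layer s u Q')].
Proof.
move=> WP WQ QP d2 e2 ratio; have [P0 Q0] := neq0_of_commutator QP.
have [D [DE bP lP]] := weyl_top WP P0; have [E [EE bQ lQ]] := weyl_top WQ Q0.
rewrite DE in d2 *; rewrite EE in e2 *; rewrite DE EE in ratio.
(* A common non-root of both leading forms makes one linear shear produce Y^D and Y^E, which gives
   end points on the y-axis. *)
have pq0 : layer 1 D%:R P * layer 1 E%:R Q != 0 by rewrite mulf_neq0.
have [z z0] := nonroot_exists pq0; rewrite hornerM mulf_eq0 negb_or => /andP[pz qz].
have shearP (G : W) (k : nat) : inWeyl G -> sbound 1 k%:R G ->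
    (layer 1 k%:R G).[z] != 0 ->
    sbound 1 k%:R (shear (z ^- 1) 1 G) /\
    size (layer 1 k%:R (shear (z ^- 1) 1 G)) = k.+1.
  move=> WG bG gz.
  have kE : k%:R = 1%:R * k%:R :> rat by rewrite mul1r.
  have bG' : sbound 1%:R^-1 k%:R G by rewrite invr1.
  have [bS top] := shear_top z0 (isT : (0 < 1)%N) kE WG bG'.
  rewrite invr1 in bS top; split=> //; apply: weyl_size_top; first exact: shear_Weyl.
  by rewrite top mulf_neq0 // invr_eq0 expf_neq0.
set P1 : W := shear (z ^- 1) 1 P; set Q1 : W := shear (z ^- 1) 1 Q.
have WP1 : inWeyl P1 by exact: shear_Weyl.
have WQ1 : inWeyl Q1 by exact: shear_Weyl.
have [bP1 sP1] := shearP P D WP bP pz; have [bQ1 sQ1] := shearP Q E WQ bQ qz.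
rewrite -/P1 in bP1 sP1; rewrite -/Q1 in bQ1 sQ1.
have QP1 : Q1 * P1 = P1 * Q1 + 1.
  by rewrite -!shearM // QP linearD /= shear1.
have n0' : n%:R != 0 :> rat by rewrite pnatr_eq0 -lt0n ltnW.
have E0' : E%:R != 0 :> rat by apply: contraTneq e2 => ->.
have wu : n%:R * D%:R = m%:R * E%:R :> rat.
  by move/eqP: ratio; rewrite eqr_div // => /eqP <-; rewrite mulrC.
have nD : (n * D = m * E)%N by apply/eqP; rewrite -(eqr_nat rat) !natrM wu.
have st1 : stage m n 1 P1 Q1 D%:R E%:R.
  split=> //; rewrite ?sP1 ?sQ1 //=.
  - by apply: lt_le_trans d2.
  - by apply: lt_le_trans e2.
  - by move: d2; lra.
have sum : 1 + 1 < D%:R + E%:R :> rat by move: d2 e2; lra.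
have [g [lam [s]]] := stage_next m1 n1 mn st1 sum (weyl_inWl WP1); lazy zeta.
set A := (_, _); set B := (_, _).
move=> [_ [lt_s _] _ [st mono] _].
have lP1 : layer 1 D%:R P1 != 0 by rewrite -size_poly_gt0 sP1.
have lQ1 : layer 1 E%:R Q1 != 0 by rewrite -size_poly_gt0 sQ1.
have vE (G : W) (k : nat) : sbound 1 k%:R G -> layer 1 k%:R G != 0 ->
    vW (1, 1) (shift lam 1 G) = k%:R.
  move=> bG lG; have [bG' lG'] := layer_shift (ltr0Sn _ 1 : 0 < 1 + 1) lam bG.
  rewrite -dir1 (vW_layer bG') ?mul1r // lG' comp_poly_eq0 // size_XaddC.
  by [].
exists (shift (c0 := c0) lam 1 \o shear (c0 := c0) (z ^- 1) 1), s, (sdeg s A), (sdeg s B).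
exists (shift lam 1 P1), (shift lam 1 Q1); split=> //.
- split; last by split.
  by apply: isAutW_comp; [exact: (shift_autW c0 lam 1) | exact: shear_autW].
- by split; apply: (shift_Weyl lam 1).
- by rewrite (vE _ _ bP1 lP1) (vE _ _ bQ1 lQ1).
Qed.

End Start.

Theorem theorem6p1 (K : closedFieldType) (charK0 : [pchar K] =i pred0)
    (P Q : Wq K) (m n : nat) :
  irreducible_pair P Q -> (1 < m)%N -> (1 < n)%N -> coprime m n ->
  vW (1, 1) P / vW (1, 1) Q = m%:R / n%:R ->
  exists (nu : nat) (psi : Wq K -> Wq K) (l : nat -> nat)
         (Pj Qj : nat -> Wq K) (rs : nat -> (int * int)%type)
         (phi : nat -> Wq K -> Wq K),
    (* general data *)
    (0 < nu)%N /\ isAutW psi /\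
    Pj 0%N = psi P /\ Qj 0%N = psi Q /\ l 0%N = 1%N /\
    ltV (rs 0%N) (1, 0) /\
    vW (1, 1) (Pj 0%N) = vW (1, 1) P /\ vW (1, 1) (Qj 0%N) = vW (1, 1) Q /\
    (forall j, (j <= nu)%N ->
       (0 < l j)%N /\ inV (rs j) /\ inWl (l j) (Pj j) /\ inWl (l j) (Qj j)) /\
    (forall j, (1 <= j <= nu)%N ->
       l j = lcmn (l j.-1) `|(rs j.-1).1|%N /\ isAutWl (l j) (phi j) /\
       Pj j = phi j (Pj j.-1) /\ Qj j = phi j (Qj j.-1)) /\
    (* (1)-(6) *)
    (forall j, (j <= nu)%N ->
       commW (Qj j) (Pj j) = oneW K /\
       vpt (1, -1) (enW (rs j) (Pj j)) < 0 /\
       vpt (1, -1) (enW (rs j) (Qj j)) < 0 /\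
       inVal (rs j) (Pj j) /\ inVal (rs j) (Qj j) /\
       0 < vW (rs j) (Pj j) /\ 0 < vW (rs j) (Qj j) /\
       vW (rs j) (Pj j) / vW (rs j) (Qj j) = m%:R / n%:R /\
       enW (rs j) (Pj j) =
         (m%:R / n%:R * (enW (rs j) (Qj j)).1,
          m%:R / n%:R * (enW (rs j) (Qj j)).2)) /\
    (* (7)-(11) *)
    (forall j, (1 <= j <= nu)%N ->
       ltV (rs j) (rs j.-1) /\
       vW (rs j.-1) (Pj j) = vW (rs j.-1) (Pj j.-1) /\
       vW (rs j.-1) (Qj j) = vW (rs j.-1) (Qj j.-1) /\
       (forall rs2 : int * int, inV rs2 -> ltV (rs j.-1) rs2 ->
          leadW rs2 (Pj j) = leadW rs2 (Pj j.-1) /\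
          leadW rs2 (Qj j) = leadW rs2 (Qj j.-1)) /\
       enW (rs j) (Pj j) = stW (rs j.-1) (Pj j) /\
       (exists F : Wq K,
          inWl (l j.-1) F /\ homogW (rs j.-1) F /\ (1 < size (msupp F))%N /\
          vW (rs j.-1) F = ((rs j.-1).1 + (rs j.-1).2)%:~R /\
          commRS (rs j.-1) (Pj j.-1) F = leadW (rs j.-1) (Pj j.-1) /\
          (enW (rs j.-1) F = (1, 1) ->
             stW (rs j.-1) (Pj j) = enW (rs j.-1) (Pj j.-1)))) /\
    (* (12), (13) *)
    (forall j, (j < nu)%N -> commRS (rs j) (Qj j) (Pj j) = 0) /\
    commRS (rs nu) (Qj nu) (Pj nu) = oneW K.
Proof.
move=> [psi0 [endo [PE [QE [d2 [e2 irr]]]]]] m1 n1 mn ratio.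
have WP : inWeyl P.
  by rewrite PE; apply: (endo.1); apply/inWeylP; apply: supp_inU.
have WQ : inWeyl Q.
  by rewrite QE; apply: (endo.1); apply/inWeylP; apply: supp_inU.
have QP := endo_commutator charK0 endo; rewrite -PE -QE in QP d2 e2.
have [psi [s [w [u [P' [Q' [[aut [P'E Q'E]] [WP' WQ'] [vP vQ] [st s1] [monoP monoQ]]]]]]]] :=
  first_stage m1 n1 mn WP WQ QP d2 e2 ratio.
(* A negative slope is exactly the requirement (1, 0) > (rho_0, sigma_0). *)
suff [psi' [s' [w' [u' [P2 [Q2 [[aut' [P2E Q2E]] [WP2 WQ2] [vP2 vQ2] [st2 s'0] [mP mQ]]]]]]]] :
    exists (psi : Wq K -> Wq K) s w u (P' Q' : Wr charK0),
    [/\ isAutW psi /\ (P' = psi P /\ Q' = psi Q), inWeyl P' /\ inWeyl Q',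
        vW (1, 1) P' = vW (1, 1) P /\ vW (1, 1) Q' = vW (1, 1) Q,
        stage m n s P' Q' w u /\ s < 0 &
        nonmono (layer s w P') /\ nonmono (layer s u Q')].
  have lt_sum := weyl_stage_sum m1 n1 mn st2 WP2 WQ2.
  have := chain_exists (k := (size (layer s' w' P2)).-1.+1)
    (r := Num.bound (1%:R * (1 + s'))) m1 n1 mn st2 mP mQ (ltn0Sn 0)
    (weyl_inWl WP2) (weyl_inWl WQ2) (ltnSn _).
  case.
    apply: le_lt_trans (archi_boundP _); rewrite ?ler_norm // mul1r ltW //.
    exact: stage_s st2.
  move=> nu [ls [Pj [Qj [rs [phi [[l0 r0] [Pj0 Qj0] nodes links [cs cnu]]]]]]].
  exists nu, psi', ls, Pj, Qj, rs, phi.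
  split.
    (* For nu = 0 the leading bracket at the start would be 1, but in W it is 0. *)
    case: nu nodes links cs cnu => // _ _ _; rewrite r0 Pj0 Qj0.
    rewrite (commRS_stage m1 n1 mn st2) gt_eqF // => /eqP.
    by rewrite eq_sym (negPf (oneW_neq0 K)).
  split; first exact: aut'.
  rewrite Pj0 Qj0 r0 l0; split; first exact: P2E.
  split; first exact: Q2E.
  split; first by [].
  split; first by rewrite ltV_dir mul1r.
  split; first exact: vP2.
  split; first exact: vQ2.
  split; first by move=> j /nodes[].
  split; first by move=> j /links[].
  split; first by move=> j /nodes[].
  by split; first by move=> j /links[].
have [s_lt0|s_gt0|s0] := ltgtP s 0.
- by exists psi, s, w, u, P', Q'.
- have [phi [autphi ltP ltQ]] := weyl_slope_pos m1 n1 mn st monoP monoQ WP' WQ' s_gt0 s1.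
  case: irr; exists (phi \o psi), id; split; first exact: isAutW_comp.
  split; first exact: isAutW_id.
  by rewrite /= -PE -QE -P'E -Q'E -vP -vQ ltrD.
have sum := weyl_stage_sum m1 n1 mn st WP' WQ'.
have [g [lam [s']]] := stage_next m1 n1 mn st sum (weyl_inWl WP'); lazy zeta.
set A := (_, _); set B := (_, _); rewrite s0 in A B *.
move=> [_ [lt_s _] _ [st' mono] _].
(* Y |-> Y + lam preserves the total degrees, because (1, 1) lies above slope 0. *)
have vE := @shift_lead _ charK0 lam 0 (1, 1) isT isT.
exists (shift (c0 := charK0) lam 0 \o psi), s', (sdeg s' A), (sdeg s' B).
exists (shift lam 0 P'), (shift lam 0 Q'); split=> //.
- split; last by rewrite /= -P'E -Q'E.
  by apply: isAutW_comp => //; exact: (shift_autW charK0 lam 0).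
- by split; apply: (shift_Weyl lam 0).
- by rewrite (vE P').1 (vE Q').1.
Qed.
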